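(* Let $T$ be a weighted $\sigma$-HST of depth $\ell$. Suppose that for every $0\le \varepsilon\le 1$ there exists an online algorithm for the fractional allocation problem on weighted stars that is $(1+\varepsilon,\log(k/\varepsilon))$-competitive. Then there is an $O(\ell\log(k\ell))$-competitive online algorithm for the fractional $k$-server problem on (the leaves of) $T$, provided $\sigma=\Omega(\ell\log(k\ell))$ (i.e., provided $\sigma\ge c\,\ell\log(k\ell)$ for a suitable absolute constant $c$).
   Context: Weighted $\sigma$-HST: a rooted tree with positive edge lengths such that for every node $p$ that is neither the root nor a leaf, the length of the edge from $p$ to its parent is at least $\sigma$ times the length of the edge from $p$ to any of its children. The metric is the shortest-path metric on the leaves; the depth is the maximum number of edges on a root-to-leaf path. For a node $p$, $W(p)$ is the length of the edge from $p$ to its parent and $T(p)$ is the set of leaves of the subtree rooted at $p$. Fractional $k$-server problem on $T$: $k$ servers start at an initial configuration on the leaves. An online fractional algorithm maintains at each time $t$ values $p^t_i\in[0,1]$ for the leaves $i$ (the probability of a server at $i$) with $\sum_i p^t_i\le k$; when leaf $\rho(t)$ is requested at time $t$ it must have $p^t_{\rho(t)}=1$. Writing $k^t(j)=\sum_{i\in T(j)}p^t_i$, the cost at time $t$ is $\sum_{j} W(j)\,|k^t(j)-k^{t-1}(j)|$. Its competitive ratio is measured against the optimal (integral, offline) $k$-server cost on the request sequence. Fractional allocation problem on a weighted star: the star has leaves (locations) $1,\dots,d$, leaf $i$ at distance $w_i>0$ from the center; $\Delta$ denotes the diameter of this metric. At each time $t$ a quota $\kappa(t)\le k$ (a nonnegative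 integer) is given and a cost vector $h^t=(h^t(0),\dots,h^t(k))$ with $h^t(0)\ge h^t(1)\ge\dots\ge h^t(k)\ge0$ arrives at a location $i_t$. A fractional state consists of $x^t_{i,j}\ge0$ ($i\in[d]$, $j\in\{0,\dots,k\}$, the probability of exactly $j$ servers at $i$) with $\sum_j x^t_{i,j}=1$ for each $i$ and $\sum_i\sum_j j\,x^t_{i,j}\le\kappa(t)$. The hit cost at time $t$ is $\sum_j h^t(j)x^t_{i_t,j}$ and the movement cost is $\sum_i w_i\sum_{j=1}^k\big|\sum_{j'<j}x^t_{i,j'}-\sum_{j'<j}x^{t-1}_{i,j'}\big|$. An integral solution is one where all $x^t_{i,j}\in\{0,1\}$. With $g(\kappa)=\sum_t|\kappa(t)-\kappa(t-1)|$ and $\mathrm{OPT}$ the total (hit plus movement) cost of an optimal solution, an online algorithm is $(\theta,\gamma)$-competitive if its total hit cost is at most $\theta(\mathrm{OPT}+\Delta\, g(\kappa))$ and its total movement cost is at most $\gamma(\mathrm{OPT}+\Delta\,g(\kappa))$. *)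

(* Defs.v *)
From HB Require Import structures.
From mathcomp Require Import all_boot all_order all_algebra.
From mathcomp Require Import classical_sets boolp reals constructive_ereal exp.

Set Implicit Arguments.
Unset Strict Implicit.
Unset Printing Implicit Defensive.

Import Order.TTheory GRing.Theory Num.Theory.
Local Open Scope ring_scope.

(* The base of the logarithm is left as a parameter. *)
Definition logb (R : realType) (b x : R) : R := ln x / ln b.

(* log_b (k / eps), with value +oo at eps = 0. *)
Definition log_ratio (R : realType) (b : R) (k : nat) (eps : R) : \bar R :=
  if eps == 0 then +oo%E else (logb b (k%:R / eps))%:E.

(* A tree is given by its parent map; the root is its own parent, but there is
   no edge above it, so [weight (troot T)] is meaningless and never used. *)
Record weighted_tree (R : realType) := WeightedTree {
  node :> finType;
  troot : node;
  parent : node -> node;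
  weight : node -> R;
  parent_troot : parent troot = troot;
  reach_troot : forall p, exists n, iter n parent p == troot;
  weight_gt0 : forall p, p != troot -> 0 < weight p }.
Arguments troot {R} w.
Arguments parent {R w} _.
Arguments weight {R w} _.

Section Tree.
Context {R : realType} (T : weighted_tree R).

Definition is_child (q p : T) : bool := (q != troot T) && (parent q == p).

Definition is_leaf (p : T) : bool := [forall q : T, ~~ is_child q p].

Definition leaves := {p : T | is_leaf p}.

Definition level (p : T) : nat := ex_minn (reach_troot p).

Definition depth : nat := \max_(p : T | is_leaf p) level p.

Definition in_subtree (p q : T) : bool := fconnect (@parent R T) q p.

Definition is_hst (sigma : R) : Prop :=
  forall p : T, p != troot T -> ~~ is_leaf p ->
  forall q : T, is_child q p -> sigma * weight q <= weight p.

Definition adjacent (u v : T) : bool := is_child u v || is_child v u.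

Definition edge_length (u v : T) : R :=
  if is_child u v then weight u else weight v.

Fixpoint walk_length (u : T) (p : seq T) : R :=
  if p is v :: p' then edge_length u v + walk_length v p' else 0.

Definition tree_dist (u v : T) : R :=
  inf [set walk_length u p | p in
        [set p : seq T | path adjacent u p /\ last u p = v]]%classic.

End Tree.

Section KServer.
Context {R : realType} (T : weighted_tree R) (k : nat).

(* Integral offline schedules; [s t a] is the position of server [a] after the
   first [t] requests of [r]. *)
Definition schedule := nat -> 'I_k -> leaves T.

Definition serves (c0 : 'I_k -> leaves T) (r : seq (leaves T)) (s : schedule) :
    Prop :=
  s 0 =1 c0 /\
  forall t : 'I_(size r), exists a : 'I_k, s t.+1 a = tnth (in_tuple r) t.

Definition schedule_cost (r : seq (leaves T)) (s : schedule) : R :=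
  \sum_(t < size r) \sum_(a < k) tree_dist (val (s t a)) (val (s t.+1 a)).

Definition kserver_opt (c0 : 'I_k -> leaves T) (r : seq (leaves T)) : R :=
  inf [set schedule_cost r s | s in [set s : schedule | serves c0 r s]]%classic.

(* An online algorithm maps the requests seen so far (the current one last) to
   its current fractional configuration. *)
Definition kserver_alg := seq (leaves T) -> leaves T -> R.

Definition is_fractional_kserver (c0 : 'I_k -> leaves T) (A : kserver_alg) :
    Prop :=
  [/\ forall i, A [::] i = [exists a : 'I_k, c0 a == i]%:R,
      forall r i, 0 <= A r i <= 1,
      forall r, \sum_i A r i <= k%:R
    & forall r i, A (rcons r i) i = 1].

Definition mass (p : leaves T -> R) (j : T) : R :=
  \sum_(i : leaves T | in_subtree j (val i)) p i.

Definition kserver_cost (A : kserver_alg) (r : seq (leaves T)) : R :=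
  \sum_(t < size r) \sum_(j : T | j != troot T)
    weight j * `|mass (A (take t.+1 r)) j - mass (A (take t r)) j|.

(* As each leaf carries probability at most 1, the k servers start at distinct
   leaves; both the algorithm and the optimum start there. *)
Definition kserver_competitive (rho : R) : Prop :=
  forall c0 : 'I_k -> leaves T, injective c0 ->
  exists A : kserver_alg, is_fractional_kserver c0 A /\
    forall r, kserver_cost A r <= rho * kserver_opt c0 r.

End KServer.

Section Allocation.
Context {R : realType} (k d : nat).

Record request := Request {
  quota : 'I_k.+1;
  location : 'I_d;
  hit : 'I_k.+1 -> R;
  hit_noninc : forall j j' : 'I_k.+1, (j <= j')%N -> hit j' <= hit j;
  hit_ge0 : forall j, 0 <= hit j }.

Definition state := 'I_d -> 'I_k.+1 -> R.

Definition is_state (kappa : 'I_k.+1) (x : state) : Prop :=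
  [/\ forall i j, 0 <= x i j,
      forall i, \sum_j x i j = 1
    & \sum_i \sum_(j < k.+1) j%:R * x i j <= kappa%:R].

Definition is_integral (x : state) : Prop :=
  forall i j, x i j = 0 \/ x i j = 1.

(* A trajectory [x] has [x 0] as initial state and [x t] as the state in force
   when the t-th request (counted from 1) is charged. *)
Definition feasible (x0 : state) (s : seq request) (x : nat -> state) : Prop :=
  x 0 =2 x0 /\
  forall t : 'I_(size s), is_state (quota (tnth (in_tuple s) t)) (x t.+1).

Definition hit_cost (s : seq request) (x : nat -> state) : R :=
  \sum_(t < size s) let q := tnth (in_tuple s) t in
    \sum_(j < k.+1) hit q j * x t.+1 (location q) j.

Definition below (x : state) (i : 'I_d) (j : 'I_k.+1) : R :=
  \sum_(j' < k.+1 | (j' < j)%N) x i j'.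

Definition movement_cost (w : 'I_d -> R) (s : seq request) (x : nat -> state) :
    R :=
  \sum_(t < size s) \sum_(i < d) w i *
    \sum_(j < k.+1 | (0 < j)%N) `|below (x t.+1) i j - below (x t) i j|.

Definition alloc_opt (w : 'I_d -> R) (x0 : state) (s : seq request) : R :=
  inf [set hit_cost s x + movement_cost w s x | x in
        [set x : nat -> state | feasible x0 s x /\
           forall t : 'I_(size s), is_integral (x t.+1)]]%classic.

Definition quota_at (kappa0 : 'I_k.+1) (s : seq request) (t : nat) : 'I_k.+1 :=
  nth kappa0 (kappa0 :: map quota s) t.

Definition quota_var (kappa0 : 'I_k.+1) (s : seq request) : R :=
  \sum_(t < size s)
    `|(quota_at kappa0 s t.+1)%:R - (quota_at kappa0 s t)%:R|.

(* The center of the star is the point [None]. *)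
Definition star_dist (w : 'I_d -> R) (u v : option 'I_d) : R :=
  if u == v then 0 else oapp w 0 u + oapp w 0 v.

Definition star_diam (w : 'I_d -> R) : R :=
  \big[Num.max/0]_(u : option 'I_d) \big[Num.max/0]_(v : option 'I_d)
    star_dist w u v.

Definition alloc_bound (w : 'I_d -> R) (kappa0 : 'I_k.+1) (x0 : state)
    (s : seq request) : R :=
  alloc_opt w x0 s + star_diam w * quota_var kappa0 s.

Definition alloc_alg := seq request -> state.

Definition run (A : alloc_alg) (s : seq request) : nat -> state :=
  fun t => A (take t s).

End Allocation.
Arguments request : clear implicits.
Arguments state : clear implicits.
Arguments alloc_alg : clear implicits.

Definition alloc_competitive (R : realType) (k : nat) (theta : R)
    (gamma : \bar R) : Prop :=
  forall (d : nat) (w : 'I_d -> R), (forall i, 0 < w i) ->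
  forall (kappa0 : 'I_k.+1) (x0 : state R k d),
  is_state kappa0 x0 -> is_integral x0 ->
  exists A : alloc_alg R k d, forall s : seq (request R k d),
    [/\ feasible x0 s (run A s),
        hit_cost s (run A s) <= theta * alloc_bound w kappa0 x0 s
      & ((movement_cost w s (run A s))%:E <=
         gamma * (alloc_bound w kappa0 x0 s)%:E)%E].

(* Main.v *)
(** For a node [p] let [h(j)] be the increase, caused by one request, of the
    optimal cost of serving [T(p)] with a constant number [j] of servers.  The
    offline problem on [T(p)] is an integral min-cost flow in time; exchanging
    one unit along a conformal augmenting path shows that [h] is nonincreasing,
    and that for every quota path [kappa] the optimal cost of [T(p)] under
    [kappa] differs from the sum of the [h(kappa(t))] by at most
    [O(W(p) / sigma)] times the variation of [kappa].  Hence the star below [p],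
    with the vectors [h] of the children as hit costs, is an allocation problem
    whose optimum is at most [1 + 2 / sigma] times the cost of [T(p)].

    The algorithm runs the allocation algorithm at every internal node.  The
    quotas of a node are random: their law at time [t] is the fractional state
    of the parent, and consecutive laws are joined by the monotone coupling, so
    that the expected variation of the quota is the movement cost charged by
    the parent.  Passing from one level to the next multiplies the potential
    (expected subtree cost plus diameter times quota variation) by
    [1 + O(1 / l)] for [eps = 1 / l], and every level contributes a movement
    cost of at most [O(log (k l))] times that potential.

    A request to a leaf without server costs a large constant instead of being
    infeasible.  The expected counts obtained in this way need
    not fill all quotas and may miss a requested leaf by a small amount; the
    actual configuration follows them lazily, with the transport distance to
    them as potential function, and the misses are paid by the hit costs. *)

Require Import Defs.
From HB Require Import structures.
From mathcomp Require Import all_boot all_order all_algebra.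
From mathcomp Require Import classical_sets boolp reals constructive_ereal exp.
From mathcomp Require Import zify ring lra.

Set Implicit Arguments.
Unset Strict Implicit.
Unset Printing Implicit Defensive.

Import Order.TTheory GRing.Theory Num.Theory.
Local Open Scope ring_scope.

(** * Rooted trees *)

(** An allocation algorithm accepts integral quotas only, while a parent hands down a distribution.
    Each child therefore follows a chain of integral quotas of its own, which shares with the
    parent's history the one-time marginals and nothing else. Forgetting the correlations is
    affordable: a hit cost looks at the quota at a single time, and the movement cost of a star
    depends on consecutive marginals through their Wasserstein distance. The chain is never sampled;
    expectations are finite sums, so the outcome is a deterministic fractional algorithm.

    The hit vectors have to be finite, monotone and known online. Charging for misses keeps [h(0)]
    finite, constant quotas make [h] independent of the quota path, and letting any initial number
    of servers start free of charge makes the increments sum to the constant-quota optimum.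

    For [k = 1] the assumption on allocation is contradictory at [eps = 1], so [k >= 2]. The repair
    of missed requests relies on this. *)

Section TreeTheory.
Context {R : realType} (T : weighted_tree R).
Implicit Types p q c j : T.

Lemma level_troot : level (troot T) = 0%N.
Proof.
rewrite /level; case: ex_minnP => m _ hm.
by apply/eqP; rewrite -leqn0; apply: hm => /=.
Qed.

Lemma level_neq_troot c : c != troot T -> level c = (level (parent c)).+1.
Proof.
move=> hc; rewrite /level; case: ex_minnP => m hm mmin; case: ex_minnP => n hn nmin.
case: m hm mmin => [|m] hm mmin; first by rewrite /= in hm; rewrite hm in hc.
apply/eqP; rewrite eqSS eqn_leq; apply/andP; split.
- by rewrite -ltnS; apply: mmin; rewrite iterSr.
- by apply: nmin; rewrite -iterSr.
Qed.

Lemma level_parent p : level (parent p) = (level p).-1.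
Proof.
have [->|hp] := eqVneq p (troot T); first by rewrite parent_troot level_troot.
by rewrite [in RHS]level_neq_troot.
Qed.

Lemma level_eq0 p : (level p == 0%N) = (p == troot T).
Proof.
have [->|hp] := eqVneq p (troot T); first by rewrite level_troot.
by rewrite level_neq_troot.
Qed.

Lemma level_iter n p : level (iter n parent p) = (level p - n)%N.
Proof. by elim: n => [|n IH] /=; rewrite ?subn0 // level_parent IH subnS. Qed.

Lemma in_subtreeP p q :
  reflect ((level p <= level q)%N /\ iter (level q - level p) parent q = p)
          (in_subtree p q).
Proof.
apply: (iffP idP) => [/iter_findex|[_ <-]]; last exact: fconnect_iter.
set n := findex _ _ _ => h.
have hl := level_iter n q; rewrite h in hl; rewrite hl; split; first exact: leq_subr.
have [hn|hn] := leqP n (level q); first by rewrite subKn.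
have hp0 : p = troot T by apply/eqP; rewrite -level_eq0 hl; lia.
apply/eqP; rewrite hp0 -level_eq0 level_iter; lia.
Qed.

Lemma in_subtree_refl p : in_subtree p p.
Proof. exact: connect0. Qed.

Lemma in_subtree_trans p q j : in_subtree p q -> in_subtree q j -> in_subtree p j.
Proof. by move=> h1 h2; apply: connect_trans h2 h1. Qed.

Lemma in_subtree_troot p : in_subtree (troot T) p.
Proof.
apply/in_subtreeP; split; first by rewrite level_troot.
by apply/eqP; rewrite level_troot subn0 -level_eq0 level_iter subnn.
Qed.

Lemma in_subtree_level p q : in_subtree p q -> (level p <= level q)%N.
Proof. by case/in_subtreeP. Qed.

Lemma in_subtreeS p q : in_subtree p q = (q == p) || (q != troot T) && in_subtree p (parent q).
Proof.
apply/idP/idP => [h|].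
  have [//|hne] := eqVneq q p; case/in_subtreeP: (h) => hl.
  case E: (level q - level p)%N => [|n] hi.
    by move/eqP: hne; case; rewrite -hi.
  rewrite /= -hi iterSr [in_subtree _ _]fconnect_iter andbT -level_eq0; lia.
case/orP => [/eqP <-|/andP[_ h]]; first exact: in_subtree_refl.
exact: connect_trans (fconnect1 _ _) h.
Qed.

Lemma is_child_neq_troot c p : is_child c p -> c != troot T.
Proof. by case/andP. Qed.

Lemma is_child_parent c p : is_child c p -> parent c = p.
Proof. by case/andP => _ /eqP. Qed.

Lemma parent_child c : c != troot T -> is_child c (parent c).
Proof. by move=> h; rewrite /is_child h eqxx. Qed.

Lemma child_level c p : is_child c p -> level c = (level p).+1.
Proof. by case/andP => hc /eqP <-; apply: level_neq_troot. Qed.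

Lemma child_in_subtree c p : is_child c p -> in_subtree p c.
Proof. by case/andP => hc /eqP <-; apply: fconnect1. Qed.

Lemma child_nsubtree c p : is_child c p -> in_subtree c p = false.
Proof. by move=> h; apply/negP => /in_subtree_level; rewrite (child_level h) ltnn. Qed.

Lemma leafP p : reflect (exists c, is_child c p) (~~ is_leaf p).
Proof.
apply: (iffP idP) => [/forallPn[c]|[c hc]]; first by rewrite negbK; exists c.
by apply/forallPn; exists c; rewrite negbK.
Qed.

Lemma leaf_no_child p c : is_leaf p -> is_child c p = false.
Proof. by move/forallP/(_ c)/negbTE. Qed.

Lemma leaf_subtree p q : is_leaf p -> in_subtree p q = (q == p).
Proof.
move=> hp; apply/idP/eqP => [|->]; last exact: in_subtree_refl.
case/in_subtreeP; case E: (level q - level p)%N => [|n] hl //= hi.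
have := forallP hp (iter n parent q); rewrite /is_child hi eqxx andbT -level_eq0 level_iter.
lia.
Qed.

Lemma child_uniq p c c' q : is_child c p -> is_child c' p ->
  in_subtree c q -> in_subtree c' q -> c = c'.
Proof.
move=> /child_level hc /child_level hc' /in_subtreeP[_ <-] /in_subtreeP[_ <-].
by rewrite hc hc'.
Qed.

Lemma subtree_child p q : in_subtree p q ->
  (q == p) || [exists c, is_child c p && in_subtree c q].
Proof.
move=> h; have [//|hne /=] := eqVneq q p.
case/in_subtreeP: (h) => hl; case E: (level q - level p)%N => [|n] hi.
  by move/eqP: hne; case; rewrite -hi.
apply/existsP; exists (iter n parent q).
have hi' : parent (iter n parent q) = p by [].
rewrite /is_child hi' eqxx andbT -level_eq0 level_iter [in_subtree _ _]fconnect_iter andbT; lia.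
Qed.

Lemma sum_subtree (V : nmodType) p (F : T -> V) :
  \sum_(j | in_subtree p j) F j =
  F p + \sum_(c | is_child c p) \sum_(j | in_subtree c j) F j.
Proof.
rewrite (bigD1 p) ?in_subtree_refl //=; congr (_ + _).
under [RHS]eq_bigr do rewrite big_mkcond /=.
rewrite exchange_big /= [RHS](bigID (fun j => in_subtree p j && (j != p))) /=.
rewrite [X in _ + X]big1 ?addr0.
  apply: eq_bigr => j /andP[hj hne].
  have := subtree_child hj; rewrite (negbTE hne) /= => /existsP[c /andP[hc hcj]].
  rewrite (bigD1 c) //= hcj big1 ?addr0 // => c' /andP[hc' hcc'].
  by case: ifP => // h; move: hcc'; rewrite (child_uniq hc' hc h hcj) eqxx.
move=> j hj; rewrite big1 // => c hc; case: ifP => // hcj; move: hj.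
rewrite (in_subtree_trans (child_in_subtree hc) hcj) /=; case: eqP => // hjp.
by rewrite hjp child_nsubtree in hcj.
Qed.

Lemma sum_strict_subtree (V : zmodType) p (F : T -> V) :
  \sum_(j | in_subtree p j && (j != p)) F j =
  \sum_(c | is_child c p) \sum_(j | in_subtree c j) F j.
Proof.
by have := sum_subtree p F; rewrite (bigD1 p) ?in_subtree_refl //= => /addrI.
Qed.

Lemma sum_child_in_subtree p q :
  (\sum_(c | is_child c p) in_subtree c q = (in_subtree p q && (q != p)))%N.
Proof.
have [h|h] := boolP (in_subtree p q && (q != p)).
  case/andP: h => hq hne; have := subtree_child hq.
  rewrite (negbTE hne) /= => /existsP[c /andP[hc hcq]].
  rewrite (bigD1 c) //= hcq big1 // => c' /andP[hc' hcc'].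
  by case E: (in_subtree _ _) => //; rewrite (child_uniq hc' hc E hcq) eqxx in hcc'.
rewrite big1 // => c hc; case E: (in_subtree _ _) => //.
move: h; rewrite (in_subtree_trans (child_in_subtree hc) E) negbK /= => /eqP hqp.
by rewrite hqp child_nsubtree in E.
Qed.

Lemma level_bounded : exists N, forall p, (level p <= N)%N.
Proof. by exists (\max_(p : T) level p) => p; apply: leq_bigmax. Qed.

Lemma bottom_up (P : T -> Prop) :
  (forall p, (forall c, is_child c p -> P c) -> P p) -> forall p, P p.
Proof.
move=> IH; have [N hN] := level_bounded.
suff H n : forall p, (N - level p < n)%N -> P p by move=> p; apply: (H (N - level p).+1).
elim: n => // n IHn p hp; apply: IH => c hc; apply: IHn.
have := hN c; rewrite (child_level hc); lia.
Qed.

Lemma top_down (P : T -> Prop) : P (troot T) ->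
  (forall c, c != troot T -> P (parent c) -> P c) -> forall p, P p.
Proof.
move=> P0 PS p; move: {2}(level p) (erefl (level p)) => n; elim: n p => [|n IH] p hp.
  by move/eqP: hp; rewrite level_eq0 => /eqP ->.
have hr : p != troot T by rewrite -level_eq0 hp.
by apply: PS => //; apply: IH; rewrite level_parent hp.
Qed.

Lemma has_leaf p : exists2 i, is_leaf i & in_subtree p i.
Proof.
elim/bottom_up: p => p IH; have [hp|/leafP[c hc]] := boolP (is_leaf p).
  by exists p => //; apply: in_subtree_refl.
have [i hi hci] := IH c hc; exists i => //.
exact: in_subtree_trans (child_in_subtree hc) hci.
Qed.

Lemma level_le_depth p : (level p <= depth T)%N.
Proof.
have [i hi hpi] := has_leaf p; apply: leq_trans (in_subtree_level hpi) _.
by rewrite /depth (bigD1 i) //= leq_maxl.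
Qed.

Lemma nonleaf_level p : ~~ is_leaf p -> (level p < depth T)%N.
Proof. by case/leafP => c /child_level <-; apply: level_le_depth. Qed.

(** Iterating [level p] times reaches exactly the root, so the level serves as fuel. This builds the
    quota laws of the nodes and the removed masses in [pull]. *)
Lemma top_down_rec (V : Type) (v0 : V) (F : T -> V -> V) :
  exists D : T -> V, D (troot T) = v0 /\
    forall c, c != troot T -> D c = F c (D (parent c)).
Proof.
pose fix G n (p : T) {struct n} := if n is n'.+1 then F p (G n' (parent p)) else v0.
exists (fun p => G (level p) p); split; first by rewrite level_troot.
by move=> c hc; rewrite (level_neq_troot hc).
Qed.

Lemma sum_child (V : nmodType) (F : T -> V) :
  \sum_(p | ~~ is_leaf p) \sum_(c | is_child c p) F c = \sum_(c | c != troot T) F c.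
Proof.
rewrite (exchange_big_dep (fun c => c != troot T)) /=; last by move=> p c _ /is_child_neq_troot.
apply: eq_bigr => c hc; rewrite (big_pred1 (parent c)) // => p /=.
rewrite /is_child hc /= eq_sym; apply/andP/eqP => [[_ /eqP ->]//|->]; split=> //.
by apply/leafP; exists c; apply: parent_child.
Qed.

End TreeTheory.

(** * Conformal exchange of integral flows *)

(** As [x] counts as 0 before time 0, a backward search from a negative value always meets a
    negative jump, and an exchanged unit can enter at time 0. *)
Definition jump (x : nat -> int) (t : nat) : int :=
  if t is t'.+1 then x t - x t' else x 0%N.

(* [1] on [t0, t1) if [t0 <= t1], and [-1] on [t1, t0) otherwise. *)
Definition pulse (t0 t1 t : nat) : int :=
  Posz (nat_of_bool (t0 <= t)%N) - Posz (nat_of_bool (t1 <= t)%N).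

(** If [d] is the difference of two solutions, a conformal [z] can be added to one and subtracted
    from the other with both values staying between the old ones. *)
Definition conf (z d : int) : bool := (0 <= z <= d) || (d <= z <= 0).

Lemma confD z1 z2 d : conf z1 d -> conf z2 (d - z1) -> conf (z1 + z2) d.
Proof. rewrite /conf; lia. Qed.

Lemma conf0 d : conf 0 d.
Proof. rewrite /conf; lia. Qed.

Lemma conf_abs z d : conf z d -> (`|d - z| <= `|d|)%N.
Proof. rewrite /conf; lia. Qed.

Lemma pulseD t0 t1 t2 t : pulse t0 t1 t + pulse t1 t2 t = pulse t0 t2 t.
Proof. rewrite /pulse; lia. Qed.

Lemma eq_jump x y s : (forall t, (t <= s)%N -> x t = y t) ->
  forall t, (t <= s)%N -> jump x t = jump y t.
Proof. by move=> h [|t] ht; rewrite /jump !h //; lia. Qed.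

Lemma jumpD x y t : jump (fun t => x t + y t) t = jump x t + jump y t.
Proof. case: t => [|t] /=; ring. Qed.

Lemma jumpB x y t : jump (fun t => x t - y t) t = jump x t - jump y t.
Proof. case: t => [|t] /=; ring. Qed.

Lemma jump_sum (I : finType) (P : pred I) (F : I -> nat -> int) t :
  jump (fun t => \sum_(i | P i) F i t) t = \sum_(i | P i) jump (F i) t.
Proof. by case: t => [|t] //=; rewrite sumrB. Qed.

Lemma jump_pulse t0 t1 t :
  jump (pulse t0 t1) t = Posz (nat_of_bool (t == t0)) - Posz (nat_of_bool (t == t1)).
Proof. by case: t => [|t] /=; rewrite /pulse; lia. Qed.

(** A unit entering at [t0] rides forward while [x] is positive, up to the first negative jump or
    past the horizon. If [x t0 <= 0], the value just before [t0] is negative, and the unit travels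
    back in time to the last negative jump before [t0]. *)
Lemma path_exchange s t0 (x : nat -> int) : (t0 <= s)%N -> 0 < jump x t0 ->
  exists t1, [/\ (t1 <= s)%N && (jump x t1 < 0) || (t1 == s.+1) &
    forall t, (t <= s)%N -> conf (pulse t0 t1 t) (x t)].
Proof.
move=> ht0 hj; have [hx|hx] := ltP 0 (x t0).
  pose P t := (t0 < t)%N && ((jump x t < 0) || (t == s.+1)).
  have exP : exists t, P t by exists s.+1; rewrite /P; lia.
  case: (ex_minnP exP) => t1 /andP[h01 hP] hmin.
  have hle : (t1 <= s.+1)%N by apply: hmin; rewrite /P; lia.
  exists t1; split; first by lia.
  have hpos m : (t0 + m < t1)%N -> 0 < x (t0 + m)%N.
    elim: m => [|m IH] hm; first by rewrite addn0.
    have h1 : 0 < x (t0 + m)%N by apply: IH; lia.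
    have : ~~ P (t0 + m).+1 by apply/negP => /hmin; lia.
    rewrite /P addnS [jump _ _]/=; lia.
  move=> t ht; rewrite /pulse /conf.
  case: (leqP t0 t) => h0; last by lia.
  case: (leqP t1 t) => h1; first by lia.
  have := hpos (t - t0)%N; rewrite subnKC //; lia.
case: t0 ht0 hj hx => [|t0] ht0 hj hx; first by rewrite /= in hj; lia.
have hx' : x t0 < 0 by move: hj; rewrite /=; lia.
pose P t := (t <= t0)%N && (jump x t < 0).
have exP : exists t, P t.
  apply: contrapT => hn.
  have hpos m : (m <= t0)%N -> 0 <= x m.
    elim: m => [|m IH] hm.
      have : ~ P 0%N by move=> h; apply: hn; exists 0%N.
      by rewrite /P [jump _ _]/=; lia.
    have h1 := IH (ltnW hm).
    have : ~ P m.+1 by move=> h; apply: hn; exists m.+1.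
    by rewrite /P [jump _ _]/=; lia.
  by have := hpos t0 (leqnn _); lia.
have ubP t : P t -> (t <= t0)%N by case/andP.
case: (ex_maxnP exP ubP) => t1 /andP[h10 hj1] hmax.
exists t1; split; first by lia.
have hneg m : (t1 + m <= t0)%N -> x (t0 - m)%N < 0.
  elim: m => [|m IH] hm; first by rewrite subn0.
  have h1 : x (t0 - m)%N < 0 by apply: IH; lia.
  have : ~~ P (t0 - m)%N by apply/negP => /hmax; lia.
  have -> : (t0 - m = (t0 - m.+1).+1)%N by lia.
  move: h1; have -> : (t0 - m = (t0 - m.+1).+1)%N by lia.
  rewrite /P [jump _ _]/=; lia.
move=> t ht; rewrite /pulse /conf.
case: (leqP t0.+1 t) => h0; first by lia.
case: (leqP t1 t) => h1; last by lia.
have := hneg (t0 - t)%N; have -> : (t0 - (t0 - t) = t)%N by lia.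
lia.
Qed.

Section Exchange.
Context {R : realType} (T : weighted_tree R).
Implicit Types (p c j : T) (X Y Z d : T -> nat -> int).

(** The servers at [j] that are in no child subtree: at a leaf the whole count, at an inner node
    servers that idle there. *)
Definition slack X j t : int := X j t - \sum_(c | is_child c j) X c t.

Lemma slackD X Y j t :
  slack (fun j t => X j t + Y j t) j t = slack X j t + slack Y j t.
Proof. rewrite /slack big_split /=; ring. Qed.

Lemma slackB X Y j t :
  slack (fun j t => X j t - Y j t) j t = slack X j t - slack Y j t.
Proof. rewrite /slack sumrB; ring. Qed.

Lemma slack_leaf X j t : is_leaf j -> slack X j t = X j t.
Proof.
by move=> hj; rewrite /slack big_pred0 ?subr0 // => c; rewrite leaf_no_child.
Qed.

Lemma slack_ge0 X p t : (forall j, in_subtree p j -> 0 <= slack X j t) ->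
  forall j, in_subtree p j -> 0 <= X j t.
Proof.
move=> h; apply: bottom_up => j IH hj.
rewrite -(subrK (\sum_(c | is_child c j) X c t) (X j t)).
apply: addr_ge0; first exact: h.
apply: sumr_ge0 => c hc; apply: IH => //.
exact: in_subtree_trans hj (child_in_subtree hc).
Qed.

Lemma eq_slack X Y j t :
  (forall q, in_subtree j q -> X q t = Y q t) -> slack X j t = slack Y j t.
Proof.
move=> h; rewrite /slack h ?in_subtree_refl //; congr (_ - _).
by apply: eq_bigr => c hc; apply/h/child_in_subtree.
Qed.

Definition conformal (s : nat) Z d j :=
  forall t, (t <= s)%N ->
  conf (slack Z j t) (slack d j t) /\ conf (jump (Z j) t) (jump (d j) t).

Definition strict p j := in_subtree p j && (j != p).

Lemma child_strict p c j : is_child c p -> in_subtree c j -> strict p j.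
Proof.
move=> hc hj; rewrite /strict (in_subtree_trans (child_in_subtree hc) hj) /=.
by apply: contraTneq hj => ->; rewrite child_nsubtree.
Qed.

Lemma strict_child p j : strict p j -> exists2 c, is_child c p & in_subtree c j.
Proof.
case/andP => hj hne; have := subtree_child hj.
by rewrite (negbTE hne) /= => /existsP[c /andP[]]; exists c.
Qed.

(* One step of the augmenting path at [p]: the unit enters at time [tc] either
   a child of [p] or the slack of [p], and leaves it at time [t1]. *)
Lemma exchange_step s p d (x : nat -> int) tc :
  (forall c, is_child c p -> forall d t0, (t0 <= s)%N -> 0 < jump (d c) t0 ->
    exists Z t1, [/\ (t1 <= s)%N && (jump (d c) t1 < 0) || (t1 == s.+1),
      forall t, Z c t = pulse t0 t1 t,
      forall j t, ~~ in_subtree c j -> Z j t = 0,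
      forall j, in_subtree c j -> conformal s Z d j
    & forall j, in_subtree c j -> 0 <= slack Z j s]) ->
  (tc <= s)%N ->
  0 < jump x tc + \sum_(c | is_child c p) jump (d c) tc ->
  exists Z w t1, [/\ (t1 <= s.+1)%N,
    forall t, w t + \sum_(c | is_child c p) Z c t = pulse tc t1 t,
    forall t, (t <= s)%N -> conf (w t) (x t),
    forall j, strict p j -> conformal s Z d j &
    [/\ 0 <= w s, forall j, strict p j -> 0 <= slack Z j s &
      (t1 <= s)%N ->
      (\sum_(t < s.+1) (`|jump (fun t => x t - w t)%R t| +
          \sum_(c | is_child c p) `|jump (fun t => d c t - Z c t)%R t|) <
       \sum_(t < s.+1) (`|jump x t| +
          \sum_(c | is_child c p) `|jump (d c) t|))%N ]].
Proof.
move=> IH htc hpos; have [hx|hx] := ltP 0 (jump x tc).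
  have [t1 [h1 hc]] := path_exchange htc hx.
  exists (fun _ _ => 0), (pulse tc t1), t1; split=> //.
  - by lia.
  - by move=> t; rewrite big1 ?addr0.
  - move=> j _ t _; split; last by case: t => [|t] /=; rewrite ?subr0 conf0.
    by rewrite /slack big1 // subr0 conf0.
  split; first by rewrite /pulse; lia.
    by move=> j _; rewrite /slack big1 ?subr0.
  (* The positive jump at [tc] shrinks by one and the negative jump at [t1] does not grow in size,
     so the measure drops strictly. *)
  move=> ht1; have hj1 : jump x t1 < 0 by lia.
  rewrite (bigD1 (inord tc)) //= [X in (_ < X)%N](bigD1 (inord tc)) //= inordK ?ltnS //.
  rewrite -addSn; apply: leq_add.
    rewrite -addSn; apply: leq_add; last by apply: leq_sum => c _; rewrite jumpB; case: (tc) => [|?] /=; lia.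
    by rewrite jumpB jump_pulse eqxx; case: eqP => [E|_] /=; [rewrite -E in hj1|]; lia.
  apply: leq_sum => t _; apply: leq_add.
    rewrite jumpB jump_pulse; case: eqP => [->|_]; case: eqP => [->|_] /=; lia.
  by apply: leq_sum => c _; rewrite jumpB; case: (nat_of_ord t) => [|?] /=; lia.
have /existsP[c /andP[hc hjc]] : [exists c, is_child c p && (0 < jump (d c) tc)].
  apply: contraT => /existsPn hn.
  have : \sum_(c | is_child c p) jump (d c) tc <= 0.
    by apply: sumr_le0 => c hc; have := hn c; rewrite hc /=; lia.
  lia.
have [Z [t1 [h1 hZc hZ0 hconf hsl]]] := IH c hc d tc htc hjc.
have Zother c' t : is_child c' p -> c' != c -> Z c' t = 0.
  move=> hc' hne; apply: hZ0; apply: contra hne => h.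
  by rewrite (child_uniq hc hc' h (in_subtree_refl c')).
have slo j t : strict p j -> ~~ in_subtree c j -> slack Z j t = 0.
  move=> hj hcj; rewrite /slack hZ0 // big1 ?subr0 // => q hq.
  apply: hZ0; apply: contra hcj => h; rewrite in_subtreeS in h.
  case/orP: h => [/eqP hqc|/andP[_]]; last by rewrite (is_child_parent hq).
  by move: hq hj; rewrite hqc /is_child (is_child_parent hc) /strict => /andP[_ /eqP ->]; rewrite eqxx andbF.
exists Z, (fun=> 0), t1; split.
- lia.
- move=> t; rewrite add0r (bigD1 c) //= big1 ?addr0 // => c' /andP[hc' hne].
  exact: Zother.
- by move=> t _; apply: conf0.
- move=> j hj; have [hcj|hcj] := boolP (in_subtree c j); first exact: hconf.
  move=> t ht; rewrite slo // conf0; split => //.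
  by rewrite (@eq_jump (Z j) (fun=> 0) t) // ?(hZ0 _ _ hcj) => [|? ?]; [case: (t) => [|?] /=; rewrite ?subr0 conf0|rewrite hZ0].
split=> //.
  move=> j hj; have [hcj|hcj] := boolP (in_subtree c j); first exact: hsl.
  by rewrite slo.
move=> ht1; have hj1 : jump (d c) t1 < 0 by lia.
have key (t : 'I_s.+1) c' : is_child c' p ->
    (`|jump (fun t => d c' t - Z c' t)%R t| <= `|jump (d c') t|)%N.
  move=> hc'; rewrite jumpB; have [->|hne] := eqVneq c' c.
    have [] := hconf c (in_subtree_refl c) t; first by rewrite -ltnS.
    by move=> _ /conf_abs.
  have -> : jump (Z c') t = 0.
    by case: (nat_of_ord t) => [|?] /=; rewrite !Zother.
  by rewrite subr0.
rewrite (bigD1 (inord tc)) //= [X in (_ < X)%N](bigD1 (inord tc)) //= inordK ?ltnS //.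
rewrite -addSn; apply: leq_add; last first.
  by apply: leq_sum => t _; rewrite jumpB; apply: leq_add; [case: (nat_of_ord t) => [|?] /=; lia|apply: leq_sum => c'; apply: key].
rewrite -addnS; apply: leq_add; first by rewrite jumpB; case: (tc) => [|?] /=; lia.
rewrite (bigD1 c) //= [X in (_ <= X)%N](bigD1 c) //= -addSn; apply: leq_add.
  rewrite jumpB (@eq_jump (Z c) (pulse tc t1) tc) // jump_pulse eqxx.
  by case: eqP => [E|_] /=; [rewrite -E in hj1|]; lia.
apply: leq_sum => c' /andP[hc' _].
by have := key (inord tc) c' hc'; rewrite inordK ?ltnS.
Qed.

(** Bottom-up over the tree; at [p] the path is composed of steps through the slack or through one
    child. A step ending where [d p] has no negative jump leaves a residual that rises there, so the
    next step can start. The total size of the residual jumps bounds the number of steps. *)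
Lemma exchange s p : forall d t0, (t0 <= s)%N -> 0 < jump (d p) t0 ->
  exists Z t1, [/\ (t1 <= s)%N && (jump (d p) t1 < 0) || (t1 == s.+1),
    forall t, Z p t = pulse t0 t1 t,
    forall j t, ~~ in_subtree p j -> Z j t = 0,
    forall j, in_subtree p j -> conformal s Z d j
  & forall j, in_subtree p j -> 0 <= slack Z j s].
Proof.
move: p; apply: bottom_up => p IH d t0 ht0 hj0.
suff inner n : forall Z w tc,
  (\sum_(t < s.+1) (`|jump (fun t => slack d p t - w t)%R t| +
     \sum_(c | is_child c p) `|jump (fun t => d c t - Z c t)%R t|) < n)%N ->
  (tc <= s)%N -> (tc == t0) || (0 <= jump (d p) tc) ->
  (forall t, w t + \sum_(c | is_child c p) Z c t = pulse t0 tc t) ->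
  (forall t, (t <= s)%N -> conf (w t) (slack d p t)) ->
  (forall j, strict p j -> conformal s Z d j) ->
  0 <= w s -> (forall j, strict p j -> 0 <= slack Z j s) ->
  exists Z t1, [/\ (t1 <= s)%N && (jump (d p) t1 < 0) || (t1 == s.+1),
    forall t, Z p t = pulse t0 t1 t,
    forall j t, ~~ in_subtree p j -> Z j t = 0,
    forall j, in_subtree p j -> conformal s Z d j
  & forall j, in_subtree p j -> 0 <= slack Z j s].
  apply: (inner _ (fun _ _ => 0) (fun=> 0) t0 (ltnSn _)) => //.
  - by rewrite eqxx.
  - by move=> t; rewrite big1 // /pulse; lia.
  - by move=> t _; apply: conf0.
  - move=> j _ t _; split; last by case: t => [|t] /=; rewrite ?subr0 conf0.
    by rewrite /slack big1 // subr0 conf0.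
  - by move=> j _; rewrite /slack big1 ?subr0.
elim: n => // n IHn Z w tc hmeas htc hstat hsum hw hconf hws hsl.
(* The residual jumps at [tc] by [jump (d p) tc + 1], or by [jump (d p) t0] if the path has come
   back to [t0]. *)
have hpos : 0 < jump (fun t => slack d p t - w t)%R tc +
    \sum_(c | is_child c p) jump (fun t => d c t - Z c t)%R tc.
  rewrite -jump_sum -jumpD.
  rewrite (@eq_jump _ (fun t => d p t - pulse t0 tc t) tc) => [|t _|//]; last first.
    by rewrite sumrB -hsum /slack; ring.
  rewrite jumpB jump_pulse eqxx; case: eqP hstat => [->|_] /=; lia.
have [Z1 [w1 [t1 [h1 hsum1 hw1 hconf1 [hws1 hsl1 hmeas1]]]]] :=
  exchange_step (d := fun j t => d j t - Z j t) IH htc hpos.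
pose Z' j t := Z j t + Z1 j t; pose w' t := w t + w1 t.
have hsum' t : w' t + \sum_(c | is_child c p) Z' c t = pulse t0 t1 t.
  by rewrite big_split /= -(pulseD t0 tc) -hsum -hsum1 /w'; ring.
have hw' t : (t <= s)%N -> conf (w' t) (slack d p t).
  by move=> ht; apply: confD; [apply: hw|apply: hw1].
have hconf' j : strict p j -> conformal s Z' d j.
  move=> hj t ht; have [a1 b1] := hconf j hj t ht; have [a2 b2] := hconf1 j hj t ht.
  rewrite /Z' slackD jumpD; rewrite slackB in a2; rewrite jumpB in b2.
  by split; apply: confD.
have hws' : 0 <= w' s by apply: addr_ge0.
have hsl' j : strict p j -> 0 <= slack Z' j s.
  by move=> hj; rewrite /Z' slackD addr_ge0 ?hsl ?hsl1.
have [hstop|hgo] := boolP ((t1 <= s)%N && (jump (d p) t1 < 0) || (t1 == s.+1)).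
  exists (fun j t => if j == p then pulse t0 t1 t else if in_subtree p j then Z' j t else 0), t1.
  have eqj j : strict p j -> forall t, (if j == p then pulse t0 t1 t
      else if in_subtree p j then Z' j t else 0) = Z' j t.
    by case/andP => -> /negbTE ->.
  have slp t : slack (fun j t => if j == p then pulse t0 t1 t
      else if in_subtree p j then Z' j t else 0) p t = w' t.
    rewrite /slack eqxx (eq_bigr (fun c => Z' c t)) => [|c hc].
      by rewrite -(hsum' t) addrK.
    by rewrite eqj //; apply: child_strict hc (in_subtree_refl c).
  have slj j t : strict p j -> slack (fun j t => if j == p then pulse t0 t1 t
      else if in_subtree p j then Z' j t else 0) j t = slack Z' j t.
    move=> hj; apply: eq_slack => q hq; apply: eqj.
    have [c hc hcj] := strict_child hj.
    exact: child_strict hc (in_subtree_trans hcj hq).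
  split=> //.
  - by move=> t; rewrite eqxx.
  - move=> j t hj; rewrite (negbTE hj); case: eqP hj => // ->.
    by rewrite in_subtree_refl.
  - move=> j hj t ht; have [->|hne] := eqVneq j p.
      rewrite slp; split; first exact: hw'.
      rewrite (@eq_jump _ (pulse t0 t1) t) // jump_pulse /conf.
      by case: eqP => [->|_]; case: eqP => [E|_] /=; rewrite ?E; lia.
    have hs : strict p j by rewrite /strict hj hne.
    by rewrite slj //= hj; apply: hconf'.
  - move=> j hj; have [->|hne] := eqVneq j p; first by rewrite slp.
    have hs : strict p j by rewrite /strict hj hne.
    by rewrite slj // hsl'.
apply: (IHn Z' w' t1) => //; [|lia|lia].
apply: leq_trans (_ : _ <= \sum_(t < s.+1) (`|jump (fun t => slack d p t - w t)%R t| +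
     \sum_(c | is_child c p) `|jump (fun t => d c t - Z c t)%R t|))%N _; last by [].
have := hmeas1 ltac:(lia); set a := (X in (_ < X)%N -> _); set b := (X in (X < _)%N -> _).
suff -> : b = (\sum_(t < s.+1) (`|jump (fun t => slack d p t - w' t)%R t| +
     \sum_(c | is_child c p) `|jump (fun t => d c t - Z' c t)%R t|))%N by [].
apply: eq_bigr => t _; congr (_ + _)%N.
  by congr absz; apply: (@eq_jump _ _ t) => // u _; rewrite /w'; ring.
apply: eq_bigr => c _; congr absz.
by apply: (@eq_jump _ _ t) => // u _; rewrite /Z'; ring.
Qed.

End Exchange.

(** * Offline costs of subtrees under prescribed quotas *)

Definition tv (n : nat) (x : nat -> int) : nat :=
  \sum_(0 <= t < n) absz (x t.+1 - x t)%R.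

(** The fate of the exchanged units after time [s]: kept in place forever, or dropped. *)
Definition extend (e : bool) (s : nat) (z : nat -> int) (t : nat) : int :=
  if (t <= s)%N then z t else if e then z s else 0.

Lemma tv_tail e s n x z : (s <= n)%N ->
  (\sum_(s <= t < n) absz ((x t.+1 + extend e s z t.+1)%R - (x t + extend e s z t))%R <=
   \sum_(s <= t < n) absz (x t.+1 - x t)%R + (~~ e && (s < n)) * absz (z s))%N.
Proof.
rewrite leq_eqVlt => /predU1P[->|hs]; first by rewrite !big_geq.
rewrite hs andbT !(big_ltn hs) /=.
have -> : (\sum_(s.+1 <= t < n) absz ((x t.+1 + extend e s z t.+1)%R - (x t + extend e s z t))%R =
   \sum_(s.+1 <= t < n) absz (x t.+1 - x t)%R)%N.
  apply: eq_big_nat => t /andP[ht _]; rewrite /extend.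
  have -> : (t.+1 <= s)%N = false by lia.
  have -> : (t <= s)%N = false by lia.
  congr absz; ring.
rewrite addnAC leq_add2r /extend leqnn ltnn; case: e => /=; lia.
Qed.

(** Up to time [s] the two new jumps lie between the old ones and have the same sum, so by convexity
    their absolute values do not grow in total. Only dropping units after [s] costs anything. *)
Lemma tv_swap e s nX nY (x y z : nat -> int) : (s <= nX)%N -> (s <= nY)%N ->
  (forall t, (t <= s)%N -> conf (jump z t) (jump y t - jump x t)) ->
  (tv nX (fun t => x t + extend e s z t)%R + tv nY (fun t => y t - extend false s z t)%R <=
   tv nX x + tv nY y + ((~~ e && (s < nX)) + (s < nY)) * absz (z s))%N.
Proof.
move=> hX hY hz; rewrite /tv !(big_cat_nat (leq0n s) hX) !(big_cat_nat (leq0n s) hY) /=.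
have htX := tv_tail e x z hX.
have htY := tv_tail false y (fun t => - z t) hY.
have eY : (\sum_(s <= t < nY) absz (y t.+1 - extend false s z t.+1 - (y t - extend false s z t))%R =
  \sum_(s <= t < nY) absz ((y t.+1 + extend false s (fun t => - z t) t.+1)%R - (y t + extend false s (fun t => - z t) t))%R)%N.
  by apply: eq_bigr => t _; congr absz; rewrite /extend; case: ifP; case: ifP; lia.
have hw : (\sum_(0 <= t < s) absz ((x t.+1 + extend e s z t.+1)%R - (x t + extend e s z t))%R +
  \sum_(0 <= t < s) absz (y t.+1 - extend false s z t.+1 - (y t - extend false s z t))%R <=
  \sum_(0 <= t < s) absz (x t.+1 - x t)%R + \sum_(0 <= t < s) absz (y t.+1 - y t)%R)%N.
  rewrite -!big_split /= !big_nat; apply: leq_sum => t /andP[_ ht].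
  by have := hz t.+1 ht; rewrite /extend ht (ltnW ht) /jump /conf; lia.
rewrite eY in hw *; move: htX htY hw; rewrite abszN mulnDl /=.
set a1 := (\sum_(s <= t < nX) _)%N; set a2 := (\sum_(s <= t < nX) _)%N.
set b1 := (\sum_(s <= t < nY) _)%N; set b2 := (\sum_(s <= t < nY) _)%N.
set c1 := (\sum_(0 <= t < s) _)%N; set c2 := (\sum_(0 <= t < s) _)%N.
set c3 := (\sum_(0 <= t < s) _)%N; set c4 := (\sum_(0 <= t < s) _)%N.
set m1 := (_ * absz (z s))%N; set m2 := (_ * absz (z s))%N.
lia.
Qed.

Section SubtreeCost.
Context {R : realType} (T : weighted_tree R) (M : R) (n0 : T -> int) (D : T -> R).
Implicit Types (rho : nat -> T) (p c j : T) (X Y Z : T -> nat -> int).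

Definition misses rho j n (x : nat -> int) : nat :=
  \sum_(0 <= t < n) [&& rho t == j, is_leaf j & x t.+1 == 0].

(** The indicator of 0 is convex on the nonnegative integers, so replacing two counts by counts
    between them with the same sum creates no additional miss. *)
Lemma misses_swap rho j e s nX nY (x y z : nat -> int) : (s <= nX)%N -> (s <= nY)%N ->
  (forall t, (t <= nX)%N -> 0 <= x t) -> (forall t, (t <= nY)%N -> 0 <= y t) ->
  0 <= z s ->
  (is_leaf j -> forall t, (t <= s)%N -> conf (z t) (y t - x t)) ->
  (misses rho j nX (fun t => x t + extend e s z t)%R +
   misses rho j nY (fun t => y t - extend false s z t)%R <=
   misses rho j nX x + misses rho j nY y)%N.
Proof.
move=> hX hY hx hy hzs hz; rewrite /misses !(big_cat_nat (leq0n s) hX) !(big_cat_nat (leq0n s) hY) /=.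
set a1 := (\sum_(0 <= t < s) _)%N; set b1 := (\sum_(s <= t < nX) _)%N.
set a2 := (\sum_(0 <= t < s) _)%N; set b2 := (\sum_(s <= t < nY) _)%N.
set a3 := (\sum_(0 <= t < s) _)%N; set b3 := (\sum_(s <= t < nX) _)%N.
set a4 := (\sum_(0 <= t < s) _)%N; set b4 := (\sum_(s <= t < nY) _)%N.
have h1 : (b1 <= b3)%N.
  rewrite /b1 /b3 !big_nat; apply: leq_sum => t /andP[h1 h2].
  rewrite /extend ltnNge h1 /=; have := hx t.+1 h2.
  by case: (e); case: (rho t == j); case: (is_leaf j) => //=; lia.
have h2 : (b2 <= b4)%N.
  rewrite /b2 /b4 !big_nat; apply: leq_sum => t /andP[h1' _].
  by rewrite /extend ltnNge h1' /= subr0.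
have h3 : (a1 + a2 <= a3 + a4)%N.
  rewrite /a1 /a2 /a3 /a4 -!big_split /= !big_nat; apply: leq_sum => t /andP[_ ht].
  case: (rho t == j) => //=; case hl: (is_leaf j) => //=.
  have := hz hl t.+1 ht; rewrite /extend ht /conf.
  have := hx t.+1 (leq_trans ht hX); have := hy t.+1 (leq_trans ht hY); lia.
lia.
Qed.

Definition cost rho p n X : R :=
  \sum_(j | in_subtree p j) M * (misses rho j n (X j))%:R +
  \sum_(j | in_subtree p j && (j != p)) weight j * (tv n (X j))%:R.

Lemma sum_slack X p t : X p t = \sum_(j | in_subtree p j) slack X j t.
Proof.
move: p; apply: bottom_up => p IH; rewrite sum_subtree.
by rewrite (eq_bigr (fun c => X c t)) ?subrK // => c hc; rewrite [RHS]IH.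
Qed.

Definition n0path j (_ : nat) := n0 j.

(* At time 0 a solution for the quota [n0 p] is in the initial configuration;
   one for another quota has added or removed servers free of charge. *)
Definition box p X :=
  (X p 0%N <= n0 p ->
     forall j, in_subtree p j -> slack X j 0%N <= slack n0path j 0%N) /\
  (n0 p <= X p 0%N ->
     forall j, in_subtree p j -> slack n0path j 0%N <= slack X j 0%N).

Lemma slack_le_eq X Y p : (forall j, in_subtree p j -> slack X j 0%N <= slack Y j 0%N) ->
  Y p 0%N <= X p 0%N -> forall j, in_subtree p j -> slack X j 0%N = slack Y j 0%N.
Proof.
move=> hle; rewrite (sum_slack X) (sum_slack Y) => hge j hj.
apply/eqP; rewrite eq_le hle //=; move: hge.
rewrite (bigD1 j) //= [X in _ <= X](bigD1 j) //=.
have : \sum_(i | in_subtree p i && (i != j)) slack X i 0%N <=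
       \sum_(i | in_subtree p i && (i != j)) slack Y i 0%N.
  by apply: ler_sum => i /andP[hi _]; apply: hle.
set a := \sum_(i | _) _; set b := \sum_(i | _) _; lia.
Qed.

Lemma box_le p X : X p 0%N <= n0 p ->
  (forall j, in_subtree p j -> slack X j 0%N <= slack n0path j 0%N) -> box p X.
Proof.
move=> h hs; split=> // h' j hj.
by rewrite (slack_le_eq (Y := n0path) hs h').
Qed.

Lemma box_ge p X : n0 p <= X p 0%N ->
  (forall j, in_subtree p j -> slack n0path j 0%N <= slack X j 0%N) -> box p X.
Proof.
move=> h hs; split=> // h' j hj.
by rewrite (slack_le_eq (X := n0path) hs h').
Qed.

Lemma box_start p X : box p X -> X p 0%N = n0 p ->
  forall j, in_subtree p j -> X j 0%N = n0 j.
Proof.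
move=> [h1 h2] e j hj; rewrite (sum_slack X) -[n0 j]/(n0path j 0%N) (sum_slack n0path).
apply: eq_bigr => i hi; have hpi := in_subtree_trans hj hi.
by apply/eqP; rewrite eq_le h1 ?h2 ?e.
Qed.

Definition feas p n X :=
  (forall j, in_subtree p j -> forall t, (t <= n)%N -> 0 <= slack X j t) /\ box p X.

Lemma weight_ge0 p j : in_subtree p j && (j != p) -> 0 <= weight j.
Proof.
case/strict_child => c /is_child_neq_troot hc hj.
apply/ltW/weight_gt0; apply: contra hc => /eqP hj0; rewrite hj0 in hj.
by have := in_subtree_level hj; rewrite level_troot leqn0 level_eq0.
Qed.

Context (M_ge0 : 0 <= M) (D_ge0 : forall p, 0 <= D p).
Context (D_parent : forall c, c != troot T -> weight c + D c <= D (parent c)).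

Lemma cost_ge0 rho p n X : 0 <= cost rho p n X.
Proof.
apply: addr_ge0; apply: sumr_ge0 => j hj; apply: mulr_ge0 => //.
exact: weight_ge0 hj.
Qed.

(** With nonnegative slacks, [Z] splits into units running down from [p] to their places, and by
    [D_parent] no descending path from [p] is longer than [D p]. *)
Lemma tail_weight Z t p : (forall j, in_subtree p j -> 0 <= slack Z j t) ->
  \sum_(j | in_subtree p j && (j != p)) weight j * (absz (Z j t))%:R <=
  D p * (absz (Z p t))%:R.
Proof.
move: p; apply: bottom_up => p IH hs.
have hc c : is_child c p -> forall j, in_subtree c j -> 0 <= slack Z j t.
  by move=> hc j hj; apply/hs/(in_subtree_trans (child_in_subtree hc) hj).
rewrite sum_strict_subtree.
apply: le_trans (_ : \sum_(c | is_child c p) D p * (absz (Z c t))%:R <= _).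
  apply: ler_sum => c hcp; rewrite (bigD1 c) ?in_subtree_refl //=.
  apply: le_trans (lerD (lexx _) (IH c hcp (hc c hcp))) _.
  rewrite -mulrDl; apply: ler_wpM2r => //.
  rewrite -(is_child_parent hcp); apply: D_parent; exact: is_child_neq_troot hcp.
rewrite -mulr_sumr; apply: ler_wpM2l => //.
rewrite -natr_sum ler_nat.
have hge c : is_child c p -> 0 <= Z c t.
  by move=> h; apply: (slack_ge0 (hc c h)); apply: in_subtree_refl.
have := hs p (in_subtree_refl p); rewrite /slack.
have -> : \sum_(c | is_child c p) Z c t = Posz (\sum_(c | is_child c p) absz (Z c t))%N.
  rewrite (big_morph Posz PoszD (erefl _)); apply: eq_bigr => c h.
  by have := hge c h; lia.
lia.
Qed.

(** The difference of the two solutions is constantly 1 at [p] on [[0, s]], so a unit entering at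
    time 0 can leave only after [s]. Handing it from [Y] to [X] crosses the two quota paths at [s];
    each drop of the unit costs at most [D p]. *)
Lemma swap rho p s nX nY X Y (e : bool) : (s <= nX)%N -> (s <= nY)%N ->
  feas p nX X -> feas p nY Y -> (forall t, (t <= s)%N -> Y p t = X p t + 1) ->
  exists X' Y', [/\ feas p nX X', feas p nY Y',
    forall t, X' p t = if (t <= s)%N then Y p t else X p t + Posz e,
    forall t, Y' p t = if (t <= s)%N then X p t else Y p t
  & cost rho p nX X' + cost rho p nY Y' <=
    cost rho p nX X + cost rho p nY Y +
      D p * ((~~ e && (s < nX)) + (s < nY))%N%:R].
Proof.
move=> hX hY [slX boxX] [slY boxY] hXY.
pose d j t := Y j t - X j t.
have dp t : (t <= s)%N -> d p t = 1 by move=> ht; rewrite /d hXY //; lia.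
have [Z [t1 [ht1 hZp hZ0 hconf hZs]]] : exists Z t1,
  [/\ (t1 <= s)%N && (jump (d p) t1 < 0) || (t1 == s.+1),
    forall t, Z p t = pulse 0 t1 t,
    forall j t, ~~ in_subtree p j -> Z j t = 0,
    forall j, in_subtree p j -> conformal s Z d j
  & forall j, in_subtree p j -> 0 <= slack Z j s].
  by apply: exchange => //; rewrite /jump dp.
have {}ht1 : t1 = s.+1.
  case/orP: ht1 => [/andP[h1]|/eqP //].
  by case: t1 h1 {hZp} => [|t1] h1; rewrite /jump !dp ?(ltnW h1).
have {}hZp t : (t <= s)%N -> Z p t = 1 by move=> ht; rewrite hZp /pulse ht1; lia.
have Zs_ge0 j : in_subtree p j -> 0 <= Z j s by apply: (slack_ge0 hZs).
exists (fun j t => X j t + extend e s (Z j) t), (fun j t => Y j t - extend false s (Z j) t).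
have extsl b j t : slack (fun j => extend b s (Z j)) j t = extend b s (slack Z j) t.
  rewrite /slack /extend; case: ifP => // _; case: b => //.
  by rewrite big1 ?subr0.
have hX0 t : X p t + extend e s (Z p) t = if (t <= s)%N then Y p t else X p t + Posz e.
  by rewrite /extend; case: ifP => ht; [rewrite hXY // hZp|case: (e); rewrite ?hZp].
have hY0 t : Y p t - extend false s (Z p) t = if (t <= s)%N then X p t else Y p t.
  rewrite /extend; case: ifP => ht; last by rewrite subr0.
  rewrite hXY // hZp //; lia.
have c0 j : in_subtree p j -> conf (slack Z j 0%N) (slack Y j 0%N - slack X j 0%N).
  by move=> hj; have [] := hconf j hj 0%N (leq0n _); rewrite slackB.
split.
- split.
    move=> j hj t ht; rewrite slackD extsl /extend; case: ifP => hts.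
      have [hc _] := hconf j hj t hts; rewrite /conf slackB in hc.
      by have := slX j hj t ht; have := slY j hj t (leq_trans hts hY); lia.
    by case: (e); [apply: addr_ge0; [apply: slX|apply: hZs]|rewrite addr0; apply: slX].
  move: (hX0 0%N); rewrite leq0n => hX0'; have [h|h] := leP (n0 p) (X p 0%N).
    apply: box_ge => [|j hj]; first by rewrite /= hX0' hXY //; lia.
    have := boxX.2 h j hj; have := boxY.2; rewrite hXY // => /(_ ltac:(lia) j hj).
    rewrite slackD extsl /extend /=; have := c0 j hj; rewrite /conf; lia.
  apply: box_le => [|j hj]; first by rewrite /= hX0' hXY //; lia.
  have := boxX.1 (ltW h) j hj; have := boxY.1; rewrite hXY // => /(_ ltac:(lia) j hj).
  rewrite slackD extsl /extend /=; have := c0 j hj; rewrite /conf; lia.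
- split.
    move=> j hj t ht; rewrite slackB extsl /extend; case: ifP => hts; last by rewrite subr0 slY.
    have [hc _] := hconf j hj t hts; rewrite /conf slackB in hc.
    by have := slY j hj t ht; have := slX j hj t (leq_trans hts hX); lia.
  move: (hY0 0%N); rewrite leq0n => hY0'; have [h|h] := leP (n0 p) (X p 0%N).
    apply: box_ge => [|j hj]; first by rewrite /= hY0'; lia.
    have := boxX.2 h j hj; have := boxY.2; rewrite hXY // => /(_ ltac:(lia) j hj).
    rewrite slackB extsl /extend /=; have := c0 j hj; rewrite /conf; lia.
  apply: box_le => [|j hj]; first by rewrite /= hY0'; lia.
  have := boxX.1 (ltW h) j hj; have := boxY.1; rewrite hXY // => /(_ ltac:(lia) j hj).
  rewrite slackB extsl /extend /=; have := c0 j hj; rewrite /conf; lia.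
- exact: hX0.
- exact: hY0.
set E := ((~~ e && (s < nX)) + (s < nY))%N.
have hm : \sum_(j | in_subtree p j) M * (misses rho j nX (fun t => X j t + extend e s (Z j) t))%:R +
   \sum_(j | in_subtree p j) M * (misses rho j nY (fun t => Y j t - extend false s (Z j) t))%:R <=
   \sum_(j | in_subtree p j) M * (misses rho j nX (X j))%:R +
   \sum_(j | in_subtree p j) M * (misses rho j nY (Y j))%:R.
  rewrite -!big_split /=; apply: ler_sum => j hj; rewrite -!mulrDr -!natrD.
  apply: ler_wpM2l => //; rewrite ler_nat; apply: misses_swap => //; last 1 first.
  - move=> hl t ht; have [hc _] := hconf j hj t ht.
    by rewrite /d !slack_leaf in hc.
  - by move=> t ht; apply: slack_ge0 hj => i hi; apply: slX.
  - by move=> t ht; apply: slack_ge0 hj => i hi; apply: slY.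
  - exact: Zs_ge0.
have ht : \sum_(j | in_subtree p j && (j != p)) weight j * (tv nX (fun t => X j t + extend e s (Z j) t))%:R +
   \sum_(j | in_subtree p j && (j != p)) weight j * (tv nY (fun t => Y j t - extend false s (Z j) t))%:R <=
   \sum_(j | in_subtree p j && (j != p)) weight j * (tv nX (X j))%:R +
   \sum_(j | in_subtree p j && (j != p)) weight j * (tv nY (Y j))%:R + D p * E%:R.
  have hD := tail_weight hZs; rewrite hZp // mulr1 in hD.
  apply: le_trans (lerD (lexx _) (ler_wpM2r (ler0n _ E) hD)).
  rewrite -!big_split mulr_suml -big_split /=; apply: ler_sum => j hj.
  rewrite -mulrA -!mulrDr -natrM -!natrD; apply: ler_wpM2l; first exact: weight_ge0 hj.
  rewrite ler_nat mulnC; apply: tv_swap => // t ht; rewrite -jumpB.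
  by have [_] := hconf j (proj1 (andP hj)) t ht.
rewrite /cost; move: hm ht.
set m1 := \sum_(j | in_subtree p j) _; set m2 := \sum_(j | in_subtree p j) _.
set m3 := \sum_(j | in_subtree p j) _; set m4 := \sum_(j | in_subtree p j) _.
lra.
Qed.

End SubtreeCost.

(** * Optimal subtree costs and the convexity of their increments *)

Lemma int_subselect (I : finType) (P : pred I) (s0 : I -> int) (m : int) :
  (forall i, P i -> 0 <= s0 i) -> 0 <= m <= \sum_(i | P i) s0 i ->
  exists S : I -> int, (forall i, P i -> 0 <= S i <= s0 i) /\ \sum_(i | P i) S i = m.
Proof.
move=> h0 /andP[hm0 hm].
have [n hn] : exists n : nat, m = \sum_(i | P i) s0 i - n%:Z.
  by exists (absz (\sum_(i | P i) s0 i - m)%R); lia.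
elim: n m hm0 hm hn => [|n IH] m hm0 hm hn.
  by exists s0; split=> [i hi|]; [rewrite h0 /=|lia].
have [|||S [hS hsum]] := IH (m + 1); [lia|lia|lia|].
have /existsP[i /andP[hi hSi]] : [exists i, P i && (0 < S i)].
  apply: contraT => /existsPn hn'.
  have : \sum_(i | P i) S i <= 0 by apply: sumr_le0 => i hi; have := hn' i; rewrite hi /=; lia.
  lia.
exists (fun j => S j - (j == i)%:Z); split=> [j hj|].
  by case: eqP => [->|_]; have := hS j hj; have := hS i hi; lia.
by rewrite sumrB hsum (bigD1 i) //= eqxx big1 => [|j /andP[_ /negbTE ->]//]; lia.
Qed.

Section SubtreeOpt.
Context {R : realType} (T : weighted_tree R) (M : R) (n0 : T -> int) (D : T -> R).
Context (M_ge0 : 0 <= M) (n0_slack : forall j, \sum_(c | is_child c j) n0 c <= n0 j).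
Context (D_ge0 : forall p, 0 <= D p).
Context (D_parent : forall c, c != troot T -> weight c + D c <= D (parent c)).
#[local] Set Default Proof Using "All".
Implicit Types (rho : nat -> T) (p c j : T) (X Y Z : T -> nat -> int).
Implicit Types (kappa : nat -> nat).

Definition sol p n kappa X :=
  feas n0 p n X /\ forall t, (t <= n)%N -> X p t = (kappa t)%:Z.

Definition subopt rho p n kappa : R :=
  inf [set cost M rho p n X | X in [set X | sol p n kappa X]]%classic.

Lemma sol_exists p n kappa : exists X, sol p n kappa X.
Proof.
pose s0 j := slack (n0path n0) j 0%N.
have s0_ge0 j : 0 <= s0 j by rewrite /s0 /slack subr_ge0.
have n0E : n0 p = \sum_(j | in_subtree p j) s0 j.
  by rewrite -[n0 p]/(n0path n0 p 0%N) (sum_slack (n0path n0)).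
have [S [S_ge0 S_sum S_cmp]] : exists S : T -> int,
  [/\ forall j, in_subtree p j -> 0 <= S j,
    \sum_(j | in_subtree p j) S j = (kappa 0%N)%:Z &
    n0 p <= (kappa 0%N)%:Z /\ (forall j, in_subtree p j -> s0 j <= S j) \/
    (kappa 0%N)%:Z <= n0 p /\ (forall j, in_subtree p j -> S j <= s0 j)].
  have [h|h] := leP (n0 p) (kappa 0%N)%:Z.
    exists (fun j => s0 j + if j == p then (kappa 0%N)%:Z - n0 p else 0).
    split=> [j _||]; first by apply: addr_ge0 => //; case: eqP => // _; lia.
      rewrite big_split /= -n0E (bigD1 p) ?in_subtree_refl //= eqxx.
      by rewrite big1 ?addr0 => [|j /andP[_ /negbTE ->]//]; ring.
    by left; split=> // j _; case: eqP => // _; lia.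
  have [||S [hS hsum]] := @int_subselect _ (in_subtree p) s0 (kappa 0%N)%:Z => //.
    by rewrite -n0E; lia.
  exists S; split=> //; first by move=> j /hS/andP[].
  by right; split=> [|j /hS/andP[]//]; lia.
(* All servers are parked at [p] after time 0. Misses are charged rather than forbidden, so this is
   a solution. *)
pose X j t := if t is 0%N then \sum_(i | in_subtree j i) S i
              else if j == p then (kappa t)%:Z else 0.
have slX0 j : slack X j 0%N = S j by rewrite /slack /X sum_subtree addrK.
have Xp0 : X p 0%N = (kappa 0%N)%:Z by rewrite /X S_sum.
exists X; split; last by case=> [|t] _ //; rewrite /X eqxx.
split.
  move=> j hj [|t] _; first by rewrite slX0 S_ge0.
  rewrite /slack /X big1 ?subr0 => [|c hc]; first by case: ifP.
  case: eqP => // hcp; have := in_subtree_level hj.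
  by rewrite -hcp (child_level hc) ltnn.
case: S_cmp => [[h1 h2]|[h1 h2]].
  have h3 : n0 p <= X p 0%N by rewrite Xp0.
  by apply: (box_ge h3) => j hj; rewrite slX0; apply: h2.
have h3 : X p 0%N <= n0 p by rewrite Xp0.
by apply: (box_le h3) => j hj; rewrite slX0; apply: h2.
Qed.

Lemma subopt_le rho p n kappa X : sol p n kappa X -> subopt rho p n kappa <= cost M rho p n X.
Proof.
move=> hX; apply: ge_inf; last by exists X.
by exists 0 => _ [Y _ <-]; apply: cost_ge0.
Qed.

Lemma subopt_glb rho p n kappa a :
  (forall X, sol p n kappa X -> a <= cost M rho p n X) -> a <= subopt rho p n kappa.
Proof.
move=> h; apply: lb_le_inf; last by move=> _ [X hX <-]; apply: h.
by have [X hX] := sol_exists p n kappa; exists (cost M rho p n X); exists X.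
Qed.

Lemma subopt_ge0 rho p n kappa : 0 <= subopt rho p n kappa.
Proof. by apply: subopt_glb => X _; apply: cost_ge0. Qed.

Lemma subopt_transfer rho rho' p n n' kappa kappa' :
  (forall X, sol p n kappa X -> exists2 X', sol p n' kappa' X' &
     cost M rho' p n' X' <= cost M rho p n X) ->
  subopt rho' p n' kappa' <= subopt rho p n kappa.
Proof.
move=> h; apply: subopt_glb => X /h[X' hX' hle].
exact: le_trans (subopt_le rho' hX') hle.
Qed.

(** An exchange inequality passes to the infima one argument at a time, whether or not they are
    attained. *)
Lemma subopt_transfer2 rho p n1 n2 k1 k2 k1' k2' a :
  (forall X Y, sol p n1 k1 X -> sol p n2 k2 Y -> exists X' Y',
    [/\ sol p n1 k1' X', sol p n2 k2' Y' &
     cost M rho p n1 X' + cost M rho p n2 Y' <=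
     cost M rho p n1 X + cost M rho p n2 Y + a]) ->
  subopt rho p n1 k1' + subopt rho p n2 k2' <=
  subopt rho p n1 k1 + subopt rho p n2 k2 + a.
Proof.
move=> h.
have h2 Y : sol p n2 k2 Y -> subopt rho p n1 k1' + subopt rho p n2 k2' -
    cost M rho p n2 Y - a <= subopt rho p n1 k1.
  move=> hY; apply: subopt_glb => X hX; have [X' [Y' [hX' hY' hle]]] := h X Y hX hY.
  have := subopt_le rho hX'; have := subopt_le rho hY'; lra.
have : subopt rho p n1 k1' + subopt rho p n2 k2' - subopt rho p n1 k1 - a <=
    subopt rho p n2 k2.
  apply: subopt_glb => Y hY; have := h2 Y hY; lra.
lra.
Qed.

Lemma eq_sol p n k1 k2 X : (forall t, (t <= n)%N -> k1 t = k2 t) ->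
  sol p n k1 X -> sol p n k2 X.
Proof. by move=> h [h1 h2]; split=> // t ht; rewrite -h ?h2. Qed.

Lemma eq_cost rho rho' p n X Y :
  (forall t, (t < n)%N -> rho t = rho' t) ->
  (forall j, in_subtree p j -> forall t, (t <= n)%N -> X j t = Y j t) ->
  cost M rho p n X = cost M rho' p n Y.
Proof.
move=> hr hX; congr (_ + _); apply: eq_bigr => j.
  move=> hj; congr (_ * _%:R); apply: eq_big_nat => t /andP[_ ht].
  by rewrite hr // hX.
case/andP => hj _; congr (_ * _%:R); apply: eq_big_nat => t /andP[_ ht].
by rewrite !hX // ltnW.
Qed.

Lemma eq_subopt rho rho' p n k1 k2 :
  (forall t, (t < n)%N -> rho t = rho' t) ->
  (forall t, (t <= n)%N -> k1 t = k2 t) ->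
  subopt rho p n k1 = subopt rho' p n k2.
Proof.
move=> hr hk; apply/eqP; rewrite eq_le; apply/andP; split; apply: subopt_transfer => X hX.
  exists X; first by apply: eq_sol hX => t ht; rewrite hk.
  by rewrite (eq_cost (rho' := rho') (Y := X)).
exists X; first by apply: eq_sol hX => t ht; rewrite hk.
by rewrite (eq_cost (rho := rho) (rho' := rho') (Y := X)).
Qed.

Definition subopt_const rho p n (j : nat) : R := subopt rho p n (fun=> j).

Definition incr rho p t (j : nat) : R := subopt_const rho p t.+1 j - subopt_const rho p t j.

(** With horizon 0 there is neither a request nor a move, and starting with another number of
    servers than [n0 p] is free. *)
Lemma subopt_const0 rho p (j : nat) : subopt_const rho p 0 j = 0.
Proof.
apply/eqP; rewrite eq_le subopt_ge0 andbT.
have [X hX] := sol_exists p 0 (fun=> j).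
rewrite /subopt_const; apply: le_trans (subopt_le rho hX) _.
by rewrite /cost !big1 ?addr0 // => i _; rewrite /misses /tv big_geq ?mulr0.
Qed.

Lemma incr_ge0 rho p t (j : nat) : 0 <= incr rho p t j.
Proof.
rewrite subr_ge0; apply: subopt_transfer => X [[h1 h2] h3].
exists X; first by split=> [|u hu]; [split=> // i hi u hu; apply: h1|apply: h3]; lia.
apply: lerD; apply: ler_sum => i hi; apply: ler_wpM2l; rewrite // ?(weight_ge0 hi) //.
  by rewrite ler_nat /misses big_nat_recr //= leq_addr.
by rewrite ler_nat /tv big_nat_recr //= leq_addr.
Qed.

Lemma incr_out rho p t (j : nat) : ~~ in_subtree p (rho t) -> incr rho p t j = 0.
Proof.
move=> hr; apply/eqP; rewrite eq_le incr_ge0 andbT subr_le0.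
apply: subopt_transfer => X [[h1 h2] h3].
exists (fun i u => X i (minn u t)).
  split=> [|u hu]; last by rewrite h3 // geq_minr.
  split=> [i hi u hu|]; first by apply: h1 => //; apply: geq_minr.
  by rewrite /box /slack !min0n.
apply: lerD; apply: ler_sum => i hi; apply: ler_wpM2l; rewrite // ?(weight_ge0 hi) //.
  rewrite ler_nat /misses big_nat_recr //= (_ : rho t == i = false) ?addn0.
    apply: eq_leq; apply: eq_big_nat => u /andP[_ hu].
    by rewrite (minn_idPl hu).
  by apply: contraNF hr => /eqP ->.
rewrite ler_nat /tv big_nat_recr //= (minn_idPr (leqnSn t)) minnn subrr addn0.
apply: eq_leq; apply: eq_big_nat => u /andP[_ hu].
by rewrite (minn_idPl hu) (minn_idPl (ltnW hu)).
Qed.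

Let swap' := swap (n0 := n0) M_ge0 D_ge0 D_parent.

(** Uncrossing of quota [j] on horizon [t.+1] with quota [j.+1] on horizon [t]. The crossing is at
    [t], where the shorter horizon ends, and the longer solution keeps the unit; nothing is dropped
    and the exchange is free. *)
Lemma incr_noninc rho p t (j : nat) : incr rho p t j.+1 <= incr rho p t j.
Proof.
suff : subopt_const rho p t.+1 j.+1 + subopt_const rho p t j <=
       subopt_const rho p t.+1 j + subopt_const rho p t j.+1 + 0 by rewrite /incr; lra.
apply: subopt_transfer2 => X Y [fX hX] [fY hY].
have [u hu|X' [Y' [fX' fY' hX' hY' hle]]] :=
  swap' rho true (leqnSn t) (leqnn t) fX fY.
  by rewrite hX ?hY //; lia.
exists X', Y'; split; last by move: hle; rewrite ltnn mulr0.
  split=> // u hu; rewrite hX'; case: ifP => h; first by rewrite hY.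
  by rewrite hX //; lia.
by split=> // u hu; rewrite hY' hu hX //; lia.
Qed.

Definition glue s (j : nat) kappa t : nat := if (t <= s)%N then j else kappa t.

Lemma glue_swap1 rho p n s (j : nat) kappa : (s <= n)%N ->
  subopt rho p n (glue s j.+1 kappa) + subopt_const rho p s j <=
  subopt rho p n (glue s j kappa) + subopt_const rho p s j.+1 + D p.
Proof.
move=> hs; apply: subopt_transfer2 => X Y [fX hX] [fY hY].
have [u hu|X' [Y' [fX' fY' hX' hY' hle]]] := swap' rho false hs (leqnn s) fX fY.
  by rewrite hX ?hY // ?/glue ?hu; lia.
exists X', Y'; split.
- split=> // u hu; rewrite hX' /glue; case: ifP => h; first by rewrite hY.
  by rewrite hX // /glue h addr0.
- by split=> // u hu; rewrite hY' hu hX ?/glue ?hu //; lia.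
apply: le_trans hle _; rewrite lerD2l ler_piMr // ltnn addn0 (ler_nat _ _ 1%N).
exact: leq_b1.
Qed.

Lemma glue_swap2 rho p n s (j : nat) kappa : (s <= n)%N ->
  subopt rho p n (glue s j kappa) + subopt_const rho p s j.+1 <=
  subopt rho p n (glue s j.+1 kappa) + subopt_const rho p s j + D p.
Proof.
move=> hs; rewrite addrC [X in _ <= X + _]addrC.
apply: subopt_transfer2 => X Y [fX hX] [fY hY].
have [u hu|X' [Y' [fX' fY' hX' hY' hle]]] := swap' rho false (leqnn s) hs fX fY.
  by rewrite hX ?hY // ?/glue ?hu; lia.
exists X', Y'; split.
- by split=> // u hu; rewrite hX' hu hY ?/glue ?hu //; lia.
- split=> // u hu; rewrite hY' /glue; case: ifP => h; first by rewrite hX.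
  by rewrite hY // /glue h.
apply: le_trans hle _; rewrite lerD2l ler_piMr // ltnn andbF add0n (ler_nat _ _ 1%N).
exact: leq_b1.
Qed.

(** One more frozen server changes the optimum as it changes the constant-quota optimum on [[0, s]],
    up to one unit dropped at [s]; crossing at [s] gives both directions. *)
Lemma glue_lip rho p n s (i j : nat) kappa : (s <= n)%N ->
  `|(subopt rho p n (glue s i kappa) - subopt_const rho p s i) -
    (subopt rho p n (glue s j kappa) - subopt_const rho p s j)| <=
  D p * (absz (i%:Z - j%:Z)%R)%:R.
Proof.
move=> hs; wlog hij : i j / (i <= j)%N.
  move=> hw; case/orP: (leq_total i j) => h; first exact: hw.
  by rewrite distrC (_ : absz _ = absz (j%:Z - i%:Z)%R); [apply: hw|lia].
rewrite -(subnKC hij); set m := (j - i)%N; clearbody m.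
have -> : absz (i%:Z - (i + m)%N%:Z)%R = m by lia.
elim: m => [|m IH]; first by rewrite addn0 subrr normr0 mulr0.
rewrite addnS; have h1 := glue_swap1 rho p (i + m) kappa hs.
have h2 := glue_swap2 rho p (i + m) kappa hs.
move: IH h1 h2; rewrite -natr1 mulrDr mulr1 !ler_norml.
set a := subopt _ _ _ _; set a' := subopt _ _ _ _; set b := subopt _ _ _ _.
set x := D p * _; lra.
Qed.

(* Telescoping over [s] the subtree optima whose quota is frozen up to time [s]. *)
Lemma subopt_incr rho p n kappa :
  `|subopt rho p n kappa - \sum_(0 <= t < n) incr rho p t (kappa t.+1)| <=
  D p * (tv n (fun t => (kappa t)%:Z))%:R.
Proof.
pose G s := subopt rho p n (glue s (kappa s) kappa) - subopt_const rho p s (kappa s).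
have G0 : subopt rho p n kappa = G 0%N.
  rewrite /G subopt_const0 subr0; apply: eq_subopt => // t _.
  by rewrite /glue; case: t.
suff H m : (m <= n)%N -> `|G (n - m)%N - \sum_(n - m <= t < n) incr rho p t (kappa t.+1)| <=
    D p * (\sum_(n - m <= t < n) absz ((kappa t.+1)%:Z - (kappa t)%:Z)%R)%N%:R.
  by have := H n (leqnn n); rewrite subnn -G0.
elim: m => [_|m IH hm].
  rewrite subn0 !big_geq // subr0 mulr0 /G /subopt_const.
  rewrite (@eq_subopt rho rho p n _ (fun=> kappa n)) ?subrr ?normr0 // => t ht.
  by rewrite /glue ht.
have {}IH := IH (ltnW hm); set s := (n - m.+1)%N.
have hs : (n - m = s.+1)%N by rewrite /s; lia.
have hsn : (s < n)%N by rewrite /s; lia.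
rewrite hs in IH; rewrite !(big_ltn hsn) /= natrD mulrDr.
have hl := glue_lip rho p (kappa s) (kappa s.+1) kappa (ltnW hsn).
have e1 : subopt rho p n (glue s (kappa s.+1) kappa) =
          subopt rho p n (glue s.+1 (kappa s.+1) kappa).
  apply: eq_subopt => // t ht; rewrite /glue [(t <= s.+1)%N]leq_eqVlt ltnS.
  by case: eqP => [->|_] /=; first by rewrite ltnn.
rewrite e1 in hl.
have e2 : absz ((kappa s)%:Z - (kappa s.+1)%:Z)%R = absz ((kappa s.+1)%:Z - (kappa s)%:Z)%R by lia.
rewrite e2 in hl; move: IH hl; rewrite /G {3}/incr !ler_norml.
set S := \sum_(_ <= t < n) _; set u := D p * _; set v := D p * _.
rewrite /incr; lra.
Qed.

End SubtreeOpt.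

(** * Monotone couplings and random quota histories *)

Section Coupling.
Context {R : realType} (k : nat).
Implicit Types y z : 'I_k.+1 -> R.

Definition is_dist y := (forall j, 0 <= y j) /\ \sum_j y j = 1.

Definition cdf y (m : nat) : R := \sum_(j < k.+1 | (j < m)%N) y j.

(** The Wasserstein-1 distance on [0..k], in the form in which one location contributes to the
    movement cost of an allocation. *)
Definition cdf_dist y z : R := \sum_(m < k.+1 | (0 < m)%N) `|cdf z m - cdf y m|.

Lemma cdf0 y : cdf y 0 = 0.
Proof. by rewrite /cdf big_pred0. Qed.

Lemma cdfS y (i : 'I_k.+1) : cdf y i.+1 = cdf y i + y i.
Proof.
rewrite /cdf (bigD1 i) //= addrC; congr (_ + _); apply: eq_bigl => j.
by rewrite ltnS (ltn_neqAle j i) andbC.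
Qed.

Lemma cdf_max y : is_dist y -> cdf y k.+1 = 1.
Proof. by case=> _ <-; apply: eq_bigl => j; rewrite ltn_ord. Qed.

Lemma cdf_ge0 y m : is_dist y -> 0 <= cdf y m.
Proof. by case=> h _; apply: sumr_ge0 => j _. Qed.

Lemma cdf_le1 y m : is_dist y -> cdf y m <= 1.
Proof.
case=> h <-; rewrite [leRHS](bigID (fun j : 'I_k.+1 => (j < m)%N)) /= lerDl.
by apply: sumr_ge0 => j _.
Qed.

Lemma telescope_ord (g : nat -> R) m : (m <= k.+1)%N ->
  \sum_(i < k.+1 | (i < m)%N) (g i.+1 - g i) = g m - g 0%N.
Proof.
move=> hm; rewrite -(big_ord_widen _ (fun i => g i.+1 - g i) hm).
by rewrite -(big_mkord predT (fun i => g i.+1 - g i)) telescope_sumr.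
Qed.

Lemma ord_indicator_sum (i : 'I_k.+1) :
  i%:R = \sum_(m < k.+1 | (0 < m)%N) (1 - (i < m)%N%:R) :> R.
Proof.
rewrite big_mkcond big_ord_recl /= add0r.
under eq_bigr => m _ do rewrite /bump leq0n add1n ltnS leqNgt.
have hi : (i <= k)%N by rewrite -ltnS.
rewrite -[in LHS](card_ord i) -sum1_card natr_sum (big_ord_widen _ (fun=> 1) hi).
rewrite big_mkcond; apply: eq_bigr => m _.
by case: (m < i)%N => /=; rewrite ?subr0 ?subrr.
Qed.

(* Joint law of the quantiles of [y] and [z] at a common uniform point. *)
Definition joint y z (i j : 'I_k.+1) : R :=
  (Num.min (cdf y i.+1) (cdf z j.+1) - Num.min (cdf y i) (cdf z j.+1)) -
  (Num.min (cdf y i.+1) (cdf z j) - Num.min (cdf y i) (cdf z j)).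

Lemma joint_ge0 y z i j : is_dist y -> is_dist z -> 0 <= joint y z i j.
Proof.
move=> [hy _] [hz _]; rewrite /joint !cdfS; have := hy i; have := hz j.
move: (cdf y i) (cdf z j) (y i) (z j) => a b u v hu hv.
by case: (leP (a + u) (b + v)); case: (leP a (b + v)); case: (leP (a + u) b);
  case: (leP a b); lra.
Qed.

Lemma jointC y z i j : joint y z i j = joint z y j i.
Proof.
rewrite /joint !(minC (cdf y _)).
set a := Num.min _ _; set b := Num.min _ _; set c := Num.min _ _; set d := Num.min _ _; lra.
Qed.

Lemma sum_joint y z m m' : is_dist y -> is_dist z -> (m <= k.+1)%N -> (m' <= k.+1)%N ->
  \sum_(i < k.+1 | (i < m)%N) \sum_(j < k.+1 | (j < m')%N) joint y z i j =
  Num.min (cdf y m) (cdf z m').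
Proof.
move=> hy hz hm hm'.
under eq_bigr => i _.
  rewrite (telescope_ord (fun j => Num.min (cdf y i.+1) (cdf z j) - Num.min (cdf y i) (cdf z j)) hm').
  over.
pose g i := Num.min (cdf y i) (cdf z m') - Num.min (cdf y i) (cdf z 0).
transitivity (\sum_(i < k.+1 | (i < m)%N) (g i.+1 - g i)).
  by apply: eq_bigr => i _; rewrite /g; ring.
rewrite (telescope_ord g hm) /g !cdf0 minxx.
by rewrite (min_idPr (cdf_ge0 _ hy)) (min_idPl (cdf_ge0 _ hz)); lra.
Qed.

Lemma joint_marginal y z i : is_dist y -> is_dist z -> \sum_j joint y z i j = y i.
Proof.
move=> hy hz.
have h m : (m <= k.+1)%N -> \sum_(i < k.+1 | (i < m)%N) \sum_j joint y z i j = cdf y m.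
  move=> hm; rewrite -[RHS](min_idPl (cdf_le1 m hy)) -(cdf_max hz) -sum_joint //.
  by apply: eq_bigr => i' _; apply: eq_bigl => j; rewrite ltn_ord.
have e : cdf (fun i => \sum_j joint y z i j) i.+1 = cdf y i.+1 by apply: h.
have e' : cdf (fun i => \sum_j joint y z i j) i = cdf y i by apply: h; apply: ltnW.
by move: e; rewrite !cdfS e' => /addrI.
Qed.

Lemma joint_cost y z : is_dist y -> is_dist z ->
  \sum_i \sum_j joint y z i j * `|i%:R - j%:R| <= cdf_dist y z.
Proof.
move=> hy hz.
(* [|i - j|] counts the thresholds [m] separating [i] from [j], and the factor multiplying [joint]
   is the indicator of separation. *)
apply: le_trans (_ : \sum_(m < k.+1 | (0 < m)%N) \sum_i \sum_j joint y z i j *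
   ((i < m)%N%:R + (j < m)%N%:R - 2 * ((i < m)%N && (j < m)%N)%:R) <= _).
  rewrite [leRHS]exchange_big; apply: ler_sum => i _ /=.
  rewrite [leRHS]exchange_big; apply: ler_sum => j _ /=.
  rewrite -mulr_sumr; apply: ler_wpM2l; first exact: joint_ge0.
  rewrite !ord_indicator_sum -sumrB; apply: le_trans (ler_norm_sum _ _ _) _.
  apply: ler_sum => m _; case: (i < m)%N; case: (j < m)%N => /=; rewrite ler_norml; lra.
apply: ler_sum => m _.
have e1 : \sum_i \sum_j joint y z i j * (i < m)%N%:R = cdf y m.
  rewrite /cdf [RHS]big_mkcond; apply: eq_bigr => i _.
  by rewrite -mulr_suml joint_marginal //; case: (i < m)%N; rewrite ?mulr1 ?mulr0.
have e2 : \sum_i \sum_j joint y z i j * (j < m)%N%:R = cdf z m.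
  rewrite exchange_big /cdf [RHS]big_mkcond; apply: eq_bigr => j _ /=.
  rewrite -mulr_suml; under eq_bigr do rewrite jointC.
  by rewrite joint_marginal //; case: (j < m)%N; rewrite ?mulr1 ?mulr0.
have e3 : \sum_i \sum_j joint y z i j * ((i < m)%N && (j < m)%N)%:R =
    Num.min (cdf y m) (cdf z m).
  rewrite -sum_joint //; try exact: ltnW.
  rewrite [RHS]big_mkcond; apply: eq_bigr => i _; case: (i < m)%N => /=; last first.
    by rewrite big1 // => j _; rewrite mulr0.
  rewrite [RHS]big_mkcond; apply: eq_bigr => j _.
  by case: (j < m)%N; rewrite ?mulr1 ?mulr0.
have -> : \sum_i \sum_j joint y z i j *
   ((i < m)%N%:R + (j < m)%N%:R - 2 * ((i < m)%N && (j < m)%N)%:R) =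
   cdf y m + cdf z m - 2 * Num.min (cdf y m) (cdf z m).
  rewrite -e3 -e1 -e2 mulr_sumr -big_split -sumrB /=; apply: eq_bigr => i _.
  rewrite mulr_sumr -big_split -sumrB /=; apply: eq_bigr => j _; ring.
by case: (leP (cdf y m) (cdf z m)) => h; [rewrite ger0_norm|rewrite ltr0_norm]; lra.
Qed.

Lemma coupling y z : is_dist y -> is_dist z -> exists K : 'I_k.+1 -> 'I_k.+1 -> R,
  [/\ forall i j, 0 <= K i j, forall i, \sum_j K i j = 1,
      forall j, \sum_i y i * K i j = z j &
      \sum_i y i * \sum_j K i j * `|i%:R - j%:R| <= cdf_dist y z].
Proof.
move=> hy hz.
(* Rows of mass zero get the identity, so that every row of [K] is a distribution. *)
pose K (i j : 'I_k.+1) : R := if y i == 0 then (i == j)%:R else joint y z i j / y i.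
have yK i j : y i * K i j = joint y z i j.
  rewrite /K; case: eqVneq => [h|h]; last by rewrite mulrC divfK.
  rewrite h mul0r; apply/esym/eqP; rewrite eq_le joint_ge0 // andbT -h.
  rewrite -(joint_marginal i hy hz) (bigD1 j) //= lerDl.
  by apply: sumr_ge0 => j' _; apply: joint_ge0.
exists K; split.
- move=> i j; rewrite /K; case: eqP => // _.
  by apply: divr_ge0; [apply: joint_ge0|case: hy].
- move=> i; rewrite /K; case: eqVneq => h; last by rewrite -mulr_suml joint_marginal // divff.
  by rewrite (bigD1 i) //= eqxx big1 ?addr0 // => j /negbTE; rewrite eq_sym => ->.
- move=> j; under eq_bigr do rewrite yK jointC.
  exact: joint_marginal.
- apply: le_trans (joint_cost hy hz); apply: ler_sum => i _; rewrite mulr_sumr.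
  by apply: ler_sum => j _; rewrite mulrA yK.
Qed.

Definition kernel y z : 'I_k.+1 -> 'I_k.+1 -> R :=
  match pselect (is_dist y /\ is_dist z) with
  | left h => sval (cid (coupling h.1 h.2))
  | right _ => fun i j => (i == j)%:R
  end.

Lemma kernelP y z : is_dist y -> is_dist z ->
  [/\ forall i j, 0 <= kernel y z i j, forall i, \sum_j kernel y z i j = 1,
      forall j, \sum_i y i * kernel y z i j = z j &
      \sum_i y i * \sum_j kernel y z i j * `|i%:R - j%:R| <= cdf_dist y z].
Proof.
move=> hy hz; rewrite /kernel; case: pselect => [h|[]//].
by case: cid.
Qed.

(** The easy half of Kantorovich duality, read off the coupling. *)
Lemma lipschitz_mean y z (f : 'I_k.+1 -> R) : is_dist y -> is_dist z ->
  (forall i j, `|f i - f j| <= `|i%:R - j%:R|) ->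
  `|\sum_j f j * z j - \sum_j f j * y j| <= cdf_dist y z.
Proof.
move=> hy hz hf; have [K0 K1 Ky Kc] := kernelP hy hz.
apply: le_trans Kc.
have -> : \sum_j f j * z j - \sum_j f j * y j =
    \sum_i y i * \sum_j kernel y z i j * (f j - f i).
  have -> : \sum_j f j * z j = \sum_i y i * \sum_j kernel y z i j * f j.
    under eq_bigr do rewrite -Ky mulr_sumr.
    rewrite exchange_big; apply: eq_bigr => i _; rewrite mulr_sumr.
    by apply: eq_bigr => j _; ring.
  rewrite -sumrB; apply: eq_bigr => i _.
  under [in RHS]eq_bigr do rewrite mulrBr.
  by rewrite sumrB -mulr_suml K1; ring.
apply: le_trans (ler_norm_sum _ _ _) _; apply: ler_sum => i _.
rewrite normrM (ger0_norm (hy.1 i)); apply: ler_wpM2l; first exact: hy.1.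
apply: le_trans (ler_norm_sum _ _ _) _; apply: ler_sum => j _.
rewrite normrM (ger0_norm (K0 _ _)); apply: ler_wpM2l; first exact: K0.
by rewrite distrC.
Qed.

Definition delta (i j : 'I_k.+1) : R := (j == i)%:R.

Lemma delta_dist i : is_dist (delta i).
Proof.
split=> [j|]; first exact: ler0n.
by rewrite (bigD1 i) //= /delta eqxx big1 ?addr0 // => j /negbTE ->.
Qed.

Lemma sum_delta i (f : 'I_k.+1 -> R) : \sum_j delta i j * f j = f i.
Proof.
rewrite (bigD1 i) //= /delta eqxx mul1r big1 ?addr0 // => j /negbTE ->.
by rewrite mul0r.
Qed.

End Coupling.
Arguments delta R {k} i j.

(** A left fold whose step also sees the prefix read so far, the shape of an online algorithm. *)
Definition rrec (A V : Type) (v0 : V) (F : seq A -> A -> V -> V) (r : seq A) : V :=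
  (foldl (fun st a => (rcons st.1 a, F st.1 a st.2)) ([::], v0) r).2.

Lemma rrec_rcons A V (v0 : V) (F : seq A -> A -> V -> V) r a :
  rrec v0 F (rcons r a) = F r a (rrec v0 F r).
Proof.
rewrite /rrec -cats1 foldl_cat /=; congr (F _ _ _).
by elim/last_ind: r => // r b IH; rewrite -cats1 foldl_cat /= IH cats1.
Qed.

(** * Expectations over random quota histories *)

Section Histories.
Context {R : realType} (k : nat) (A Q : Type) (quotaf : Q -> 'I_k.+1).
Context (mk : seq A -> A -> 'I_k.+1 -> Q) (kappa0 : 'I_k.+1).
Context (mkE : forall r a j, quotaf (mk r a j) = j).
Context (y : seq A -> 'I_k.+1 -> R).
Implicit Types (r : seq A) (a : A) (s : seq Q) (f g : seq Q -> R).

Definition lastq s : 'I_k.+1 := last kappa0 (map quotaf s).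

Definition step_mean r a s (phi : 'I_k.+1 -> R) : R :=
  \sum_j kernel (y r) (y (rcons r a)) (lastq s) j * phi j.

(** Expectation over a Markov chain: given [s], the next quota is drawn from the coupling kernel at
    the last quota of [s]. As a functional of [f] it needs no probability space. *)
Definition mean : seq A -> (seq Q -> R) -> R :=
  rrec (fun f => f [::])
    (fun r a E f => E (fun s => step_mean r a s (fun j => f (rcons s (mk r a j))))).

Lemma mean_nil f : mean [::] f = f [::].
Proof. by []. Qed.

Lemma mean_rcons r a f : mean (rcons r a) f =
  mean r (fun s => step_mean r a s (fun j => f (rcons s (mk r a j)))).
Proof. by rewrite /mean rrec_rcons. Qed.

(** Contains the support of the law behind [mean], so pointwise bounds are required only here. *)
Inductive history : seq A -> seq Q -> Prop :=
| history_nil : history [::] [::]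
| history_rcons r a s j : history r s -> history (rcons r a) (rcons s (mk r a j)).

Lemma lastq_rcons s r a j : lastq (rcons s (mk r a j)) = j.
Proof. by rewrite /lastq map_rcons last_rcons mkE. Qed.

Context (y_dist : forall r, is_dist (y r)) (y_nil : y [::] =1 delta R kappa0).

Lemma step_mean_le r a s phi psi : (forall j, phi j <= psi j) ->
  step_mean r a s phi <= step_mean r a s psi.
Proof.
move=> h; have [K0 _ _ _] := kernelP (y_dist r) (y_dist (rcons r a)).
by apply: ler_sum => j _; apply: ler_wpM2l.
Qed.

Lemma step_mean_cst r a s c : step_mean r a s (fun=> c) = c.
Proof.
have [_ K1 _ _] := kernelP (y_dist r) (y_dist (rcons r a)).
by rewrite /step_mean -mulr_suml K1 mul1r.
Qed.

Lemma step_meanD r a s phi psi :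
  step_mean r a s (fun j => phi j + psi j) = step_mean r a s phi + step_mean r a s psi.
Proof. by rewrite -big_split; apply: eq_bigr => j _; rewrite mulrDr. Qed.

Lemma step_meanZ r a s c phi :
  step_mean r a s (fun j => c * phi j) = c * step_mean r a s phi.
Proof. by rewrite mulr_sumr; apply: eq_bigr => j _; rewrite mulrCA. Qed.

Lemma mean_le r f g : (forall s, history r s -> f s <= g s) -> mean r f <= mean r g.
Proof.
elim/last_ind: r f g => [|r a IH] f g h; first by apply: h; constructor.
rewrite !mean_rcons; apply: IH => s hs; apply: step_mean_le => j.
by apply: h; constructor.
Qed.

Lemma eq_mean r f g : (forall s, history r s -> f s = g s) -> mean r f = mean r g.
Proof. by move=> h; apply/eqP; rewrite eq_le !mean_le // => s /h ->. Qed.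

Lemma mean_cst r c : mean r (fun=> c) = c.
Proof.
elim/last_ind: r => [|r a IH] //; rewrite mean_rcons -[RHS]IH.
by apply: eq_mean => s _; apply: step_mean_cst.
Qed.

Lemma meanD r f g : mean r (fun s => f s + g s) = mean r f + mean r g.
Proof.
elim/last_ind: r f g => [|r a IH] f g //; rewrite !mean_rcons -IH.
by apply: eq_mean => s _; apply: step_meanD.
Qed.

Lemma meanZ r c f : mean r (fun s => c * f s) = c * mean r f.
Proof.
elim/last_ind: r f => [|r a IH] f //; rewrite !mean_rcons -IH.
by apply: eq_mean => s _; apply: step_meanZ.
Qed.

Lemma mean_sum r (I : finType) (P : pred I) (F : I -> seq Q -> R) :
  mean r (fun s => \sum_(i | P i) F i s) = \sum_(i | P i) mean r (F i).
Proof.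
have H (l : seq I) : mean r (fun s => \sum_(i <- l) F i s) = \sum_(i <- l) mean r (F i).
  elim: l => [|i l IH].
    by rewrite big_nil -[RHS](mean_cst r); apply: eq_mean => s _; rewrite big_nil.
  by rewrite big_cons -IH -meanD; apply: eq_mean => s _; rewrite big_cons.
by rewrite -[RHS]big_enum -H; apply: eq_mean => s _; rewrite big_enum.
Qed.

Lemma mean_ge0 r f : (forall s, history r s -> 0 <= f s) -> 0 <= mean r f.
Proof. by move=> h; rewrite -(mean_cst r 0); apply: mean_le. Qed.

Lemma mean_last r (f : 'I_k.+1 -> R) :
  mean r (fun s => f (lastq s)) = \sum_j y r j * f j.
Proof.
elim/last_ind: r f => [|r a IH] f.
  rewrite mean_nil -[f (lastq [::])](sum_delta (R := R)).
  by apply: eq_bigr => j _; rewrite y_nil.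
pose G i := \sum_j kernel (y r) (y (rcons r a)) i j * f j.
rewrite mean_rcons (@eq_mean _ _ (fun s => G (lastq s))) => [|s _]; last first.
  by apply: eq_bigr => j _; rewrite lastq_rcons.
rewrite IH /G; have [_ _ Ky _] := kernelP (y_dist r) (y_dist (rcons r a)).
under [RHS]eq_bigr do rewrite -Ky mulr_suml.
rewrite exchange_big; apply: eq_bigr => i _; rewrite mulr_sumr.
by apply: eq_bigr => j _; rewrite mulrA.
Qed.

Lemma mean_step r a F g phi :
  (forall s j, history r s ->
     F (rcons s (mk r a j)) = g s + phi (rcons s (mk r a j))) ->
  mean (rcons r a) F = mean r g + mean (rcons r a) phi.
Proof.
move=> h; rewrite !mean_rcons -meanD; apply: eq_mean => s hs.
rewrite -(step_mean_cst r a s (g s)) -step_meanD.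
by apply: eq_bigr => j _; rewrite h.
Qed.

(** The kernel sees the history only through its last quota, whose law is [y r], so the expected
    displacement is the cost of the monotone coupling. *)
Lemma mean_move r a F g : (forall s j, history r s ->
     F (rcons s (mk r a j)) = g s + `|(lastq s)%:R - j%:R|) ->
  mean (rcons r a) F <= mean r g + cdf_dist (y r) (y (rcons r a)).
Proof.
move=> h; have [_ _ _ Kc] := kernelP (y_dist r) (y_dist (rcons r a)).
apply: le_trans (lerD (lexx _) Kc).
rewrite -(mean_last r (fun i => \sum_j kernel (y r) (y (rcons r a)) i j * `|i%:R - j%:R|)).
rewrite -meanD mean_rcons; apply: mean_le => s hs.
rewrite -(step_mean_cst r a s (g s)) -step_meanD.
by apply: step_mean_le => j; rewrite h.
Qed.

(** Jensen's inequality for the absolute value. *)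
Lemma mean_norm_dist r a f g :
  `|mean (rcons r a) f - mean r g| <=
  mean r (fun s => step_mean r a s (fun j => `|f (rcons s (mk r a j)) - g s|)).
Proof.
have hD : mean (rcons r a) f - mean r g =
    mean r (fun s => step_mean r a s (fun j => f (rcons s (mk r a j)) - g s)).
  rewrite mean_rcons -mulN1r -meanZ -meanD; apply: eq_mean => s _.
  by rewrite mulN1r [RHS]step_meanD step_mean_cst.
rewrite ler_norml hD -mulN1r -meanZ; apply/andP; split; apply: mean_le => s _.
  rewrite -step_meanZ; apply: step_mean_le => j.
  by rewrite mulN1r lerNl -normrN ler_norm.
by apply: step_mean_le => j; apply: ler_norm.
Qed.

(** The kernel from a point mass to itself stays at the point, so only the constant history has
    positive weight. This is the situation at the root. *)
Lemma mean_delta_le r f g : (forall r, y r =1 delta R kappa0) ->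
  (forall s, history r s -> all (fun q => quotaf q == kappa0) s -> f s <= g s) ->
  mean r f <= mean r g.
Proof.
move=> hd; elim/last_ind: r f g => [|r a IH] f g h; first by apply: h; first by constructor.
rewrite !mean_rcons; apply: IH => s hs hall.
have hl : lastq s = kappa0.
  rewrite /lastq; elim/last_ind: s {hs} hall => // s q _.
  by rewrite all_rcons map_rcons last_rcons => /andP[/eqP].
have [_ _ Ky _] := kernelP (y_dist r) (y_dist (rcons r a)).
have Kd j : kernel (y r) (y (rcons r a)) kappa0 j = delta R kappa0 j.
  rewrite -(hd (rcons r a)) -Ky -(sum_delta kappa0 (fun i => kernel (y r) (y (rcons r a)) i j)).
  by apply: eq_bigr => i _; rewrite hd.
rewrite /step_mean hl; under eq_bigr do rewrite Kd.
under [leRHS]eq_bigr do rewrite Kd.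
rewrite !sum_delta; apply: h; first by constructor.
by rewrite all_rcons hall mkE eqxx.
Qed.

End Histories.

(** * Allocation instances on the stars of the tree *)

Lemma sum_tnth (A : Type) (V : nmodType) (s : seq A) (x0 : A) (F : A -> nat -> V) :
  \sum_(t < size s) F (tnth (in_tuple s) t) t = \sum_(0 <= t < size s) F (nth x0 s t) t.
Proof. by rewrite big_mkord; apply: eq_bigr => t _; rewrite (tnth_nth x0). Qed.

Lemma sum_tnth_rcons (A : Type) (V : nmodType) (s : seq A) q (F G : A -> nat -> V) :
  (forall q t, (t < size s)%N -> F q t = G q t) ->
  \sum_(t < size (rcons s q)) F (tnth (in_tuple (rcons s q)) t) t =
  \sum_(t < size s) G (tnth (in_tuple s) t) t + F q (size s).
Proof.
move=> h; rewrite !(sum_tnth _ q) size_rcons big_nat_recr //= nth_rcons ltnn eqxx.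
congr (_ + _); apply: eq_big_nat => t /andP[_ ht].
by rewrite nth_rcons ht h.
Qed.

Section AllocationCosts.
Context {R : realType} (k d : nat).
Implicit Types (A : alloc_alg R k d) (s : seq (request R k d)) (q : request R k d).

Lemma run_rcons A s q t : (t <= size s)%N -> run A (rcons s q) t = run A s t.
Proof. by move=> ht; rewrite /run -cats1 takel_cat. Qed.

Lemma run_size A s : run A s (size s) = A s.
Proof. by rewrite /run take_size. Qed.

Lemma hit_cost_rcons A s q : hit_cost (rcons s q) (run A (rcons s q)) =
  hit_cost s (run A s) + \sum_j hit q j * A (rcons s q) (location q) j.
Proof.
rewrite /hit_cost (@sum_tnth_rcons _ _ s q (fun q' t => \sum_(j < k.+1) hit q' j *
    run A (rcons s q) t.+1 (location q') j)
  (fun q' t => \sum_(j < k.+1) hit q' j * run A s t.+1 (location q') j)).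
  by rewrite -(size_rcons s q) run_size.
by move=> q' t ht; apply: eq_bigr => j _; rewrite run_rcons.
Qed.

Definition move_step (w : 'I_d -> R) (x x' : state R k d) : R :=
  \sum_(i < d) w i * \sum_(j < k.+1 | (0 < j)%N) `|below x' i j - below x i j|.

Lemma movement_cost_rcons A w s q :
  movement_cost w (rcons s q) (run A (rcons s q)) =
  movement_cost w s (run A s) + move_step w (A s) (A (rcons s q)).
Proof.
rewrite /movement_cost (@sum_tnth_rcons _ _ s q (fun _ t =>
    move_step w (run A (rcons s q) t) (run A (rcons s q) t.+1))
  (fun _ t => move_step w (run A s t) (run A s t.+1))).
  by rewrite -(size_rcons s q) run_size run_rcons // run_size.
by move=> _ t ht; rewrite !run_rcons // ltnW.
Qed.

Lemma quota_var_rcons kappa0 s q : quota_var kappa0 (rcons s q) =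
  quota_var kappa0 s + `|(last kappa0 (map (@quota R k d) s))%:R - (quota q)%:R| :> R.
Proof.
rewrite /quota_var (@sum_tnth_rcons _ _ s q (fun _ t =>
    `|(quota_at kappa0 (rcons s q) t.+1)%:R - (quota_at kappa0 (rcons s q) t)%:R|)
  (fun _ t => `|(quota_at kappa0 s t.+1)%:R - (quota_at kappa0 s t)%:R|)).
  congr (_ + _); rewrite /quota_at /= map_rcons nth_rcons size_map ltnn eqxx.
  rewrite distrC; congr `|_%:R - _|.
  rewrite -rcons_cons nth_rcons /= size_map ltnSn.
  by rewrite -(size_map (@quota R k d) s) nth_last /= (last_nth kappa0).
move=> _ t ht; rewrite /quota_at /= map_rcons nth_rcons size_map ht.
by rewrite -rcons_cons nth_rcons /= size_map ltnS (ltnW ht).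
Qed.

Lemma quota_at_tv kappa0 s : quota_var kappa0 s =
  (tv (size s) (fun t => (quota_at kappa0 s t : nat)%:Z))%:R :> R.
Proof.
rewrite /quota_var /tv big_mkord natr_sum; apply: eq_bigr => t _.
by rewrite natr_absz intr_norm rmorphB.
Qed.

Lemma below_indicator m (x : state R k d) i (j : 'I_k.+1) : (m < k.+1)%N ->
  (forall j, x i j = (nat_of_ord j == m)%:R) -> below x i j = (m < j)%N%:R.
Proof.
move=> hm hx; rewrite /below; under eq_bigr do rewrite hx.
have [h|h] := ltnP m j.
  rewrite (bigD1 (Ordinal hm)) //= eqxx big1 ?addr0 // => j' /andP[_ /eqP hne].
  by case: eqP => // e; case: hne; apply: val_inj.
by rewrite big1 // => j' hj; case: eqP => // e; move: hj; rewrite e ltnNge h.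
Qed.

Lemma sum_indicator_dist (a b : nat) : (a < k.+1)%N -> (b < k.+1)%N ->
  \sum_(j < k.+1 | (0 < j)%N) `|(a < j)%N%:R - (b < j)%N%:R| =
  (absz (a%:Z - b%:Z)%R)%:R :> R.
Proof.
wlog hab : a b / (a <= b)%N.
  move=> hw ha hb; case/orP: (leq_total a b) => h; first exact: hw.
  rewrite (_ : absz _ = absz (b%:Z - a%:Z)%R); last by lia.
  by rewrite -hw //; apply: eq_bigr => j _; rewrite distrC.
move=> ha hb; have -> : absz (a%:Z - b%:Z)%R = (b - a)%N by lia.
rewrite natrB // -[b]/(nat_of_ord (Ordinal hb)) -[a]/(nat_of_ord (Ordinal ha)).
rewrite !ord_indicator_sum -sumrB; apply: eq_bigr => j _ /=.
have : (b < j)%N -> (a < j)%N by apply: leq_ltn_trans.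
case: (a < j)%N; case: (b < j)%N => /=; rewrite ?subrr ?subr0 ?normr0 ?normr1 //; lra.
Qed.

End AllocationCosts.

Section Star.
Context {R : realType} (T : weighted_tree R).
Implicit Types p c j : T.

(** The star below [p] is indexed by all nodes of [T]. Locations that are no children need a
    positive weight too; borrowing that of a child preserves the bound on the diameter. *)
Definition star_weight p c : R :=
  if is_child c p then weight c
  else if [pick c' | is_child c' p] is Some c' then weight c' else 1.

Lemma star_weight_gt0 p c : 0 < star_weight p c.
Proof.
rewrite /star_weight; case: ifP => [/is_child_neq_troot/weight_gt0 //|_].
by case: pickP => // c' /is_child_neq_troot/weight_gt0.
Qed.

Lemma star_diam_le p (B : R) : ~~ is_leaf p -> 0 <= B ->
  (forall c, is_child c p -> weight c <= B) ->
  star_diam (fun i : 'I_#|T| => star_weight p (enum_val i)) <= 2 * B.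
Proof.
move=> hp hB h.
have hw (i : 'I_#|T|) : star_weight p (enum_val i) <= B.
  rewrite /star_weight; case: ifP => [/h //|_]; case: pickP => [c /h //|hn].
  by case/leafP: hp => c; rewrite hn.
have hd u : oapp (fun i : 'I_#|T| => star_weight p (enum_val i)) 0 u <= B by case: u.
apply: bigmax_le => [|u _]; first lra.
apply: bigmax_le => [|v _]; first lra.
rewrite /star_dist; case: ifP => _; first lra.
have := hd u; have := hd v; lra.
Qed.

(** A request outside the subtree of [p] still needs a location. Any child will do, since its hit
    vector then vanishes. *)
Definition toward p (a : T) : T :=
  if [pick c | is_child c p && in_subtree c a] is Some c then c
  else if [pick c | is_child c p] is Some c then c else p.

Lemma toward_child p a : ~~ is_leaf p -> is_child (toward p a) p.
Proof.
move=> /leafP[c hc]; rewrite /toward; case: pickP => [c' /andP[]//|_].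
by case: pickP => // hn; rewrite hn in hc.
Qed.

Lemma toward_uniq p c a : is_child c p -> in_subtree c a -> toward p a = c.
Proof.
move=> hc ha; rewrite /toward; case: pickP => [c' /andP[hc' ha']|/(_ c)].
  exact: child_uniq hc' hc ha' ha.
by rewrite hc ha.
Qed.

End Star.

(** * Lazy movement towards a virtual configuration *)

Section Pull.
Context {R : realType} (T : weighted_tree R).
Implicit Types (p c : T) (q v : T -> R).

Definition additive_mass q := forall p, ~~ is_leaf p -> \sum_(c | is_child c p) q c = q p.

Local Notation pos x := (Num.max x 0).

Lemma pos_ge0 (x : R) : 0 <= pos x.
Proof. by rewrite le_max lexx orbT. Qed.

Lemma le_pos (x : R) : x <= pos x.
Proof. by rewrite le_max lexx. Qed.

(* Each unit of mass missing at [a] is taken from a place where [q] exceeds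
   [v]: walking up from [a], from the closest subtrees with an excess. *)
Lemma pull q v (a : T) : is_leaf a -> additive_mass q ->
  (forall p, ~~ is_leaf p -> \sum_(c | is_child c p) v c <= v p) ->
  (forall p, 0 <= v p) -> v (troot T) = q (troot T) -> v a = 1 ->
  (forall i, is_leaf i -> 0 <= q i <= 1) ->
  exists q', [/\ additive_mass q', forall i, is_leaf i -> 0 <= q' i <= 1,
    q' (troot T) = q (troot T), q' a = 1 &
    forall j, `|q' j - q j| + `|q' j - v j| <= `|q j - v j|].
Proof.
move=> ha hq hv v_ge0 hroot va q01.
pose e p := q p - v p; pose on p := in_subtree p a.
pose S p := \sum_(c | is_child c p && ~~ on c) pos (e c).
(* [H p] is what the excesses hanging off the path to [a] inside the subtree of [p] can supply;
   [dl p] is the rest, to be imported from outside that subtree. *)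
pose H p := \sum_(j | in_subtree p j) (if on j then S j else 0).
pose dl p := pos (1 - q a - H p).
pose nxt p := toward p a.
have S_ge0 p : 0 <= S p by apply: sumr_ge0 => c _; apply: pos_ge0.
have nxtP p : on p -> ~~ is_leaf p -> is_child (nxt p) p && on (nxt p).
  move=> hon hp; have := subtree_child hon; rewrite (_ : a == p = false) /=.
    by case/existsP => c /andP[hc hca]; rewrite /nxt (toward_uniq hc hca) hc.
  by apply: contraNF hp => /eqP <-.
have onE p c : on p -> ~~ is_leaf p -> is_child c p -> on c = (c == nxt p).
  move=> hon hp hc; apply/idP/eqP => [h|->]; first by rewrite /nxt (toward_uniq hc h).
  by case/andP: (nxtP p hon hp).
have offE p c : ~~ on p -> is_child c p -> on c = false.
  move=> hoff hc; apply: contraNF hoff => h.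
  exact: in_subtree_trans (child_in_subtree hc) h.
have SE p : on p -> ~~ is_leaf p -> S p = \sum_(c | is_child c p && (c != nxt p)) pos (e c).
  move=> hon hp; apply: eq_bigl => c; case hc: (is_child c p) => //=.
  by rewrite (onE p c).
have SoffE p : ~~ on p -> S p = \sum_(c | is_child c p) pos (e c).
  move=> hoff; apply: eq_bigl => c; case hc: (is_child c p) => //=.
  by rewrite (offE p c).
have Hrec p : on p -> ~~ is_leaf p -> H p = S p + H (nxt p).
  move=> hon hp; rewrite /H sum_subtree hon; congr (_ + _).
  case/andP: (nxtP p hon hp) => hc hcon.
  rewrite (bigD1 (nxt p)) //= [X in _ + X]big1 ?addr0 // => c /andP[hc' hne].
  rewrite big1 // => j hj; case: ifP => // hjon.
  have : on c by apply: in_subtree_trans hj hjon.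
  by rewrite (onE p c) // (negbTE hne).
have Ha : H a = 0.
  rewrite /H big1 // => j; rewrite (leaf_subtree _ ha) => /eqP ->.
  case: ifP => // _; rewrite /S big_pred0 // => c.
  by rewrite leaf_no_child.
have esum p : ~~ is_leaf p -> e p <= \sum_(c | is_child c p) e c.
  by move=> hp; rewrite /e sumrB hq //; have := hv p hp; lra.
(* The import of [p] is at most its deficit, so raising [q p] by [dl p] never overshoots [v p]. *)
have onH p : on p -> 1 - q a - H p <= - e p.
  move: p; apply: bottom_up => p IH hon; have [hl|hp] := boolP (is_leaf p).
    have -> : p = a by apply/eqP; rewrite eq_sym -(leaf_subtree _ hl).
    by rewrite Ha /e va; lra.
  case/andP: (nxtP p hon hp) => hc hcon; have := IH _ hc hcon; rewrite (Hrec p hon hp).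
  have := esum p hp; rewrite (bigD1 (nxt p)) //=.
  have : \sum_(c | is_child c p && (c != nxt p)) e c <= S p.
    by rewrite SE //; apply: ler_sum => c _; apply: le_pos.
  set z := \sum_(c | _) _; lra.
have onr : on (troot T) by apply: in_subtree_troot.
have dlr : dl (troot T) = 0.
  by have := onH _ onr; rewrite /dl /e hroot subrr oppr0 => h; apply/max_idPr.
have dla : dl a = 1 - q a.
  rewrite /dl Ha subr0; apply/max_idPl; have := q01 a ha; lra.
have dlb p : on p -> dl p <= pos (- e p).
  by move=> hon; rewrite /dl ge_max pos_ge0 andbT; apply: le_trans (onH p hon) (le_pos _).
have dlm p : on p -> ~~ is_leaf p -> 0 <= dl (nxt p) - dl p <= S p.
  move=> hon hp; rewrite /dl (Hrec p hon hp); have := S_ge0 p.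
  by case: (leP (1 - q a - H (nxt p)) 0); case: (leP (1 - q a - (S p + H (nxt p))) 0); lra.
pose tot (x : R) p := if on p then dl (nxt p) - dl p else x.
(* Removals descend in proportion to the positive excesses. If these all vanish, so does the amount
   to be removed, and the division by 0 does no harm. *)
have [rem [_ remE]] := top_down_rec 0
  (fun c x => if on c then 0 else tot x (parent c) * (pos (e c) / S (parent c))).
have totP p : (~~ on p -> 0 <= rem p <= pos (e p)) -> ~~ is_leaf p -> 0 <= tot (rem p) p <= S p.
  move=> hr hp; rewrite /tot; case: ifP => hon; first exact: dlm.
  have /andP[-> h] := hr (negbT hon); apply: le_trans h _; rewrite /= SoffE ?hon //.
  rewrite ge_max; apply/andP; split; last by apply: sumr_ge0 => c _; apply: pos_ge0.
  apply: le_trans (esum p hp) _; apply: ler_sum => c _; exact: le_pos.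
have remP c : ~~ on c -> 0 <= rem c <= pos (e c).
  move: c; apply: top_down => [|c hc IH hoff]; first by rewrite onr.
  have hp : ~~ is_leaf (parent c) by apply/leafP; exists c; apply: parent_child.
  have /andP[t0 tS] := totP _ IH hp.
  rewrite (remE c hc) (negbTE hoff); have [S0|Sn] := eqVneq (S (parent c)) 0.
    by rewrite S0 invr0 !mulr0 lexx pos_ge0.
  have Sp : 0 < S (parent c) by rewrite lt_def Sn S_ge0.
  apply/andP; split; first by apply: mulr_ge0 => //; apply: divr_ge0; [apply: pos_ge0|exact: ltW].
  rewrite mulrCA ler_piMr ?pos_ge0 // ler_pdivrMr // mul1r //.
have remsum p : ~~ is_leaf p -> \sum_(c | is_child c p && ~~ on c) rem c = tot (rem p) p.
  move=> hp; have /andP[t0 tS] := totP p (remP p) hp.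
  rewrite (eq_bigr (fun c => tot (rem p) p * (pos (e c) / S p))) => [|c /andP[hc hoff]]; last first.
    by rewrite (remE c (is_child_neq_troot hc)) (negbTE hoff) (is_child_parent hc).
  rewrite -mulr_sumr -mulr_suml -/(S p); have [S0|Sn] := eqVneq (S p) 0; last by rewrite divff ?mulr1.
  by rewrite S0 mul0r mulr0; apply/eqP; rewrite eq_le t0 -S0 tS.
pose q' p := if on p then q p + dl p else q p - rem p.
exists q'; split.
- move=> p hp; have h := remsum p hp; have [hon|hoff] := boolP (on p).
    case/andP: (nxtP p hon hp) => hc hcon.
    rewrite (bigD1 (nxt p)) //= {1}/q' hcon.
    have -> : \sum_(c | is_child c p && (c != nxt p)) q' c =
        \sum_(c | is_child c p && (c != nxt p)) q c - tot (rem p) p.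
      have -> : tot (rem p) p = \sum_(c | is_child c p && (c != nxt p)) rem c.
        rewrite -h; apply: eq_bigl => c.
        by case hcp: (is_child c p) => //=; rewrite (onE p c).
      rewrite -sumrB; apply: eq_bigr => c /andP[hcp hne].
      by rewrite /q' (onE p c) // (negbTE hne).
    rewrite /q' hon -(hq p hp) [in RHS](bigD1 (nxt p)) //= /tot hon; ring.
  have -> : q' p = \sum_(c | is_child c p) q c - \sum_(c | is_child c p) rem c.
    rewrite /q' (negbTE hoff) (hq p hp); congr (_ - _).
    rewrite /tot (negbTE hoff) in h; rewrite -h; apply: eq_bigl => c.
    by case hc: (is_child c p) => //=; rewrite (offE p c).
  by rewrite -sumrB; apply: eq_bigr => c hc; rewrite /q' (offE p c).
- move=> i hi; rewrite /q'; case: ifP => [|/negbT] hon.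
    have -> : i = a by apply/eqP; rewrite eq_sym -(leaf_subtree _ hi).
    by rewrite dla; lra.
  have /andP[r0 r1] := remP i hon; have := q01 i hi; have := v_ge0 i.
  by move: r1; rewrite /e; case: (leP (q i - v i) 0); lra.
- by rewrite /q' onr dlr addr0.
- by rewrite /q' /on in_subtree_refl dla; ring.
move=> j; rewrite /q'; case: ifP => [|/negbT] hon.
  have := dlb j hon; have := pos_ge0 (1 - q a - H j); rewrite -/(dl j) /e.
  move: (dl j) (q j) (v j) => x y z hx; rewrite opprB.
  case: (leP (z - y) 0) => h1 h2.
    have -> : x = 0 by lra.
    by rewrite addr0 subrr normr0 add0r.
  have -> : y + x - y = x by ring.
  have h3 : y + x - z <= 0 by lra.
  have h4 : y - z <= 0 by lra.
  rewrite (ger0_norm hx) (ler0_norm h3) (ler0_norm h4); lra.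
have /andP[] := remP j hon; rewrite /e; move: (rem j) (q j) (v j) => x y z hx.
case: (leP (y - z) 0) => h1 h2.
  have -> : x = 0 by lra.
  by rewrite subr0 subrr normr0 add0r.
have -> : y - x - y = - x by ring.
have h3 : 0 <= y - x - z by lra.
rewrite normrN (ger0_norm hx) (ger0_norm h3) (ger0_norm (ltW h1)); lra.
Qed.

Lemma sum_leaves (V : nmodType) (P : pred T) (F : T -> V) :
  \sum_(i : leaves T | P (val i)) F (val i) = \sum_(x | is_leaf x && P x) F x.
Proof.
rewrite [RHS](reindex_omap (fun i : leaves T => val i) insub) /=; last first.
  by move=> x /andP[hx _]; rewrite insubT.
apply: eq_bigl => i.
by rewrite (valP i) valK eqxx andbT.
Qed.

Lemma mass_additive q : additive_mass q -> forall p,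
  mass (fun i : leaves T => q (val i)) p = q p.
Proof.
move=> hq; apply: bottom_up => p IH.
rewrite /mass (sum_leaves (in_subtree p) q); have [hl|hp] := boolP (is_leaf p).
  rewrite (big_pred1 p) // => x /=; rewrite leaf_subtree //.
  by case: eqP => [->|_]; rewrite ?hl ?andbF.
rewrite (eq_bigl _ _ (fun x => andbC (is_leaf x) (in_subtree p x))) big_mkcondr.
rewrite sum_subtree (negbTE hp) add0r -(hq p hp); apply: eq_bigr => c hc.
rewrite -[RHS](IH c hc) /mass (sum_leaves (in_subtree c) q) -big_mkcondr.
by apply: eq_bigl => x; rewrite andbC.
Qed.

End Pull.

(** * Reduction of the quota problem on a subtree to allocation on its star *)

Section Reduction.
Context {R : realType} (T : weighted_tree R) (k : nat) (sigma : R).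
Context (sigma_ge2 : 2 <= sigma) (hst : is_hst T sigma) (c0 : 'I_k -> leaves T).
Implicit Types (p c : T) (r : seq (leaves T)) (a : leaves T).
Implicit Types (X : T -> nat -> int).

Definition total_weight : R := \sum_(j : T | j != troot T) weight j.

(** A miss of probability [eta] displaces the target by at most [k * eta] at every edge, and the
    amortised analysis pays this displacement twice. *)
Definition miss_cost : R := 2 * k%:R * total_weight.

Definition init_count p : nat := #|[set a | in_subtree p (val (c0 a))]|.

Definition init_int p : int := (init_count p)%:Z.

(** Twice an upper bound for the edges below [p]: it dominates the diameter of the star and the
    length of every descending path. The root has no edge above it, so the total weight is used
    there. *)
Definition diam p : R :=
  if p == troot T then 2 * total_weight else 2 * weight p / sigma.

Lemma weight_total c : c != troot T -> weight c <= total_weight.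
Proof.
move=> hc; rewrite /total_weight (bigD1 c) //= lerDl.
by apply: sumr_ge0 => j /andP[/weight_gt0/ltW].
Qed.

Lemma total_weight_ge0 : 0 <= total_weight.
Proof. by apply: sumr_ge0 => j /weight_gt0/ltW. Qed.

Lemma miss_cost_ge0 : 0 <= miss_cost.
Proof. by rewrite /miss_cost; apply: mulr_ge0; [apply: mulr_ge0|apply: total_weight_ge0]. Qed.

Lemma child_weight p c : p != troot T -> is_child c p -> weight c <= weight p / sigma.
Proof.
move=> hp hc; have hs : 0 < sigma by apply: lt_le_trans sigma_ge2.
rewrite ler_pdivlMr //.
by rewrite mulrC; apply: hst => //; apply/leafP; exists c.
Qed.

Lemma diam_neq_troot c : c != troot T -> diam c = 2 / sigma * weight c.
Proof. by rewrite /diam => /negbTE ->; rewrite mulrAC. Qed.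

Lemma diam_ge0 p : 0 <= diam p.
Proof.
rewrite /diam; case: eqVneq => hp; first by have := total_weight_ge0; lra.
by apply: divr_ge0; [have := weight_gt0 hp; lra|have := sigma_ge2; lra].
Qed.

Lemma two_sigma : 2 / sigma <= 1.
Proof. by have h := sigma_ge2; rewrite ler_pdivrMr ?mul1r //; lra. Qed.

(** Since [2 / sigma <= 1], the sum is at most two edges [weight c], which fit into
    [diam (parent c)]. *)
Lemma diam_parent c : c != troot T -> weight c + diam c <= diam (parent c).
Proof.
move=> hc; rewrite (diam_neq_troot hc); have hw := weight_gt0 hc.
have h : 2 / sigma * weight c <= weight c.
  by rewrite -[leRHS]mul1r; apply: ler_wpM2r; [exact: ltW|exact: two_sigma].
rewrite /diam; case: eqVneq => hp; first by have := weight_total hc; lra.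
have := child_weight hp (parent_child hc); lra.
Qed.

Lemma init_countE p : init_count p = (\sum_a in_subtree p (val (c0 a)))%N.
Proof.
rewrite /init_count -sum1_card big_mkcond /=; apply: eq_bigr => a _.
by rewrite inE; case: (in_subtree _ _).
Qed.

Lemma init_count_children p : (\sum_(c | is_child c p) init_count c =
  \sum_a (in_subtree p (val (c0 a)) && (val (c0 a) != p)))%N.
Proof.
under eq_bigr do rewrite init_countE.
by rewrite exchange_big; apply: eq_bigr => a _; rewrite sum_child_in_subtree.
Qed.

Lemma init_slack p : \sum_(c | is_child c p) init_int c <= init_int p.
Proof.
rewrite /init_int -(big_morph Posz PoszD (erefl _)) lez_nat init_count_children init_countE.
by apply: leq_sum => a _; case: (in_subtree _ _) => //; case: (_ != _).
Qed.

Lemma init_count_le p : (init_count p <= k)%N.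
Proof. by rewrite -[leqRHS]card_ord /init_count max_card. Qed.

Lemma init_count_troot : init_count (troot T) = k.
Proof.
rewrite /init_count -[RHS]card_ord -cardsT; congr #|pred_of_set _|.
by apply/setP => a; rewrite !inE in_subtree_troot.
Qed.

Definition rho r (t : nat) : T := nth (troot T) (map val r) t.

Notation sopt := (subopt miss_cost init_int).
Notation sinc := (incr miss_cost init_int).

Lemma rho_prefix r r' t : (t < size r)%N -> rho (r ++ r') t = rho r t.
Proof. by move=> ht; rewrite /rho map_cat nth_cat size_map ht. Qed.

Lemma rho_last r a : rho (rcons r a) (size r) = val a.
Proof. by rewrite /rho map_rcons nth_rcons size_map ltnn eqxx. Qed.

(** An increment ignores all later requests, which makes the hit vectors available online. *)
Lemma incr_prefix r r' p t i : (t < size r)%N -> sinc (rho (r ++ r')) p t i = sinc (rho r) p t i.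
Proof.
move=> ht; rewrite /incr /subopt_const.
congr (_ - _); apply: (eq_subopt miss_cost_ge0 init_slack diam_ge0 diam_parent) => // u hu;
  apply: rho_prefix; lia.
Qed.

Definition hit_vector p r a (i : nat) : R := sinc (rho (rcons r a)) p (size r) i.

Lemma hit_vector_ge0 p r a i : 0 <= hit_vector p r a i.
Proof. exact: incr_ge0 miss_cost_ge0 init_slack diam_ge0 diam_parent _ _ _ _. Qed.

Lemma hit_vector_noninc p r a (i j : nat) : (i <= j)%N ->
  hit_vector p r a j <= hit_vector p r a i.
Proof.
move=> /subnKC <-; elim: (j - i)%N => [|n IH]; first by rewrite addn0.
rewrite addnS; apply: le_trans IH.
exact: incr_noninc miss_cost_ge0 init_slack diam_ge0 diam_parent _ _ _ _.
Qed.

Lemma hit_vector_out p r a i : ~~ in_subtree p (val a) -> hit_vector p r a i = 0.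
Proof.
move=> h; apply: (incr_out miss_cost_ge0 init_slack diam_ge0 diam_parent).
by rewrite rho_last.
Qed.

Definition star_request p r a (i : 'I_k.+1) : request R k #|T| :=
  @Request R k #|T| i (enum_rank (toward p (val a)))
    (fun i => hit_vector (toward p (val a)) r a i)
    (fun i j hij => hit_vector_noninc (toward p (val a)) r a hij)
    (fun j => hit_vector_ge0 (toward p (val a)) r a j).

Definition init_quota p : 'I_k.+1 := inord (init_count p).

Lemma init_quotaE p : init_quota p = init_count p :> nat.
Proof. by rewrite inordK // ltnS init_count_le. Qed.

Definition init_state p : state R k #|T| := fun i j =>
  (nat_of_ord j == if is_child (enum_val i) p then init_count (enum_val i) else 0)%N%:R.

Definition weights p (i : 'I_#|T|) : R := star_weight p (enum_val i).

Lemma sum_eq_nat (m : nat) (f : nat -> R) : (m <= k)%N ->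
  \sum_(j < k.+1) f j * (nat_of_ord j == m)%:R = f m.
Proof.
rewrite -ltnS => hm; rewrite (bigD1 (Ordinal hm)) //= eqxx mulr1 big1 ?addr0 // => j hj.
case: eqP => [e|]; last by rewrite mulr0.
by case/eqP: hj; apply: val_inj.
Qed.

Lemma indicator_state (m : 'I_#|T| -> nat) (q : 'I_k.+1) :
  (forall i, m i <= k)%N -> (\sum_i m i <= q)%N ->
  is_state q (fun i j => (nat_of_ord j == m i)%:R : R).
Proof.
move=> hm hq; split=> [i j|i|]; first exact: ler0n.
  by rewrite -[RHS](sum_eq_nat (fun=> 1) (hm i)); apply: eq_bigr => j _; rewrite mul1r.
under eq_bigr => i _ do rewrite (sum_eq_nat (fun j => j%:R) (hm i)).
by rewrite -natr_sum ler_nat.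
Qed.

Lemma sum_enum_val (V : nmodType) (F : T -> V) : \sum_(i < #|T|) F (enum_val i) = \sum_j F j.
Proof. by rewrite -big_enum_val. Qed.

Lemma init_stateP p : is_state (init_quota p) (init_state p) /\ is_integral (init_state p).
Proof.
split; last by move=> i j; rewrite /init_state; case: eqP; [right|left].
apply: indicator_state => [i|]; first by case: ifP => // _; apply: init_count_le.
rewrite init_quotaE (sum_enum_val (fun c => if is_child c p then init_count c else 0%N)).
rewrite -big_mkcond /= -lez_nat (big_morph Posz PoszD (erefl _)); exact: init_slack.
Qed.

Lemma size_history p r s : history (star_request p) r s -> size s = size r.
Proof. by elim=> // {}r a {}s i _ IH; rewrite !size_rcons IH. Qed.

Lemma history_nth p r s q0 : history (star_request p) r s -> forall t, (t < size r)%N ->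
  location (nth q0 s t) = enum_rank (toward p (rho r t)) /\
  forall j, hit (nth q0 s t) j = sinc (rho r) (toward p (rho r t)) t j.
Proof.
elim=> // {}r a {}s i hs IH t; rewrite size_rcons ltnS leq_eqVlt => /predU1P[->|ht].
  by rewrite nth_rcons (size_history hs) ltnn eqxx rho_last.
rewrite nth_rcons (size_history hs) ht -cats1 rho_prefix //.
have [-> h2] := IH t ht; split=> // j.
by rewrite h2 incr_prefix.
Qed.

Definition quota_path p (s : seq (request R k #|T|)) (t : nat) : nat := quota_at (init_quota p) s t.

Lemma quota_path_le p s t : (quota_path p s t <= k)%N.
Proof. by rewrite -ltnS; apply: ltn_ord. Qed.

Lemma cost_children rho p n X : cost miss_cost rho p n X =
  miss_cost * (misses rho p n (X p))%:R +
  \sum_(c | is_child c p) (weight c * (tv n (X c))%:R + cost miss_cost rho c n X).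
Proof.
rewrite /cost sum_subtree sum_strict_subtree -addrA; congr (_ + _).
rewrite -big_split; apply: eq_bigr => c _ /=.
by rewrite [X in _ + X = _](bigD1 c) ?in_subtree_refl //= addrCA.
Qed.

(** A solution on the subtree, read at the children of [p], is an integral allocation. Its movement
    is the movement along the child edges; by [subopt_incr] its hit cost is at most the children's
    costs plus [2 / sigma] times that movement. *)
Lemma alloc_opt_le p r s : ~~ is_leaf p -> history (star_request p) r s ->
  alloc_opt (weights p) (init_state p) s <=
  (1 + 2 / sigma) * sopt (rho r) p (size r) (quota_path p s).
Proof.
move=> hp hs; set n := size r; have sz := size_history hs.
have hpos : 0 < 1 + 2 / sigma.
  by have h := sigma_ge2; apply: ltr_wpDr => //; apply: divr_ge0; lra.
rewrite mulrC -ler_pdivrMr //; apply: (subopt_glb miss_cost_ge0 init_slack diam_ge0 diam_parent).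
move=> X [[slX boxX] hX]; rewrite ler_pdivrMr // mulrC.
have X0 j : in_subtree p j -> X j 0%N = init_int j.
  by apply: (box_start boxX); rewrite hX // /quota_path /quota_at /= init_quotaE.
have Xge0 j t : in_subtree p j -> (t <= n)%N -> 0 <= X j t.
  by move=> hj ht; apply: slack_ge0 hj => i hi; apply: slX.
have Xsum t : (t <= n)%N -> \sum_(c | is_child c p) X c t <= (quota_path p s t)%:Z.
  by move=> ht; rewrite -hX // -subr_ge0; apply: slX => //; apply: in_subtree_refl.
pose m c t : nat := if is_child c p then absz (X c t) else 0%N.
have hmsum t : (t <= n)%N -> (\sum_c m c t <= quota_path p s t)%N.
  move=> ht; have := Xsum t ht; rewrite -lez_nat (big_morph Posz PoszD (erefl _)).
  rewrite big_mkcond /=; congr (_ <= _); apply: eq_bigr => c _; rewrite /m; case: ifP => // hc.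
  by have := Xge0 c t (child_in_subtree hc) ht; lia.
have hm c t : (t <= n)%N -> (m c t <= k)%N.
  move=> ht; apply: leq_trans (quota_path_le p s t); apply: leq_trans (hmsum t ht).
  by rewrite (bigD1 c) //= leq_addr.
pose x (t : nat) : state R k #|T| := fun i j => (nat_of_ord j == m (enum_val i) t)%:R.
have solc c : is_child c p -> sol init_int c n (m c) X.
  move=> hc; have hsub := child_in_subtree hc; split.
    split=> [j hj|]; first exact: slX (in_subtree_trans hsub hj).
    have e j : in_subtree c j -> slack X j 0%N = slack (n0path init_int) j 0%N.
      move=> hj; apply: eq_slack => q hq; apply: X0.
      exact: in_subtree_trans hsub (in_subtree_trans hj hq).
    by split=> _ j hj; rewrite e.
  move=> t ht; rewrite /m hc; have := Xge0 c t hsub ht; lia.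
have feas : feasible (init_state p) s x.
  split.
    move=> i j; rewrite /x /init_state /m; case: ifP => // hc.
    by rewrite X0 ?child_in_subtree.
  move=> t; have ht : (t.+1 <= n)%N by rewrite /n -sz ltn_ord.
  apply: indicator_state => [i|]; first exact: hm.
  rewrite (sum_enum_val (fun c => m c t.+1)); apply: leq_trans (hmsum _ ht) _.
  have q0 := tnth (in_tuple s) t.
  by rewrite /quota_path /quota_at /= (nth_map q0) ?ltn_ord // (tnth_nth q0).
apply: le_trans (_ : hit_cost s x + movement_cost (weights p) s x <= _).
  apply: ge_inf.
    exists 0 => _ [z [[_ fz] _] <-]; apply: addr_ge0; apply: sumr_ge0 => t _.
      apply: sumr_ge0 => j _; apply: mulr_ge0; first exact: hit_ge0.
      by have [] := fz t.
    by apply: sumr_ge0 => i _; apply: mulr_ge0; [apply/ltW/star_weight_gt0|apply: sumr_ge0].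
  exists x => //; split=> // t i j; rewrite /x; case: eqP; [by right|by left].
have hmove : movement_cost (weights p) s x <=
    \sum_(c | is_child c p) weight c * (tv n (X c))%:R.
  under [leRHS]eq_bigr => c _ do rewrite /tv natr_sum mulr_sumr.
  rewrite exchange_big /= big_mkord /movement_cost sz; apply: ler_sum => t _.
  rewrite (eq_bigr (fun i => (fun c => star_weight p c *
     (absz ((m c t.+1)%:Z - (m c t)%:Z)%R)%:R) (enum_val i))) => [|i _]; last first.
    have ha : (m (enum_val i) t.+1 < k.+1)%N by rewrite ltnS hm.
    have hb : (m (enum_val i) t < k.+1)%N by rewrite ltnS hm // ltnW.
    congr (_ * _); rewrite -(sum_indicator_dist (R := R) ha hb).
    apply: eq_bigr => j _; congr `|_ - _|.
      exact: (below_indicator j ha (fun=> erefl)).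
    exact: (below_indicator j hb (fun=> erefl)).
  rewrite (sum_enum_val (fun c => star_weight p c * (absz ((m c t.+1)%:Z - (m c t)%:Z)%R)%:R)).
  rewrite [leRHS]big_mkcond /=; apply: ler_sum => c _.
  rewrite /m /star_weight; case: ifP => hc; last by rewrite subrr mulr0.
  have h1 := Xge0 c t.+1 (child_in_subtree hc) (ltn_ord t).
  have h2 := Xge0 c t (child_in_subtree hc) (ltnW (ltn_ord t)).
  by rewrite !gez0_abs.
have hhit : hit_cost s x <= \sum_(c | is_child c p)
    (cost miss_cost (rho r) c n X + 2 / sigma * (weight c * (tv n (X c))%:R)).
  apply: le_trans (_ : \sum_(c | is_child c p)
    \sum_(0 <= t < n) sinc (rho r) c t (m c t.+1) <= _).
    rewrite exchange_big /= /hit_cost.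
    have [s0|s0] := posnP (size s).
      rewrite big1 => [|t _]; last by have := ltn_ord t; rewrite {2}s0.
      apply: sumr_ge0 => t _; apply: sumr_ge0 => c _.
      exact: incr_ge0 miss_cost_ge0 init_slack diam_ge0 diam_parent _ _ _ _.
    have q0 : request R k #|T| by case: (s) s0.
    rewrite (sum_tnth _ q0 (fun q t => \sum_(j < k.+1) hit q j * x t.+1 (location q) j)).
    rewrite sz !big_nat; apply: ler_sum => t /andP[_ ht].
    have [-> hh] := history_nth q0 hs ht.
    rewrite (bigD1 (toward p (rho r t))) ?toward_child //=.
    rewrite (eq_bigr (fun j : 'I_k.+1 => (fun i => sinc (rho r) (toward p (rho r t)) t i) j *
       (nat_of_ord j == m (toward p (rho r t)) t.+1)%:R)) => [|j _]; last first.
      by rewrite hh /x enum_rankK.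
    rewrite (sum_eq_nat (fun i => sinc (rho r) (toward p (rho r t)) t i)) ?hm // lerDl.
    by apply: sumr_ge0 => c _; apply: (incr_ge0 miss_cost_ge0 init_slack diam_ge0 diam_parent).
  apply: ler_sum => c hc.
  have h1 := subopt_incr miss_cost_ge0 init_slack diam_ge0 diam_parent (rho r) c n (m c).
  have h2 := subopt_le miss_cost_ge0 init_slack diam_ge0 diam_parent (rho r) (solc c hc).
  rewrite (diam_neq_troot (is_child_neq_troot hc)) in h1.
  have e : tv n (fun t => (m c t)%:Z) = tv n (X c).
    have mX u : (u <= n)%N -> (m c u)%:Z = X c u.
      by move=> hu; have [_ ->] := solc c hc.
    by apply: eq_big_nat => t /andP[_ ht]; rewrite !mX // ltnW.
  rewrite e -[2 / sigma * _ * _]mulrA ler_norml in h1; case/andP: h1 => h1 _.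
  move: h1 h2; set S := \sum_(0 <= t < n) _; set u := 2 / sigma * _.
  set v := subopt _ _ _ _ _ _; set z := cost _ _ _ _ _; lra.
rewrite cost_children; apply: le_trans (lerD hhit hmove) _; rewrite -big_split /=.
apply: le_trans (_ : _ <= (1 + 2 / sigma) * (\sum_(c | is_child c p)
   (weight c * (tv n (X c))%:R + cost miss_cost (rho r) c n X))) _; last first.
  apply: ler_wpM2l; first exact: ltW.
  by rewrite lerDr mulr_ge0 ?miss_cost_ge0.
rewrite mulr_sumr; apply: ler_sum => c _.
have := cost_ge0 miss_cost_ge0 (rho r) c n X.
have : 0 <= 2 / sigma by have h := sigma_ge2; apply: divr_ge0; lra.
set u := 2 / sigma; set v := weight c * _; set z := cost _ _ _ _ _; nra.
Qed.
(** * The optimum as an integral flow *)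

Lemma in_subtree_child (u u' j : T) : is_child u u' -> j != u ->
  in_subtree j u = in_subtree j u'.
Proof.
move=> hu hj; rewrite in_subtreeS eq_sym (negbTE hj) (is_child_neq_troot hu) /=.
by rewrite (is_child_parent hu).
Qed.

(** The tree metric written edge by edge, the form in which a moving server changes the subtree
    counts. *)
Definition cut_dist (u v : T) : R := \sum_(j : T | j != troot T)
  weight j * `|(in_subtree j u)%:R - (in_subtree j v)%:R|.

Lemma cut_distC u v : cut_dist u v = cut_dist v u.
Proof. by apply: eq_bigr => j _; rewrite distrC. Qed.

Lemma cut_dist_child (u u' : T) : is_child u u' -> cut_dist u u' <= weight u.
Proof.
move=> hu; have hr := is_child_neq_troot hu.
rewrite /cut_dist (bigD1 u) //= big1 => [|j /andP[_ hj]]; last first.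
  by rewrite (in_subtree_child hu hj) subrr normr0 mulr0.
rewrite addr0 -[leRHS]mulr1; apply: ler_wpM2l; first exact/ltW/weight_gt0.
by rewrite in_subtree_refl child_nsubtree // subr0 normr1.
Qed.

Lemma cut_dist_walk u w : path (@adjacent R T) u w -> cut_dist u (last u w) <= walk_length u w.
Proof.
elim: w u => [|u' w IH] u /=.
  by move=> _; rewrite /cut_dist big1 // => j _; rewrite subrr normr0 mulr0.
case/andP => hadj hw; apply: le_trans (_ : _ <= cut_dist u u' + cut_dist u' (last u' w)) _.
  rewrite -big_split; apply: ler_sum => j hj /=; rewrite -mulrDr.
  by apply: ler_wpM2l; [exact/ltW/weight_gt0|exact: ler_distD].
apply: lerD; last exact: IH.
rewrite /edge_length; case: ifP hadj => [hu _|hu]; first exact: cut_dist_child.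
by rewrite /adjacent hu /= => hu'; rewrite cut_distC; apply: cut_dist_child.
Qed.

Lemma adjacent_connect (u v : T) : connect (@adjacent R T) u v.
Proof.
have hsym : connect_sym (@adjacent R T).
  by apply: sym_connect_sym => x z; rewrite /adjacent orbC.
have H x : connect (@adjacent R T) x (troot T).
  move: x; apply: top_down => [|c hc]; first exact: connect0.
  by apply: connect_trans; apply: connect1; rewrite /adjacent parent_child.
by apply: connect_trans (H u) _; rewrite hsym.
Qed.

Lemma cut_dist_le u v : cut_dist u v <= tree_dist u v.
Proof.
apply: lb_le_inf; last by move=> _ [w [hw <-] <-]; apply: cut_dist_walk.
have /connectP[w hw hl] := adjacent_connect u v.
by exists (walk_length u w); exists w.
Qed.

(** The subtree counts of a schedule form a solution without misses, and a moving server changes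
    only the counts of edges on its path. *)
Lemma sopt_le_schedule r (s : schedule T k) : serves c0 r s ->
  sopt (rho r) (troot T) (size r) (fun=> k) <= schedule_cost r s.
Proof.
move=> [hs0 hs].
pose X j t : int := (\sum_b in_subtree j (val (s t b)))%N%:Z.
have Xslack j t : \sum_(c | is_child c j) X c t <= X j t.
  rewrite -(big_morph Posz PoszD (erefl _)) lez_nat exchange_big; apply: leq_sum => b _ /=.
  by rewrite sum_child_in_subtree; case: (in_subtree _ _) => //; case: (_ != _).
have X0 j : X j 0%N = init_int j.
  by rewrite /X /init_int init_countE; congr Posz; apply: eq_bigr => b _; rewrite hs0.
have hsol : sol init_int (troot T) (size r) (fun=> k) X.
  split; last first.
    move=> t _; rewrite /X; congr Posz; rewrite -[RHS]card_ord -sum1_card.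
    by apply: eq_bigr => b _; rewrite in_subtree_troot.
  split=> [j _ t _|]; first by rewrite subr_ge0.
  have e j : slack X j 0%N = slack (n0path init_int) j 0%N by apply: eq_slack => q _; apply: X0.
  by split=> _ j _; rewrite e.
apply: le_trans (subopt_le miss_cost_ge0 init_slack diam_ge0 diam_parent (rho r) hsol) _.
rewrite /cost big1 ?add0r => [|j _]; last first.
  rewrite /misses big1_seq ?mulr0 // => t; rewrite mem_index_iota => /andP[_ /andP[_ ht]].
  case: eqP => // hrho; have [b hb] := hs (Ordinal ht).
  rewrite (tnth_nth (c0 b)) /= in hb.
  suff -> : (X j t.+1 == 0) = false by rewrite andbF.
  rewrite /X (bigD1 b) //= hb -hrho /rho (nth_map (c0 b)) // in_subtree_refl.
  by rewrite /= add1n.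
apply: le_trans (_ : _ <= \sum_(t < size r) \sum_(b < k) cut_dist (val (s t b)) (val (s t.+1 b))) _.
  under [leRHS]eq_bigr => t _ do rewrite exchange_big /=.
  rewrite exchange_big /=.
  rewrite (eq_bigl (fun j => j != troot T)) => [|j]; last by rewrite in_subtree_troot.
  apply: ler_sum => j hj; rewrite /tv big_mkord natr_sum mulr_sumr; apply: ler_sum => t _.
  rewrite -mulr_sumr; apply: ler_wpM2l; first exact/ltW/weight_gt0.
  rewrite natr_absz intr_norm rmorphB /= /X -!pmulrn !natr_sum -sumrB.
  apply: le_trans (ler_norm_sum _ _ _) _; apply: ler_sum => b _.
  by rewrite distrC.
by apply: ler_sum => t _; apply: ler_sum => b _; apply: cut_dist_le.
Qed.

Lemma sopt_le_opt r : (0 < k)%N -> sopt (rho r) (troot T) (size r) (fun=> k) <= kserver_opt c0 r.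
Proof.
move=> k_gt0; apply: lb_le_inf; last by move=> _ [s hs <-]; apply: sopt_le_schedule.
(* Sending every server to every request shows that the infimum is over a nonempty set. *)
pose s : schedule T k := fun t b => nth (c0 b) (c0 b :: r) t.
exists (schedule_cost r s); exists s => //; split=> // t.
by exists (Ordinal k_gt0); rewrite /s /= (tnth_nth (c0 (Ordinal k_gt0))).
Qed.


(** * Random quotas along the tree *)

Context (eps gamma : R) (eps_ge0 : 0 <= eps) (gamma_ge0 : 0 <= gamma).
Context (halloc : alloc_competitive k (1 + eps) gamma%:E).

Lemma weights_gt0 p i : 0 < weights p i.
Proof. exact: star_weight_gt0. Qed.

Definition alg p : alloc_alg R k #|T| :=
  sval (cid (halloc (weights_gt0 p) (init_stateP p).1 (init_stateP p).2)).

Notation bound p s := (alloc_bound (weights p) (init_quota p) (init_state p) s).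

Lemma algP p s : [/\ feasible (init_state p) s (run (alg p) s),
  hit_cost s (run (alg p) s) <= (1 + eps) * bound p s &
  movement_cost (weights p) s (run (alg p) s) <= gamma * bound p s].
Proof.
rewrite /alg; case: cid => A hA /=; have [h1 h2 h3] := hA s; split=> //.
Qed.

Lemma alg_nil p i j : alg p [::] i j = init_state p i j.
Proof. by have [[h _] _ _] := algP p [::]; apply: h. Qed.

Notation quotaf := (@quota R k #|T|).

Lemma alg_state p s : is_state (lastq quotaf (init_quota p) s) (alg p s).
Proof.
elim/last_ind: s => [|s q _].
  rewrite /lastq /= (_ : alg p [::] = init_state p); first exact: (init_stateP p).1.
  by apply/funext => i; apply/funext => j; apply: alg_nil.
have [[_ h] _ _] := algP p (rcons s q).
have hs : (size s < size (rcons s q))%N by rewrite size_rcons.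
have := h (Ordinal hs); rewrite (tnth_nth q) /= nth_rcons ltnn eqxx.
by rewrite -(size_rcons s q) run_size /lastq map_rcons last_rcons.
Qed.

(** The laws enter through the recursion that determines them; [top_down_rec] provides a solution at
    the end. *)
Context (y : T -> seq (leaves T) -> 'I_k.+1 -> R).
Context (y_root : y (troot T) = fun=> delta R ord_max).

Notation E p := (mean quotaf (star_request p) (init_quota p) (y p)).

Context (y_child : forall c, c != troot T -> y c = fun r j =>
  E (parent c) r (fun s => alg (parent c) s (enum_rank c) j)).

Lemma init_quota_root : init_quota (troot T) = ord_max.
Proof. by apply: val_inj; rewrite [LHS]init_quotaE init_count_troot. Qed.

Lemma y_dist_nil p : (forall r, is_dist (y p r)) /\ y p [::] =1 delta R (init_quota p).
Proof.
move: p; apply: top_down => [|c hc [hd hn]].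
  by rewrite y_root init_quota_root; split=> // r; apply: delta_dist.
rewrite (y_child hc); split=> [r|j].
  split=> [j|]; first by apply: mean_ge0 => // s _; have [] := alg_state (parent c) s.
  rewrite -mean_sum // -[RHS](mean_cst quotaf (star_request (parent c)) (init_quota (parent c)) hd r).
  by apply: eq_mean => // s _; have [] := alg_state (parent c) s.
rewrite mean_nil alg_nil /init_state enum_rankK (parent_child hc) /delta.
by rewrite -val_eqE /= init_quotaE.
Qed.

Lemma y_dist p r : is_dist (y p r).
Proof. exact: (y_dist_nil p).1. Qed.

Lemma y_nil p : y p [::] =1 delta R (init_quota p).
Proof. exact: (y_dist_nil p).2. Qed.

(** * Expected costs at a node and the potential *)

Definition move_mass c r : R :=
  weight c * \sum_(0 <= t < size r) cdf_dist (y c (take t r)) (y c (take t.+1 r)).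

Definition hit_mass c r : R :=
  \sum_(0 <= t < size r) \sum_(j < k.+1) y c (take t.+1 r) j * sinc (rho r) c t j.

Lemma take_rcons_le r a t : (t <= size r)%N -> take t (rcons r a) = take t r.
Proof. by move=> ht; rewrite -cats1 takel_cat. Qed.

Lemma move_mass_rcons c r a : move_mass c (rcons r a) =
  move_mass c r + weight c * cdf_dist (y c r) (y c (rcons r a)).
Proof.
rewrite /move_mass -mulrDr size_rcons big_nat_recr //= take_rcons_le // take_size.
rewrite -(size_rcons r a) take_size; congr (_ * (_ + _)).
by apply: eq_big_nat => t /andP[_ ht]; rewrite !take_rcons_le // ltnW.
Qed.

Lemma hit_mass_rcons c r a : hit_mass c (rcons r a) =
  hit_mass c r + \sum_j y c (rcons r a) j * hit_vector c r a j.
Proof.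
rewrite /hit_mass size_rcons big_nat_recr //= -(size_rcons r a) take_size.
congr (_ + _); apply: eq_big_nat => t /andP[_ ht]; apply: eq_bigr => j _.
by rewrite take_rcons_le // -cats1 incr_prefix.
Qed.

Lemma mean_hit_cost p r : ~~ is_leaf p ->
  \sum_(c | is_child c p) hit_mass c r = E p r (fun s => hit_cost s (run (alg p) s)).
Proof.
move=> hp; elim/last_ind: r => [|r a IH].
  rewrite mean_nil /hit_cost big_ord0 big1 // => c _.
  by rewrite /hit_mass big_geq.
under eq_bigr do rewrite hit_mass_rcons.
rewrite big_split /= IH.
set b := toward p (val a).
rewrite (@mean_step _ _ _ _ quotaf (star_request p) (init_quota p) (y p) (y_dist p) r a _
  (fun s => hit_cost s (run (alg p) s))
  (fun s => \sum_(j < k.+1) hit_vector b r a j * alg p s (enum_rank b) j)); last first.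
  by move=> s j hs; rewrite hit_cost_rcons.
congr (_ + _); have hb : is_child b p by apply: toward_child.
rewrite (bigD1 b) //= [X in _ + X]big1 ?addr0 => [|c /andP[hc hne]].
  rewrite mean_sum; last exact: y_dist.
  apply: eq_bigr => j _; rewrite meanZ; last exact: y_dist.
  rewrite mulrC; congr (_ * _).
  by rewrite (y_child (is_child_neq_troot hb)) (is_child_parent hb).
rewrite big1 // => j _; rewrite hit_vector_out ?mulr0 //.
by apply: contra hne => ha; rewrite /b (toward_uniq hc ha).
Qed.

Lemma cdf_mean c r m : c != troot T -> cdf (y c r) m =
  E (parent c) r (fun s => cdf (alg (parent c) s (enum_rank c)) m).
Proof. by move=> hc; rewrite /cdf mean_sum ?(y_child hc) //; apply: y_dist. Qed.

(** Movement is convex in the states, so averaged states move at most as much as the random ones do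
    on average. Hit costs are linear, which gave an equality in [mean_hit_cost]. *)
Lemma mean_movement_cost p r :
  \sum_(c | is_child c p) move_mass c r <=
  E p r (fun s => movement_cost (weights p) s (run (alg p) s)).
Proof.
elim/last_ind: r => [|r a IH].
  rewrite mean_nil /movement_cost big_ord0 big1 // => c _.
  by rewrite /move_mass big_geq ?mulr0.
under eq_bigr do rewrite move_mass_rcons.
rewrite big_split /= mean_rcons.
rewrite (@eq_mean _ _ _ _ quotaf (star_request p) (init_quota p) (y p) (y_dist p) r _
  (fun s => movement_cost (weights p) s (run (alg p) s) +
     step_mean quotaf (init_quota p) (y p) r a s
       (fun j => move_step (weights p) (alg p s) (alg p (rcons s (star_request p r a j)))))); last first.
  move=> s hs; rewrite -{1}(step_mean_cst quotaf (init_quota p) (y_dist p) r a s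
    (movement_cost (weights p) s (run (alg p) s))) -step_meanD.
  by apply: eq_bigr => j _; rewrite movement_cost_rcons.
rewrite meanD; last exact: y_dist.
apply: lerD => //.
apply: le_trans (_ : _ <= \sum_(c | is_child c p) weight c * \sum_(m < k.+1 | (0 < m)%N)
   E p r (fun s => step_mean quotaf (init_quota p) (y p) r a s (fun j =>
     `|cdf (alg p (rcons s (star_request p r a j)) (enum_rank c)) m -
       cdf (alg p s (enum_rank c)) m|))) _.
  apply: ler_sum => c hc; have hcr := is_child_neq_troot hc.
  apply: ler_wpM2l; first exact/ltW/weight_gt0.
  apply: ler_sum => m _; rewrite !cdf_mean // (is_child_parent hc).
  exact: mean_norm_dist (y_dist p) _ _ _ _.
under eq_bigr => c hc.
  rewrite -mean_sum; last exact: y_dist.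
  rewrite -meanZ; last exact: y_dist.
  over.
rewrite -mean_sum; last exact: y_dist.
apply: mean_le => [|s hs]; first exact: y_dist.
rewrite /step_mean.
under eq_bigr => c hc do rewrite exchange_big mulr_sumr /=.
rewrite exchange_big; apply: ler_sum => j _ /=.
under eq_bigr => c hc do rewrite -mulr_sumr mulrCA.
rewrite -mulr_sumr; apply: ler_wpM2l.
  by have [K0 _ _ _] := kernelP (y_dist p r) (y_dist p (rcons r a)); apply: K0.
rewrite /move_step.
rewrite (eq_bigr (fun i => (fun c => star_weight p c * \sum_(m < k.+1 | (0 < m)%N)
  `|below (alg p (rcons s (star_request p r a j))) (enum_rank c) m -
    below (alg p s) (enum_rank c) m|) (enum_val i))) => [|i _]; last by rewrite /= enum_valK.
rewrite (sum_enum_val (fun c => star_weight p c * \sum_(m < k.+1 | (0 < m)%N)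
  `|below (alg p (rcons s (star_request p r a j))) (enum_rank c) m -
    below (alg p s) (enum_rank c) m|)) [leLHS]big_mkcond; apply: ler_sum => c _.
rewrite /star_weight; case: ifP => // _.
by apply: mulr_ge0; [case: pickP => // c' /is_child_neq_troot/weight_gt0/ltW|apply: sumr_ge0].
Qed.

Lemma mean_quota_var c r : c != troot T ->
  weight c * E c r (fun s => quota_var (init_quota c) s) <= move_mass c r.
Proof.
move=> hc; have hw := ltW (weight_gt0 hc); elim/last_ind: r => [|r a IH].
  by rewrite mean_nil /quota_var big_ord0 mulr0 /move_mass big_geq ?mulr0.
rewrite move_mass_rcons; apply: le_trans (lerD IH (lexx _)); rewrite -mulrDr.
apply: ler_wpM2l => //; apply: mean_move => //.
- exact: y_dist.
- exact: y_nil.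
- by move=> s j hs; rewrite quota_var_rcons.
Qed.

Lemma quota_path_rcons p s q t : (t <= size s)%N ->
  quota_path p (rcons s q) t = quota_path p s t.
Proof.
move=> ht; rewrite /quota_path /quota_at map_rcons -rcons_cons nth_rcons /= size_map.
by rewrite ltnS ht.
Qed.

Lemma quota_path_last p s q : quota_path p (rcons s q) (size s).+1 = quota q.
Proof. by rewrite /quota_path /quota_at /= map_rcons nth_rcons size_map ltnn eqxx. Qed.

(** Each increment sees the quota at one time only, so its mean is determined by the marginal law.
    This is the gain from replacing subtree optima by sums of increments. *)
Lemma mean_incr c r :
  E c r (fun s => \sum_(0 <= t < size r) sinc (rho r) c t (quota_path c s t.+1)) =
  hit_mass c r.
Proof.
elim/last_ind: r => [|r a IH]; first by rewrite mean_nil /hit_mass !big_geq.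
rewrite hit_mass_rcons -IH.
have e : E c (rcons r a) (fun s => hit_vector c r a (lastq quotaf (init_quota c) s)) =
    \sum_j y c (rcons r a) j * hit_vector c r a j.
  exact: (mean_last (mk := star_request c) (fun _ _ _ => erefl) (y_dist c) (y_nil c) (rcons r a)
    (fun j : 'I_k.+1 => hit_vector c r a j)).
rewrite -e.
apply: mean_step => [|s j hs]; first exact: y_dist.
have sz := size_history hs.
rewrite size_rcons big_nat_recr //= -sz quota_path_last /lastq map_rcons last_rcons /= sz.
congr (_ + _); apply: eq_big_nat => t /andP[_ ht].
by rewrite quota_path_rcons ?sz // -cats1 incr_prefix.
Qed.

Definition potential p r : R :=
  E p r (fun s => sopt (rho r) p (size r) (quota_path p s) + diam p * quota_var (init_quota p) s).

Lemma sopt_ge0 r p n kap : 0 <= sopt (rho r) p n kap.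
Proof. exact: subopt_ge0 miss_cost_ge0 init_slack diam_ge0 diam_parent _ _ _ _. Qed.

Lemma quota_var_ge0 p (s : seq (request R k #|T|)) : 0 <= quota_var (init_quota p) s :> R.
Proof. exact: sumr_ge0. Qed.

Lemma potential_ge0 p r : 0 <= potential p r.
Proof.
apply: mean_ge0 => [|s _]; first exact: y_dist.
by apply: addr_ge0; [apply: sopt_ge0|apply: mulr_ge0; [apply: diam_ge0|apply: quota_var_ge0]].
Qed.

(** Passing from the optimum to the increments loses one [diam c] per unit of quota variation, and
    the potential contains another; together they are [4 / sigma] edge lengths. *)
Lemma potential_child c r : c != troot T ->
  potential c r <= hit_mass c r + 4 / sigma * move_mass c r.
Proof.
move=> hc; rewrite -(mean_incr c r).
apply: le_trans (_ : _ <= E c r (fun s =>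
    \sum_(0 <= t < size r) sinc (rho r) c t (quota_path c s t.+1) +
    2 * diam c * quota_var (init_quota c) s)) _.
  apply: mean_le => [|s hs]; first exact: y_dist.
  have := subopt_incr miss_cost_ge0 init_slack diam_ge0 diam_parent (rho r) c (size r) (quota_path c s).
  rewrite quota_at_tv (size_history hs) ler_norml => /andP[_].
  rewrite /quota_path; set S := \sum_(0 <= t < _) _; set v := diam c * _.
  rewrite -mulrA -/v; lra.
rewrite meanD; last exact: y_dist.
rewrite meanZ; last exact: y_dist.
rewrite lerD2l (diam_neq_troot hc); have := mean_quota_var r hc.
set u := E c r _; have h4 : 0 <= 4 / sigma by have h := sigma_ge2; apply: divr_ge0; lra.
move=> h; apply: le_trans (ler_wpM2l h4 h); rewrite le_eqVlt; apply/orP; left; apply/eqP; ring.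
Qed.

Lemma mean_bound p r : ~~ is_leaf p ->
  E p r (fun s => bound p s) <= (1 + 2 / sigma) * potential p r.
Proof.
move=> hp; rewrite /potential -meanZ; last exact: y_dist.
apply: mean_le => [|s hs]; first exact: y_dist.
rewrite /alloc_bound mulrDr; apply: lerD; first exact: alloc_opt_le.
have hd : star_diam (weights p) <= diam p.
  rewrite /diam; case: eqVneq => hpr.
    apply: star_diam_le => [//||c hc]; first exact: total_weight_ge0.
    exact: weight_total (is_child_neq_troot hc).
  rewrite -mulrA; apply: star_diam_le => [//||c hc]; last exact: child_weight.
  by apply: divr_ge0; [exact/ltW/weight_gt0|have h := sigma_ge2; lra].
have h1 : 0 <= 2 / sigma by have h := sigma_ge2; apply: divr_ge0; lra.
have h2 : 0 <= diam p * quota_var (init_quota p) s.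
  by apply: mulr_ge0; [apply: diam_ge0|apply: quota_var_ge0].
apply: le_trans (ler_wpM2r (quota_var_ge0 p s) hd) _.
by rewrite ler_peMl // lerDl.
Qed.

Lemma sum_potential_children p r : ~~ is_leaf p ->
  \sum_(c | is_child c p) potential c r <=
  (1 + eps + 4 / sigma * gamma) * ((1 + 2 / sigma) * potential p r).
Proof.
move=> hp.
apply: le_trans (_ : _ <= \sum_(c | is_child c p) (hit_mass c r + 4 / sigma * move_mass c r)) _.
  by apply: ler_sum => c hc; apply: potential_child; apply: is_child_neq_troot hc.
have h4 : 0 <= 4 / sigma by have h := sigma_ge2; apply: divr_ge0; lra.
rewrite big_split /= mean_hit_cost // -mulr_sumr.
apply: le_trans (lerD (lexx _) (ler_wpM2l h4 (mean_movement_cost p r))) _.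
rewrite -meanZ; last exact: y_dist.
rewrite -meanD; last exact: y_dist.
have h5 : 0 <= 1 + eps + 4 / sigma * gamma.
  apply: addr_ge0; first by apply: addr_ge0.
  exact: mulr_ge0.
apply: le_trans (ler_wpM2l h5 (mean_bound r hp)).
rewrite -meanZ; last exact: y_dist.
apply: mean_le => [|s _]; first exact: y_dist.
have [_ h1 h2] := algP p s; rewrite [leRHS]mulrDl; apply: lerD => //.
by rewrite -[leRHS]mulrA; apply: ler_wpM2l.
Qed.

Lemma sum_move_children p r : ~~ is_leaf p ->
  \sum_(c | is_child c p) move_mass c r <= gamma * ((1 + 2 / sigma) * potential p r).
Proof.
move=> hp; apply: le_trans (mean_movement_cost p r) _.
apply: le_trans (ler_wpM2l gamma_ge0 (mean_bound r hp)).
rewrite -meanZ; last exact: y_dist.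
apply: mean_le => [|s _]; first exact: y_dist.
by have [_ _] := algP p s.
Qed.

Lemma potential_root r : potential (troot T) r <= sopt (rho r) (troot T) (size r) (fun=> k).
Proof.
rewrite /potential -[leRHS](mean_cst quotaf (star_request (troot T)) (init_quota (troot T)) (y_dist (troot T)) r).
apply: mean_delta_le => //.
- exact: y_dist.
- by move=> r'; rewrite y_root init_quota_root.
move=> s hs hall.
have e : map quotaf s = nseq (size s) (init_quota (troot T)).
  by elim: (s) hall => //= q s' IH /andP[/eqP -> /IH ->].
have hq t : quota_at (init_quota (troot T)) s t = init_quota (troot T).
  by rewrite /quota_at e -[_ :: _]/(nseq (size s).+1 _) nth_nseq if_same.
rewrite (_ : quota_var _ _ = 0) ?mulr0 ?addr0; last first.
  by rewrite /quota_var big1 // => t _; rewrite !hq subrr normr0.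
rewrite le_eqVlt; apply/orP; left; apply/eqP.
apply: (eq_subopt miss_cost_ge0 init_slack diam_ge0 diam_parent) => // t _.
by rewrite /quota_path hq init_quotaE init_count_troot.
Qed.

(** At a leaf the subtree cost consists of charged misses alone, and a request is missed with the
    probability of quota 0. *)
Lemma potential_leaf i r : is_leaf i ->
  miss_cost * \sum_(0 <= t < size r) (rho r t == i)%:R * y i (take t.+1 r) ord0 <=
  potential i r.
Proof.
move=> hi.
have -> : \sum_(0 <= t < size r) (rho r t == i)%:R * y i (take t.+1 r) ord0 =
    E i r (fun s => (misses (rho r) i (size r) (fun t => (quota_path i s t)%:Z))%:R).
  elim/last_ind: r => [|r a IH]; first by rewrite mean_nil /misses !big_geq.
  rewrite size_rcons big_nat_recr //= -(size_rcons r a) take_size rho_last.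
  have -> : (val a == i)%:R * y i (rcons r a) ord0 =
      \sum_j y i (rcons r a) j * ((val a == i) && (j == ord0))%:R.
    rewrite [RHS](bigD1 ord0) //= eqxx andbT mulrC [X in _ + X]big1 ?addr0 // => j /negbTE ->.
    by rewrite andbF mulr0.
  have e : E i (rcons r a) (fun s => ((val a == i) && (lastq quotaf (init_quota i) s == ord0))%:R) =
      \sum_j y i (rcons r a) j * ((val a == i) && (j == ord0))%:R.
    exact: (mean_last (mk := star_request i) (fun _ _ _ => erefl) (y_dist i) (y_nil i) (rcons r a)
      (fun j : 'I_k.+1 => ((val a == i) && (j == ord0))%:R)).
  rewrite -e.
  transitivity (E i r (fun s => (misses (rho r) i (size r) (fun t => (quota_path i s t)%:Z))%:R) +
    E i (rcons r a) (fun s => ((val a == i) && (lastq quotaf (init_quota i) s == ord0))%:R)).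
    congr (_ + _); rewrite -IH; apply: eq_big_nat => t /andP[_ ht].
    by rewrite take_rcons_le // -cats1 rho_prefix.
  apply/esym/mean_step => [|s j hs]; first exact: y_dist.
  have sz := size_history hs.
  rewrite size_rcons /misses big_nat_recr //= natrD rho_last hi -sz quota_path_last /=.
  rewrite /lastq map_rcons last_rcons /=; congr (_%:R + _).
  by apply: eq_big_nat => t /andP[_ ht]; rewrite quota_path_rcons // -cats1 rho_prefix // -sz.
rewrite -meanZ; last exact: y_dist.
apply: mean_le => [|s hs]; first exact: y_dist.
apply: ler_wpDr; first by apply: mulr_ge0; [apply: diam_ge0|apply: quota_var_ge0].
apply: (subopt_glb miss_cost_ge0 init_slack diam_ge0 diam_parent) => X [_ hX].
rewrite cost_children; apply: ler_wpDr.
  apply: sumr_ge0 => c; by rewrite leaf_no_child.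
rewrite (_ : misses _ _ _ (X i) = misses (rho r) i (size r) (fun t => (quota_path i s t)%:Z)) //.
by apply: eq_big_nat => t /andP[_ ht]; rewrite hX.
Qed.

(** * The fractional server configuration *)

Context (k_gt1 : (1 < k)%N) (c0_inj : injective c0) (root_nonleaf : ~~ is_leaf (troot T)).

(** A fractional configuration holds at most mass 1 at a leaf, so further servers there do not
    count. *)
Definition cap p (i : 'I_k.+1) : R := if is_leaf p then (i != ord0)%:R else i%:R.

Definition virt p r : R := \sum_j cap p j * y p r j.

Lemma cap_ge0 p i : 0 <= cap p i.
Proof. by rewrite /cap; case: ifP. Qed.

Lemma cap_le p i : cap p i <= i%:R.
Proof. by rewrite /cap; case: ifP => // _; rewrite ler_nat; case: i => -[]. Qed.

Lemma virt_dist p r r' : `|virt p r' - virt p r| <= cdf_dist (y p r) (y p r').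
Proof.
apply: lipschitz_mean => [||i j]; [exact: y_dist|exact: y_dist|].
rewrite /cap; case: ifP => // _.
have pos1 (x : 'I_k.+1) : x != ord0 -> 1 <= x%:R :> R.
  by rewrite (ler_nat _ 1) lt0n; apply: contra => /eqP hx; apply/eqP/val_inj.
have [->|hi] := eqVneq i ord0; have [->|hj] := eqVneq j ord0; rewrite /= ?subrr ?normr0 //.
  by rewrite distrC subr0 normr1 distrC subr0; apply: le_trans (pos1 _ hj) (ler_norm _).
by rewrite !subr0 normr1; apply: le_trans (pos1 _ hi) (ler_norm _).
Qed.

Lemma virt_ge0 p r : 0 <= virt p r.
Proof. by apply: sumr_ge0 => j _; apply: mulr_ge0; [apply: cap_ge0|apply: (y_dist p r).1]. Qed.

Lemma virt_le p r : virt p r <= k%:R.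
Proof.
have -> : k%:R = \sum_j k%:R * y p r j by rewrite -mulr_sumr (y_dist p r).2 mulr1.
apply: ler_sum => j _.
apply: ler_wpM2r; first exact: (y_dist p r).1.
by apply: le_trans (cap_le p j) _; rewrite ler_nat -ltnS.
Qed.

Lemma virt_root r : virt (troot T) r = k%:R.
Proof.
rewrite /virt y_root /cap (negbTE root_nonleaf); under eq_bigr do rewrite mulrC.
exact: sum_delta ord_max (fun j : 'I_k.+1 => j%:R).
Qed.

Lemma virt_leaf i r : is_leaf i -> virt i r = 1 - y i r ord0.
Proof.
move=> hi; rewrite -(y_dist i r).2 [X in _ = X - _](bigD1 ord0) //= addrAC subrr add0r.
rewrite /virt (bigD1 ord0) //= /cap hi eqxx mul0r add0r.
by apply: eq_bigr => j ->; rewrite mul1r.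
Qed.

Lemma virt_children p r : ~~ is_leaf p -> \sum_(c | is_child c p) virt c r <= virt p r.
Proof.
move=> hp.
have -> : virt p r = E p r (fun s => (lastq quotaf (init_quota p) s)%:R).
  rewrite (mean_last (mk := star_request p) (fun _ _ _ => erefl) (y_dist p) (y_nil p) r
    (fun j : 'I_k.+1 => j%:R)).
  by apply: eq_bigr => j _; rewrite /cap (negbTE hp) mulrC.
apply: le_trans (_ : _ <= \sum_(c | is_child c p)
    E p r (fun s => \sum_(j < k.+1) j%:R * alg p s (enum_rank c) j)) _.
  apply: ler_sum => c hc; rewrite mean_sum; last exact: y_dist.
  apply: ler_sum => j _; rewrite meanZ; last exact: y_dist.
  rewrite (y_child (is_child_neq_troot hc)) (is_child_parent hc).
  apply: ler_wpM2r; last exact: cap_le.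
  apply: mean_ge0 => [|s _]; first exact: y_dist.
  by have [] := alg_state p s.
rewrite -mean_sum; last exact: y_dist.
apply: mean_le => [|s _]; first exact: y_dist.
have [h0 _ h] := alg_state p s; apply: le_trans h.
rewrite [leRHS](eq_bigr (fun i => (fun c => \sum_(j < k.+1) j%:R * alg p s (enum_rank c) j) (enum_val i)))
  => [|i _]; last by rewrite /= enum_valK.
rewrite (sum_enum_val (fun c => \sum_(j < k.+1) j%:R * alg p s (enum_rank c) j)).
rewrite [leLHS]big_mkcond; apply: ler_sum => c _; case: ifP => // _.
by apply: sumr_ge0 => j _; apply: mulr_ge0.
Qed.

Lemma init_count_leaf (i : leaves T) : init_count (val i) = [exists b : 'I_k, c0 b == i].
Proof.
rewrite init_countE; have E b : in_subtree (val i) (val (c0 b)) = (c0 b == i).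
  by rewrite leaf_subtree ?(valP i).
under eq_bigr do rewrite E.
have [/existsP[b /eqP hb]|hn] := boolP [exists b : 'I_k, c0 b == i].
  rewrite (bigD1 b) //= hb eqxx big1 // => b' hb'.
  by case: eqP => // e; case/eqP: hb'; apply: c0_inj; rewrite e.
by rewrite big1 // => b _; move/existsPn/(_ b): hn => /negbTE ->.
Qed.

Lemma virt_nil p : virt p [::] = (init_count p)%:R.
Proof.
rewrite /virt; under eq_bigr do rewrite y_nil mulrC.
rewrite (sum_delta (init_quota p) (cap p)) /cap; case: ifP => hp; last by rewrite init_quotaE.
rewrite -val_eqE /= init_quotaE -[p]/(val (Sub p hp : leaves T)) init_count_leaf.
by case: [exists b, _].
Qed.

(** The mixture of the virtual configuration, with weight [1 - eta], and of all [k] servers at [a],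
    with weight [eta], then cut to 1 at [a]. Mixing keeps the root at [k] and every node at least
    the sum of its children. *)
Definition target r a p : R :=
  let eta := y (val a) (rcons r a) ord0 in
  if p == val a then 1
  else (1 - eta) * virt p (rcons r a) + eta * (k%:R * (in_subtree p (val a))%:R).

Lemma y_unit p r j : 0 <= y p r j <= 1.
Proof.
have [h0 h1] := y_dist p r; rewrite h0 -h1 (bigD1 j) //= lerDl.
by apply: sumr_ge0.
Qed.

Lemma k_ge2 : 2 <= k%:R :> R.
Proof. by rewrite (ler_nat _ 2). Qed.

(** At [a] the mixture holds [(1 - eta) ^+ 2 + k * eta], at least 1 because [k >= 2]; setting the
    value to 1 therefore only lowers it. *)
Lemma target_le r a p : target r a p <=
  (1 - y (val a) (rcons r a) ord0) * virt p (rcons r a) +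
  y (val a) (rcons r a) ord0 * (k%:R * (in_subtree p (val a))%:R).
Proof.
rewrite /target; case: eqP => // ->; rewrite in_subtree_refl mulr1 virt_leaf ?(valP a) //.
have := y_unit (val a) (rcons r a) ord0; have := k_ge2.
move: (y _ _ _) (k%:R) => u v; nra.
Qed.

Lemma target_children r a p : ~~ is_leaf p ->
  \sum_(c | is_child c p) target r a c <= target r a p.
Proof.
move=> hp; have hpa : (p == val a) = false.
  by apply: contraNF hp => /eqP ->; apply: (valP a).
apply: le_trans (ler_sum _ (fun c _ => target_le r a c)) _.
have := y_unit (val a) (rcons r a) ord0.
rewrite /target hpa big_split /= -!mulr_sumr -natr_sum sum_child_in_subtree eq_sym hpa andbT.
move=> /andP[h0 h1]; rewrite lerD2r; apply: ler_wpM2l; first by lra.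
exact: virt_children.
Qed.

Lemma target_ge0 r a p : 0 <= target r a p.
Proof.
rewrite /target; case: ifP => // _; have /andP[h0 h1] := y_unit (val a) (rcons r a) ord0.
apply: addr_ge0; apply: mulr_ge0 => //; [lra|exact: virt_ge0|exact: mulr_ge0].
Qed.

Lemma target_root r a : target r a (troot T) = k%:R.
Proof.
rewrite /target (_ : _ == _ = false); last first.
  by apply: contraNF root_nonleaf => /eqP ->; apply: (valP a).
rewrite virt_root in_subtree_troot mulr1; ring.
Qed.

Lemma target_dist r a p : `|target r a p - virt p (rcons r a)| <=
  k%:R * y (val a) (rcons r a) ord0.
Proof.
have := y_unit (val a) (rcons r a) ord0; have := k_ge2; rewrite /target; case: eqP => [->|_].
  rewrite virt_leaf ?(valP a) // opprB addrC subrK.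
  move: (y _ _ _) (k%:R) => u v h1 h2; rewrite ger0_norm; nra.
have := virt_ge0 p (rcons r a); have := virt_le p (rcons r a).
move: (virt _ _) (y _ _ _) (k%:R) => w u v h1 h2 h3 /andP[h4 h5]; rewrite ler_norml.
have p1 : 0 <= u * w by apply: mulr_ge0.
have p2 : 0 <= u * (v - w) by apply: mulr_ge0 => //; lra.
by case: (in_subtree _ _); rewrite ?mulr1 ?mulr0 ?addr0; apply/andP; split; nra.
Qed.

Definition pull_spec (q v q' : T -> R) (a : T) :=
  [/\ additive_mass q', forall i, is_leaf i -> 0 <= q' i <= 1,
    q' (troot T) = q (troot T), q' a = 1 &
    forall j, `|q' j - q j| + `|q' j - v j| <= `|q j - v j|].

(** On valid configurations [pull] supplies the witness, so the default [q] is never met there. *)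
Definition pulled (q v : T -> R) (a : T) : T -> R :=
  if pselect (exists q', pull_spec q v q' a) is left h then sval (cid h) else q.

Definition config : seq (leaves T) -> T -> R :=
  rrec (fun p => (init_count p)%:R) (fun r a q => pulled q (target r a) (val a)).

Lemma config_nil p : config [::] p = (init_count p)%:R.
Proof. by []. Qed.

Definition valid_config (q : T -> R) :=
  [/\ additive_mass q, forall i, is_leaf i -> 0 <= q i <= 1 & q (troot T) = k%:R].

Lemma pulledP q r a : valid_config q ->
  pull_spec q (target r a) (pulled q (target r a) (val a)) (val a).
Proof.
move=> [h1 h2 h3]; rewrite /pulled; case: pselect => [h|[]]; first by case: cid.
apply: pull => //; first exact: (valP a).
- by move=> p hp; apply: target_children.
- by move=> p; apply: target_ge0.
- by rewrite target_root h3.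
- by rewrite /target eqxx.
Qed.

Lemma config_valid r : valid_config (config r).
Proof.
elim/last_ind: r => [|r a IH].
  split=> [p hp|i hi|]; rewrite ?config_nil ?init_count_troot //.
    rewrite -natr_sum init_count_children init_countE; congr _%:R.
    apply: eq_bigr => a _; rewrite (_ : val (c0 a) != p) ?andbT //.
    by apply: contraNneq hp => <-; apply: (valP (c0 a)).
  rewrite -[i]/(val (Sub i hi : leaves T)) init_count_leaf.
  by case: [exists b, _]; rewrite /= ?lexx ?ler01.
rewrite /config rrec_rcons -/config; have [_ _ h4] := IH.
by have [h1 h2 h3 _ _] := pulledP r a IH; split; rewrite ?h3.
Qed.

Lemma config_step r a :
  pull_spec (config r) (target r a) (config (rcons r a)) (val a).
Proof. by rewrite /config rrec_rcons; apply/pulledP/config_valid. Qed.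

Definition kalg : kserver_alg T := fun r i => config r (val i).

Lemma kalg_mass r p : mass (kalg r) p = config r p.
Proof. by apply: mass_additive; have [] := config_valid r. Qed.

Lemma kalg_fractional : is_fractional_kserver c0 kalg.
Proof.
split=> [i|r i|r|r i].
- by rewrite /kalg config_nil init_count_leaf.
- by have [_ h _] := config_valid r; apply: h; apply: (valP i).
- have := kalg_mass r (troot T); have [_ _ ->] := config_valid r; rewrite /mass => <-.
  by rewrite le_eqVlt; apply/orP; left; apply/eqP/eq_bigl => i; rewrite in_subtree_troot.
- by have [_ _ _ h _] := config_step r i.
Qed.

Definition miss_mass r : R := \sum_(0 <= t < size r) y (rho r t) (take t.+1 r) ord0.

Lemma miss_mass_rcons r a :
  miss_mass (rcons r a) = miss_mass r + y (val a) (rcons r a) ord0.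
Proof.
rewrite /miss_mass size_rcons big_nat_recr //= -(size_rcons r a) take_size rho_last.
congr (_ + _); apply: eq_big_nat => t /andP[_ ht].
by rewrite take_rcons_le // -cats1 rho_prefix.
Qed.

Lemma kserver_cost_rcons (A : kserver_alg T) r a : kserver_cost A (rcons r a) =
  kserver_cost A r + \sum_(j : T | j != troot T)
    weight j * `|mass (A (rcons r a)) j - mass (A r) j|.
Proof.
pose F r' t := \sum_(j : T | j != troot T)
  weight j * `|mass (A (take t.+1 r')) j - mass (A (take t r')) j|.
rewrite /kserver_cost -!(big_mkord predT (F _)) size_rcons big_nat_recr //=; congr (_ + _).
  by apply: eq_big_nat => t /andP[_ ht]; rewrite /F !take_rcons_le // ltnW.
by rewrite /F -{1}(size_rcons r a) take_size take_rcons_le // take_size.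
Qed.

(** A pull towards the target is paid by the shrinking distance, the drift of [virt] by [move_mass],
    and the two passages between [virt] and the target by the miss term. *)
Lemma kalg_cost_potential r :
  kserver_cost kalg r + \sum_(j : T | j != troot T) weight j * `|config r j - virt j r| <=
  \sum_(j : T | j != troot T) move_mass j r + miss_cost * miss_mass r.
Proof.
elim/last_ind: r => [|r a IH].
  rewrite /kserver_cost big_ord0 /miss_mass big_geq // mulr0 addr0 add0r.
  by apply: ler_sum => j hj; rewrite config_nil virt_nil subrr normr0 mulr0 /move_mass big_geq ?mulr0.
rewrite kserver_cost_rcons miss_mass_rcons mulrDr.
under [X in _ <= X + _]eq_bigr do rewrite move_mass_rcons.
rewrite big_split /=; set eta := y (val a) (rcons r a) ord0.
have key : \sum_(j : T | j != troot T) weight j *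
      `|mass (kalg (rcons r a)) j - mass (kalg r) j| +
    \sum_(j : T | j != troot T) weight j * `|config (rcons r a) j - virt j (rcons r a)| <=
    \sum_(j : T | j != troot T) weight j * `|config r j - virt j r| +
    \sum_(j : T | j != troot T) weight j * cdf_dist (y j r) (y j (rcons r a)) +
    miss_cost * eta.
  have -> : miss_cost * eta = \sum_(j : T | j != troot T) weight j * (2 * (k%:R * eta)).
    by rewrite -mulr_suml /miss_cost /total_weight; ring.
  rewrite -!big_split; apply: ler_sum => j hj /=; rewrite -!mulrDr.
  apply: ler_wpM2l; first exact/ltW/weight_gt0.
  rewrite !kalg_mass; have [_ _ _ _ /(_ j) h1] := config_step r a.
  have h2 := target_dist r a j; have h3 := virt_dist j r (rcons r a).
  have h4 := ler_distD (target r a j) (config (rcons r a) j) (virt j (rcons r a)).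
  have h5 := ler_distD (virt j (rcons r a)) (config r j) (target r a j).
  have h6 := ler_distD (virt j r) (config r j) (virt j (rcons r a)).
  rewrite distrC in h3; rewrite [`|virt j (rcons r a) - target r a j|]distrC in h5.
  rewrite -/eta in h2; lra.
move: IH key; set a1 := \sum_(j | _) _; set a2 := \sum_(j | _) _; set a3 := \sum_(j | _) _.
set a4 := \sum_(j | _) _; set a5 := \sum_(j | _) _; lra.
Qed.

Lemma kalg_cost r : kserver_cost kalg r <=
  \sum_(j : T | j != troot T) move_mass j r + miss_cost * miss_mass r.
Proof.
apply: le_trans (kalg_cost_potential r); rewrite lerDl; apply: sumr_ge0 => j hj.
by apply: mulr_ge0 => //; exact/ltW/weight_gt0.
Qed.

(** * Compounding of the potential along the levels *)

Definition growth : R := (1 + eps + 4 / sigma * gamma) * (1 + 2 / sigma).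

Lemma growth_ge1 : 1 <= growth.
Proof.
have h := sigma_ge2; have h2 : 0 <= 2 / sigma by apply: divr_ge0; lra.
have h4 : 0 <= 4 / sigma * gamma by apply: mulr_ge0 => //; apply: divr_ge0; lra.
have h5 := eps_ge0; rewrite /growth; nra.
Qed.

Definition level_potential r m : R := \sum_(p : T | level p == m) potential p r.

Lemma level_potential0 r : level_potential r 0 = potential (troot T) r.
Proof. by rewrite /level_potential (big_pred1 (troot T)) // => p; rewrite /= level_eq0. Qed.

Lemma level_potentialS r m : level_potential r m.+1 <= growth * level_potential r m.
Proof.
have -> : level_potential r m.+1 =
    \sum_(p : T | ~~ is_leaf p) if level p == m then \sum_(c | is_child c p) potential c r else 0.
  transitivity (\sum_(c : T | c != troot T) if level c == m.+1 then potential c r else 0).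
    rewrite -big_mkcondr; apply: eq_bigl => c.
    by case: eqP => [h|]; rewrite ?andbF // -level_eq0 h.
  rewrite -sum_child; apply: eq_bigr => p _; case: ifP => hp.
    by apply: eq_bigr => c hc; rewrite (child_level hc) eqSS hp.
  by rewrite big1 // => c hc; rewrite (child_level hc) eqSS hp.
rewrite /level_potential mulr_sumr big_mkcond [leRHS]big_mkcond; apply: ler_sum => p _ /=.
have hg : 0 <= growth * potential p r.
  apply: mulr_ge0; last exact: potential_ge0.
  exact: le_trans ler01 growth_ge1.
case: ifP => hp; case: ifP => // _.
by rewrite /growth -mulrA; apply: sum_potential_children.
Qed.

Lemma level_potential_le r m : level_potential r m <= growth ^+ m * potential (troot T) r.
Proof.
elim: m => [|m IH]; first by rewrite level_potential0 expr0 mul1r.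
apply: le_trans (level_potentialS r m) _; rewrite exprS -mulrA.
by apply: ler_wpM2l => //; apply: le_trans ler01 growth_ge1.
Qed.

Lemma sum_potential_le r (P : pred T) N : (forall p, P p -> level p < N)%N ->
  \sum_(p | P p) potential p r <= N%:R * growth ^+ N * potential (troot T) r.
Proof.
move=> hP; apply: le_trans (_ : _ <= \sum_(m < N) level_potential r m) _.
  rewrite /level_potential.
  under [leRHS]eq_bigr do rewrite big_mkcond.
  rewrite exchange_big big_mkcond; apply: ler_sum => p _ /=; case: ifP => hp.
    rewrite (bigD1 (Ordinal (hP p hp))) //= eqxx lerDl.
    by apply: sumr_ge0 => m _; case: ifP => // _; apply: potential_ge0.
  by apply: sumr_ge0 => m _; case: ifP => // _; apply: potential_ge0.
apply: le_trans (_ : _ <= \sum_(m < N) growth ^+ N * potential (troot T) r) _.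
  apply: ler_sum => m _; apply: le_trans (level_potential_le r m) _.
  apply: ler_wpM2r; first exact: potential_ge0.
  by apply: ler_weXn2l; [exact: growth_ge1|exact: ltnW].
by rewrite sumr_const card_ord -[leLHS]mulr_natl mulrA.
Qed.

Lemma sum_move_mass r : \sum_(j : T | j != troot T) move_mass j r <=
  gamma * (1 + 2 / sigma) * ((depth T).+1%:R * growth ^+ (depth T).+1 * potential (troot T) r).
Proof.
rewrite -sum_child.
apply: le_trans (ler_sum _ (fun p hp => sum_move_children r hp)) _.
under eq_bigr do rewrite mulrA.
rewrite -mulr_sumr; apply: ler_wpM2l.
  apply: mulr_ge0 => //; have h := sigma_ge2.
  by apply: addr_ge0 => //; apply: divr_ge0; lra.
by apply: sum_potential_le => p _; rewrite ltnS level_le_depth.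
Qed.

(** Each request is a leaf, so its miss probability occurs among the terms that [potential_leaf]
    charges to the leaves. *)
Lemma sum_miss_mass r : miss_cost * miss_mass r <=
  (depth T).+1%:R * growth ^+ (depth T).+1 * potential (troot T) r.
Proof.
apply: le_trans (_ : _ <= \sum_(i : T | is_leaf i) potential i r) _; last first.
  by apply: sum_potential_le => p _; rewrite ltnS level_le_depth.
apply: le_trans (ler_sum _ (fun i hi => potential_leaf r hi)).
rewrite -mulr_sumr; apply: ler_wpM2l; first exact: miss_cost_ge0.
rewrite exchange_big /miss_mass !big_nat; apply: ler_sum => t /andP[_ ht] /=.
have hl : is_leaf (rho r t).
  rewrite /rho (nth_map (nth (c0 (Ordinal (ltnW k_gt1))) r t)) //; exact: valP.
rewrite (bigD1 (rho r t)) //= eqxx mul1r lerDl; apply: sumr_ge0 => i _.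
by apply: mulr_ge0 => //; case/andP: (y_unit i (take t.+1 r) ord0).
Qed.

Lemma kalg_cost_le r : kserver_cost kalg r <=
  (gamma * (1 + 2 / sigma) + 1) * ((depth T).+1%:R * growth ^+ (depth T).+1) *
  sopt (rho r) (troot T) (size r) (fun=> k).
Proof.
apply: le_trans (kalg_cost r) _.
apply: le_trans (lerD (sum_move_mass r) (sum_miss_mass r)) _.
rewrite -{2}[(depth T).+1%:R * _ * _]mul1r -mulrDl -[leRHS]mulrA.
have h := sigma_ge2; apply: ler_wpM2l.
  apply: addr_ge0 => //; apply: mulr_ge0 => //; apply: addr_ge0 => //.
  by apply: divr_ge0; lra.
apply: ler_wpM2l; last exact: potential_root.
apply: mulr_ge0 => //; apply: exprn_ge0; exact: le_trans ler01 growth_ge1.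
Qed.

End Reduction.

(** * Competitive ratio *)

Lemma exists_kserver_alg (R : realType) (T : weighted_tree R) (k : nat) (sigma eps gamma : R)
    (c0 : 'I_k -> leaves T) :
  2 <= sigma -> is_hst T sigma -> 0 <= eps -> 0 <= gamma ->
  alloc_competitive k (1 + eps) gamma%:E -> (1 < k)%N -> injective c0 ->
  ~~ is_leaf (troot T) ->
  exists A : kserver_alg T, is_fractional_kserver c0 A /\ forall r,
    kserver_cost A r <= (gamma * (1 + 2 / sigma) + 1) *
      ((depth T).+1%:R * growth sigma eps gamma ^+ (depth T).+1) * kserver_opt c0 r.
Proof.
move=> hs hst heps hgamma halloc hk hinj hroot.
have [y [y_root y_child]] := top_down_rec (fun=> delta R ord_max)
  (fun (c : T) (yp : seq (leaves T) -> 'I_k.+1 -> R) r j =>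
     mean (@quota R k #|T|) (star_request hs hst c0 (parent c)) (init_quota c0 (parent c)) yp r
       (fun s => alg c0 halloc (parent c) s (enum_rank c) j)).
exists (kalg c0 y); split.
  exact: (kalg_fractional y_root y_child hk hinj hroot).
move=> r; apply: le_trans (kalg_cost_le heps hgamma y_root y_child hk hinj hroot r) _.
apply: ler_wpM2l; last by apply: (sopt_le_opt hs hst); apply: ltnW.
apply: mulr_ge0.
  apply: addr_ge0 => //; apply: mulr_ge0 => //; apply: addr_ge0 => //; apply: divr_ge0; lra.
apply: mulr_ge0 => //; apply: exprn_ge0.
exact: le_trans ler01 (growth_ge1 hs heps hgamma).
Qed.

(* For [k = 1] and [eps = 1] the movement cost would have to vanish, although a
   drop of the quota from 1 to 0 forces the server to leave. *)
Lemma alloc_competitive1_false (R : realType) (b : R) :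
  ~ alloc_competitive 1 (1 + 1) (log_ratio b 1 1).
Proof.
move=> h; pose x0 : state R 1 1 := fun _ j => (j == ord_max)%:R.
have hx0 : is_state ord_max x0.
  split=> [i j|i|]; first exact: ler0n.
    by rewrite /x0 big_ord_recl big_ord1 /= add0r.
  by rewrite /x0 big_ord1 big_ord_recl big_ord1 /= mulr0 add0r mulr1.
have hint : is_integral x0 by move=> i j; rewrite /x0; case: eqP; [right|left].
have [A hA] := h 1%N (fun=> 1) (fun=> ltr01) ord_max x0 hx0 hint.
pose q : request R 1 1 := @Request R 1 1 ord0 ord0 (fun=> 0) (fun _ _ _ => lexx _) (fun=> lexx _).
have [[A0 As] _] := hA [:: q].
rewrite /log_ratio oner_eq0 /logb divr1 ln1 mul0r mul0e lee_fin leNgt; case/negP.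
have [p0 p1 p2] := As ord0; rewrite (tnth_nth q) /= in p2.
have e0 : run A [:: q] 0 ord0 ord0 = 0 by rewrite A0.
set x := run A [:: q] (ord0 : 'I_1).+1 in p0 p1 p2.
have e1 : x ord0 ord_max = 0.
  apply/eqP; rewrite eq_le p0 andbT; move: p2.
  rewrite big_ord1 big_ord_recl big_ord1 (_ : lift _ _ = ord_max); last exact: val_inj.
  by rewrite /= mul0r add0r mul1r.
have e2 : x ord0 ord0 = 1.
  have := p1 ord0; rewrite big_ord_recl big_ord1 (_ : lift _ _ = ord_max) ?e1 ?addr0 //.
  exact: val_inj.
rewrite /movement_cost !big_ord1 mul1r (bigD1 ord_max) //= ltr_wpDr ?sumr_ge0 //.
rewrite /below !(big_pred1 ord0); try by case=> -[|[]].
by rewrite e0 -/x e2 subr0 normr1.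
Qed.

Theorem theorem2p2 (R : realType) (b : R) (hb : 1 < b) :
  exists c C : R, [/\ 0 < c, 0 < C &
    forall (k : nat) (sigma : R) (T : weighted_tree R),
      (0 < k)%N ->
      is_hst T sigma ->
      (forall eps : R, 0 <= eps <= 1 ->
         alloc_competitive k (1 + eps) (log_ratio b k eps)) ->
      c * ((depth T)%:R * logb b (k * depth T)%:R) <= sigma ->
      kserver_competitive T k
        (C * ((depth T)%:R * logb b (k * depth T)%:R))].
Proof.
have lnb : 0 < ln b by apply: ln_gt0.
(* The least value of the logarithm once [k * depth T >= 2]; additive constants become multiples of
   it. *)
set g2 := logb b 2; have hg2 : 0 < g2.
  by apply: divr_gt0 => //; apply: ln_gt0; rewrite ltr1n.
(* The summand 4 of [c] gives [4 / sigma * gamma <= 1 / l], and [2 / g2] gives [2 * l <= sigma]. In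
   [C], [expR 8] bounds the growth over all levels; the other factor absorbs [l + 1 <= 2 * l],
   [1 + 2 / sigma <= 2] and the 1 contributed by the misses. *)
exists (4 + 2 / g2), (2 * (2 + g2^-1) * sequences.expR 8); split.
- by apply: ltr_wpDr => //; apply/ltW/divr_gt0.
- by apply: mulr_gt0; [apply: mulr_gt0 => //; apply: addr_gt0 => //; rewrite invr_gt0|exact: expR_gt0].
move=> k sigma T k_gt0 hst halloc hsigma c0 c0_inj.
have [k1|k_gt1] : k = 1%N \/ (1 < k)%N by lia.
  subst k; have := halloc 1; rewrite ler01 lexx => /(_ isT) h.
  by case: (alloc_competitive1_false h).
(* A one-node tree has a single leaf, too few for [k >= 2] distinct starting positions. *)
have root_nonleaf : ~~ is_leaf (troot T).
  apply/negP => hr; have e (i : leaves T) : val i = troot T.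
    by apply/eqP; rewrite -(leaf_subtree _ hr) in_subtree_troot.
  have : c0 (Ordinal k_gt0) = c0 (Ordinal k_gt1) by apply: val_inj; rewrite !e.
  by move/c0_inj/(congr1 val).
set l := depth T in hsigma *; have l_gt0 : (0 < l)%N.
  exact: leq_ltn_trans (leq0n _) (nonleaf_level root_nonleaf).
have l2 : (l.+1 <= 2 * l)%N by rewrite mul2n -addnn -addn1 leq_add2l.
set gamma := logb b (k * l)%:R in hsigma *.
have lR : 1 <= l%:R :> R by rewrite (ler_nat _ 1).
have hgam : g2 <= gamma.
  rewrite /g2 /gamma /logb ler_pM2r ?invr_gt0 // ler_ln ?posrE ?ltr0n ?muln_gt0 ?k_gt0 ?l_gt0 //.
  by rewrite (ler_nat _ 2) -[2%N]muln1; apply: leq_mul.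
(* The choice [eps = 1 / l] turns [log_ratio] into [logb b (k * l)]. *)
have heps : 0 <= (l%:R^-1 : R) <= 1 by rewrite invr_ge0 ler0n invf_le1 // ltr0n.
have hal := halloc _ heps.
have eg : log_ratio b k l%:R^-1 = gamma%:E.
  rewrite /log_ratio invr_eq0 pnatr_eq0 eqn0Ngt l_gt0 /= invrK /gamma.
  by rewrite natrM.
rewrite eg in hal.
have hlg : l%:R * g2 <= l%:R * gamma by apply: ler_wpM2l.
have s4 : 4 * (l%:R * gamma) <= sigma.
  apply: le_trans hsigma; apply: ler_wpM2r; first by apply: mulr_ge0 => //; lra.
  by rewrite lerDl; apply/ltW/divr_gt0.
have s2 : 2 * l%:R <= sigma.
  apply: le_trans hsigma.
  apply: le_trans (_ : 2 / g2 * (l%:R * gamma) <= _).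
    have -> : 2 * l%:R = 2 / g2 * (l%:R * g2) by field; rewrite gt_eqF.
    by apply: ler_wpM2l => //; apply/ltW/divr_gt0.
  apply: ler_wpM2r; first by apply: mulr_ge0 => //; lra.
  by rewrite lerDr.
have sigma_ge2 : 2 <= sigma by lra.
have gam0 : 0 <= gamma by lra.
have sigma_gt0 : 0 < sigma by lra.
have [A [hA hcost]] := exists_kserver_alg sigma_ge2 hst (proj1 (andP heps)) gam0 hal k_gt1 c0_inj root_nonleaf.
exists A; split=> // r; apply: le_trans (hcost r) _.
have opt0 : 0 <= kserver_opt c0 r.
  by apply: le_trans (sopt_le_opt sigma_ge2 hst c0 r k_gt0); apply: (sopt_ge0 sigma_ge2 hst).
apply: ler_wpM2r => //; rewrite -/l.
have h2 : 2 / sigma <= l%:R^-1.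
  by rewrite ler_pdivrMr // [leRHS]mulrC ler_pdivlMr ?ltr0n //; lra.
have h4 : 4 / sigma * gamma <= l%:R^-1.
  by rewrite mulrAC ler_pdivrMr // [leRHS]mulrC ler_pdivlMr ?ltr0n //; lra.
have hgr : growth sigma l%:R^-1 gamma <= sequences.expR (2 / l%:R) ^+ 2.
  have hx : 0 <= l%:R^-1 :> R by case/andP: heps.
  have h20 : 0 <= 2 / sigma by apply: divr_ge0; lra.
  have h40 : 0 <= 4 / sigma * gamma by apply: mulr_ge0 => //; apply: divr_ge0; lra.
  have he := expR_ge1Dx (2 / l%:R : R).
  rewrite /growth expr2; apply: ler_pM; [lra|lra|lra|lra].
have hgr1 : 1 <= growth sigma l%:R^-1 gamma by apply: growth_ge1 => //; case/andP: heps.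
(* Both factors of [growth] are at most [1 + 2 / l <= expR (2 / l)]; the power [l + 1 <= 2 * l] then
   gives the exponent [2 / l * 2 * (2 * l) = 8]. *)
have hK : growth sigma l%:R^-1 gamma ^+ l.+1 <= sequences.expR 8.
  apply: le_trans (_ : growth sigma l%:R^-1 gamma ^+ (2 * l)%N <= _).
    exact: (ler_weXn2l hgr1 l2).
  apply: le_trans (_ : (sequences.expR (2 / l%:R) ^+ 2) ^+ (2 * l)%N <= _).
    by apply: lerXn2r => //; rewrite nnegrE; [lra|exact: exprn_ge0 (expR_ge0 _)].
  rewrite -exprM -expRM_natl le_eqVlt; apply/orP; left; apply/eqP; congr sequences.expR.
  rewrite !natrM; field; by rewrite pnatr_eq0 -lt0n.
have hf : (gamma * (1 + 2 / sigma) + 1) * l.+1%:R <= 2 * (2 + g2^-1) * (l%:R * gamma).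
  have hi : 1 <= g2^-1 * gamma by rewrite mulrC ler_pdivlMr // mul1r.
  have hl1 : l.+1%:R <= 2 * l%:R :> R by rewrite -natrM ler_nat.
  have h21 : 2 / sigma <= 1 by apply: two_sigma.
  apply: le_trans (_ : (2 * gamma + g2^-1 * gamma) * (2 * l%:R) <= _); last by lra.
  apply: ler_pM => //; first by have : 0 <= 2 / sigma by [apply: divr_ge0; lra]; nra.
  nra.
rewrite mulrA; apply: le_trans (_ : 2 * (2 + g2^-1) * (l%:R * gamma) * sequences.expR 8 <= _); last by lra.
apply: ler_pM => //.
  by apply: mulr_ge0 => //; have : 0 <= 2 / sigma by [apply: divr_ge0; lra]; nra.
by apply: exprn_ge0; lra.
Qed.
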